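(* Let $N>1$ be an integer and let $\Omega\subset\mathbb{R}^N$ be an open, bounded and connected set having Lipschitz boundary and satisfying the uniform interior sphere condition. Let $p>1$, $\gamma>p$, $\lambda\ge 0$, $\nu>0$, $c_H>0$, $q\ge 1$ with $q>\frac{N}{\gamma}$, and let $f\in\mathcal{L}^{1,\frac{N}{q}}(\Omega)$. Let $\mathcal{A}:\Omega\times\mathbb{R}\times\mathbb{R}^N\to\mathbb{R}^N$ be a Carathéodory function such that $$|\mathcal{A}(x,s,\xi)|\le \nu|\xi|^{p-1}\quad\text{for every }(s,\xi)\in\mathbb{R}\times\mathbb{R}^N\text{ and a.e. }x\in\Omega,$$ and let $\mathcal{B}_1:\Omega\times\mathbb{R}\times\mathbb{R}^N\to\mathbb{R}$ satisfy $$\mathcal{B}_1(x,s,\xi)\ge c_H|\xi|^\gamma-\lambda s-f(x)\quad\text{for every }(s,\xi)\in\mathbb{R}\times\mathbb{R}^N\text{ and a.e. }x\in\Omega.$$ Let $u\in W^{1,\gamma}_{\mathrm{loc}}(\Omega)$ be such that $\lambda u^+\in\mathcal{L}^{1,\frac{N}{q}}(\Omega)$ and such that $u$ satisfies, in the sense of distributions, the inequality $$-\mathrm{div}(\mathcal{A}(x,u,\nabla u))\ge \mathcal{B}_1(x,u,\nabla u)\quad\text{in }\Omega.$$ Then $u$ (up to modification on a null set and extension to $\partial\Omega$) is Hölder continuous up to the boundary, i.e. in the whole of $\overline\Omega$, and satisfies $$|u(x)-u(y)|\le K|x-y|^\alpha\qquad\forall x,y\in\overline\Omega,$$ where $$\alpha=\min\left\{1-\frac{N}{q\gamma},\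 \frac{\gamma-p}{\gamma-(p-1)}\right\},$$ and $K$ depends only on $p,q,\gamma,N,\nu,c_H,\Omega$ and $\|f+\lambda u^+\|_{\mathcal{L}^{1,\frac{N}{q}}(\Omega)}$. In particular, the estimate holds when $f,\lambda u^+\in L^q(\Omega)$ with $q>\frac{N}{\gamma}$.
   Context: Notation: $u^+=\max\{u,0\}$. $B_r(z)$ is the Euclidean ball of center $z$ and radius $r$. A Carathéodory function is one that is measurable in $x$ and continuous in the remaining variables $(s,\xi)$. Morrey space: for $s\ge1$ and $\theta\in(0,N]$, $\mathcal{L}^{s,\theta}(\Omega)$ is the space of $h\in L^s(\Omega)$ such that $\int_{B_r(z)\cap\Omega}|h|^s\,dx\le Cr^{N-\theta}$ for all $z\in\Omega$, $r\in(0,\mathrm{diam}(\Omega)]$, with $C$ independent of $z$ and $r$, with norm $\|h\|_{\mathcal{L}^{s,\theta}(\Omega)}=\sup_{z\in\Omega,\,0<r\le\mathrm{diam}(\Omega)} r^{\frac{\theta-N}{s}}\|h\|_{L^s(B_r(z)\cap\Omega)}$. Here $s=1$, $\theta=N/q$. Distributional inequality: $u$ satisfies $-\mathrm{div}(\mathcal{A}(x,u,\nabla u))\ge\mathcal{B}(x,u,\nabla u)$ in $\Omega$ in the sense of distributions (is a distributional supersolution) if $u\in W^{1,p}_{\mathrm{loc}}(\Omega)$, $\mathcal{A}(\cdot,u,\nabla u)\in L^{p'}_{\mathrm{loc}}(\Omega)$ with $p'=\frac{p}{p-1}$, $\mathcal{B}(\cdot,u,\nabla u)\in L^1_{\mathrm{loc}}(\Omega)$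 and $$\int_\Omega\mathcal{A}(x,u,\nabla u)\cdot\nabla\varphi\,dx\ge\int_\Omega\mathcal{B}(x,u,\nabla u)\varphi\,dx\qquad\text{for all }\varphi\in C^1_0(\Omega),\ \varphi\ge0.$$ Lipschitz boundary: in a neighborhood of each $x_0\in\partial\Omega$ the domain $\Omega$ can be represented as the subgraph of a Lipschitz function of $N-1$ variables. Uniform interior sphere condition: there is $r>0$ such that for every $x_0\in\partial\Omega$ there exists a unit vector $\zeta(x_0)$ with $B_r(x_0+r\zeta(x_0))\subset\Omega$. *)

(* Defs.v *)
From HB Require Import structures.
From mathcomp Require Import all_boot all_order all_algebra.
From mathcomp Require Import all_classical all_reals all_analysis.

Set Implicit Arguments.
Unset Strict Implicit.
Unset Printing Implicit Defensive.

Import Order.TTheory GRing.Theory Num.Theory.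
Import numFieldNormedType.Exports.

Local Open Scope classical_set_scope.
Local Open Scope ring_scope.

(* Points of R^n are row vectors 'rV[R]_n.  Their topology is the library's;
   their canonical norm `|x| is the sup norm, so the Euclidean norm is
   introduced separately. *)

Section Euclidean.
Context {R : realType} {n : nat}.
Implicit Types x y z : 'rV[R]_n.

Definition dotp x y : R := \sum_(i < n) x 0 i * y 0 i.

Definition enorm x : R := Num.sqrt (dotp x x).

Definition eball z (r : R) : set 'rV[R]_n := [set x | enorm (x - z) < r].

Definition ediam (D : set 'rV[R]_n) : R :=
  sup [set d | exists x y, [/\ D x, D y & d = enorm (x - y)]].

Definition bdry (D : set 'rV[R]_n) : set 'rV[R]_n := closure D `\` interior D.

End Euclidean.

(* Lebesgue measure on R^n: the n-fold product of the one-dimensional measure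
   on the product (Borel) sigma-algebra, then completed, so that the measurable
   sets are the Lebesgue measurable ones. *)

Section Borel.
Context {R : realType}.

Definition borel_rV (n : nat) : Type := 'rV[R]_n.

HB.instance Definition _ n := Pointed.on (borel_rV n).

Definition rV_coord n (i : 'I_n) (v : borel_rV n) : measurableTypeR R := v 0 i.

Definition borel_rV_display : measure_display.
Proof. exact: (measure_tuple_display default_measure_display). Qed.

Let borel0 n : g_sigma_preimage (@rV_coord n) set0.
Proof. exact: sigma_algebra0. Qed.

Let borelC n A : g_sigma_preimage (@rV_coord n) A ->
  g_sigma_preimage (@rV_coord n) (~` A).
Proof. exact: sigma_algebraC. Qed.

Let borel_bigcup n (F : (set (borel_rV n))^nat) :
  (forall i, g_sigma_preimage (@rV_coord n) (F i)) ->
  g_sigma_preimage (@rV_coord n) (\bigcup_i F i).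
Proof. exact: sigma_algebra_bigcup. Qed.

HB.instance Definition _ n := @isMeasurable.Build borel_rV_display
  (borel_rV n) (g_sigma_preimage (@rV_coord n)) (@borel0 n) (@borelC n)
  (@borel_bigcup n).

Definition rV_cons n (z : measurableTypeR R * borel_rV n) : borel_rV n.+1 :=
  row_mx (z.1%:M : 'rV[R]_1) z.2.

Lemma measurable_rV_coord n (i : 'I_n) : measurable_fun setT (@rV_coord n i).
Proof.
move=> _ Y mY; rewrite setTI; apply: sub_sigma_algebra => /=.
rewrite -bigcup_seq/=; exists i => /=; first by rewrite mem_index_enum.
by exists Y => //; rewrite setTI.
Qed.

Lemma measurable_rV_cons n : measurable_fun setT (@rV_cons n).
Proof.
suff mc i : measurable_fun setT (@rV_coord n.+1 i \o @rV_cons n).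
  have : g_sigma_preimage (fun i => @rV_coord n.+1 i \o @rV_cons n)
           `<=` measurable.
    apply: smallest_sub; first exact: sigma_algebra_measurable.
    rewrite -bigcup_mkord_ord; apply: bigcup_sub => i _.
    by move=> A [B mB <-]; exact: mc.
  rewrite g_sigma_preimage_comp => sub _ A mA.
  by apply: sub; exists A.
case: (splitP (i : 'I_(1 + n))) => [j ij|j ij].
- rewrite (_ : _ \o _ = fst); first exact: measurable_fst.
  apply/funext => -[x v]; rewrite /rV_coord /rV_cons/=.
  have -> : i = lshift n j by exact: val_inj.
  by rewrite (row_mxEl (x%:M : 'rV[R]_1)) mxE !ord1 eqxx.
- rewrite (_ : _ \o _ = rV_coord j \o snd).
    by apply: measurableT_comp => //; exact: measurable_rV_coord.
  apply/funext => -[x v]; rewrite /rV_coord /rV_cons/=.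
  have -> : i = rshift 1 j by exact: val_inj.
  by rewrite (row_mxEr (x%:M : 'rV[R]_1)).
Qed.

Section borel_leb_succ.
Context {n : nat} (m : {measure set (borel_rV n) -> \bar R}).

Definition borel_leb_succ : set (borel_rV n.+1) -> \bar R :=
  pushforward ((@lebesgue_measure R) \x^ m)%E (@rV_cons n).

Let succ0 : borel_leb_succ set0 = 0%E.
Proof. by rewrite /borel_leb_succ /pushforward preimage_set0 measure0. Qed.

Let succ_ge0 A : (0 <= borel_leb_succ A)%E.
Proof.
exact: (@measure_ge0 _ _ _
  (measure_function_pushforward__canonical__measure_function_Measure
    _ (@measurable_rV_cons n))).
Qed.

Let succ_sigma_additive : semi_sigma_additive borel_leb_succ.
Proof.
exact: (@measure_semi_sigma_additive _ _ _
  (measure_function_pushforward__canonical__measure_function_Measure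
    _ (@measurable_rV_cons n))).
Qed.

HB.instance Definition _ := isMeasure.Build _ _ _ borel_leb_succ
  succ0 succ_ge0 succ_sigma_additive.

End borel_leb_succ.

Fixpoint borel_leb (n : nat) : {measure set (borel_rV n) -> \bar R} :=
  if n is n'.+1 then borel_leb_succ (borel_leb n')
  else \d_((0 : 'rV[R]_0) : borel_rV 0).

End Borel.

Section Lebesgue.
Context (R : realType) (n : nat).

Definition leb_type : Type := caratheodory_type (mu_ext (@borel_leb R n)).

Definition leb : set leb_type -> \bar R :=
  @completed_measure_extension _ _ _ (@borel_leb R n).

HB.instance Definition _ := Measure.on leb.

End Lebesgue.

Section Domains.
Context {R : realType} {n : nat}.
Implicit Types D : set 'rV[R]_n.

(* (Q, e) is an orthonormal frame of R^n: the n-1 rows of Q are the horizontal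
   directions and e is the vertical one. *)
Definition lipschitz_boundary D : Prop :=
  forall x0, bdry D x0 ->
  exists (Q : 'M[R]_(n.-1, n)) (e : 'rV[R]_n) (psi : 'rV[R]_(n.-1) -> R),
  [/\ Q *m Q^T = 1%:M, Q *m e^T = 0, enorm e = 1,
      exists L : R, forall y z, `|psi y - psi z| <= L * enorm (y - z) &
      exists2 U : set 'rV[R]_n, nbhs x0 U &
        forall x, U x -> (D x <-> dotp x e < psi (x *m Q^T))].

Definition uniform_interior_sphere D : Prop :=
  exists2 r : R, 0 < r & forall x0, bdry D x0 ->
    exists2 zeta : 'rV[R]_n, enorm zeta = 1 & eball (x0 + r *: zeta) r `<=` D.

End Domains.

Section FunctionSpaces.
Context {R : realType} {n : nat}.
Implicit Types (D : set 'rV[R]_n) (h : 'rV[R]_n -> R) (F : 'rV[R]_n -> 'rV[R]_n).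

Definition Lp_on D (s : R) h : Prop := h \_ D \in Lfun (@leb R n) s%:E.

Definition Lp_loc D (s : R) h : Prop :=
  forall K : set 'rV[R]_n, compact K -> K `<=` D -> Lp_on K s h.

Definition Lp_loc_vec D (s : R) F : Prop :=
  forall i, Lp_loc D s (fun x => F x 0 i).

Definition Lp_norm_on D (s : R) h : \bar R :=
  Lnorm (@leb R n) s%:E (EFin \o (h \_ D)).

Definition morrey D (s theta : R) h : Prop :=
  Lp_on D s h /\
  exists C : R, forall z r, D z -> 0 < r <= ediam D ->
    (\int[@leb R n]_(x in eball z r `&` D) (`|h x| `^ s)%:E
       <= (C * r `^ (n%:R - theta))%:E)%E.

Definition morrey_norm D (s theta : R) h : \bar R :=
  ereal_sup [set t | exists z r, [/\ D z, 0 < r <= ediam D &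
    t = ((r `^ ((theta - n%:R) / s))%:E * Lp_norm_on (eball z r `&` D) s h)%E]].

Definition partial (i : 'I_n) h (x : 'rV[R]_n) : R := 'D_(delta_mx 0 i) h x.

Definition grad h (x : 'rV[R]_n) : 'rV[R]_n := \row_i partial i h x.

Definition C1c D h : Prop :=
  let S := closure [set x | h x != 0] in
  [/\ forall x, differentiable h x, forall i, continuous (partial i h),
      compact S & S `<=` D].

(* First-order weak derivatives are tested against C^1 functions with compact
   support, which is equivalent to testing against smooth ones by
   mollification. *)
Definition weak_gradient D h F : Prop :=
  forall phi, C1c D phi -> forall i,
    (\int[@leb R n]_(x in D) (h x * partial i phi x)%:E =
     - \int[@leb R n]_(x in D) (F x 0 i * phi x)%:E)%E.

(* h belongs to W^{1,s}_loc(D) and F is (a representative of) its gradient. *)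
Definition W1_loc D (s : R) h F : Prop :=
  [/\ Lp_loc D s h, Lp_loc_vec D s F & weak_gradient D h F].

End FunctionSpaces.

Section Equation.
Context {R : realType} {n : nat}.
Implicit Types (D : set 'rV[R]_n)
  (A : 'rV[R]_n -> R -> 'rV[R]_n -> 'rV[R]_n)
  (B : 'rV[R]_n -> R -> 'rV[R]_n -> R)
  (u : 'rV[R]_n -> R) (Du : 'rV[R]_n -> 'rV[R]_n).

Definition ae_in D (P : 'rV[R]_n -> Prop) : Prop :=
  {ae @leb R n, forall x, D x -> P x}.

Definition caratheodory_fun D A : Prop :=
  (forall s xi i, measurable_fun (D : set (leb_type R n))
     (fun x => A x s xi 0 i)) /\
  ae_in D (fun x => continuous (fun z : R * 'rV[R]_n => A x z.1 z.2)).

Definition distributional_supersolution D (p : R) A B u Du : Prop :=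
  [/\ W1_loc D p u Du,
      Lp_loc_vec D (p / (p - 1)) (fun x => A x (u x) (Du x)),
      Lp_loc D 1 (fun x => B x (u x) (Du x)) &
      forall phi, C1c D phi -> (forall x, 0 <= phi x) ->
        (\int[@leb R n]_(x in D) (B x (u x) (Du x) * phi x)%:E <=
         \int[@leb R n]_(x in D) (dotp (A x (u x) (Du x)) (grad phi x))%:E)%E].

Definition holder_up_to_boundary D u (K alpha : R) : Prop :=
  exists v : 'rV[R]_n -> R,
    ae_in D (fun x => v x = u x) /\
    forall x y, closure D x -> closure D y ->
      `|v x - v y| <= K * enorm (x - y) `^ alpha.

End Equation.

(* Main.v *)
(* Testing the inequality with the power [phi = zeta^(m+1)] of a cutoff of the
   cube of side 4 rho and absorbing [A . grad phi] into half of the gradient term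
   bounds the integral of [|Du|^gamma phi] by that of [|f + lambda u^+|] plus a
   power of rho.  The bound [t^(gamma-1) (a - t) <= a^gamma] with
   [t = rho^(alpha-1)] turns this into the L^1 decay
   [int_{Q_rho} |D_i u| <= C rho^(N-1+alpha)], valid as soon as a cube larger by a
   fixed factor lies in Omega.  As in Morrey's lemma, averages of u over neighbouring
   boxes then differ by at most C rho^alpha; the limits of the averages over
   shrinking cubes form a representative v of u that satisfies
   [|v x - v y| <= C |x - y|^alpha] when a ball of radius comparable to |x - y|
   around x lies in Omega.  Near the boundary the Lipschitz condition gives an
   interior cone: both points are pushed inside along the axis of the cone through
   a geometric sequence of steps, at a cost C |x - y|^alpha, so v is Hölder near
   every point of the closure, and connectedness and compactness make the bound
   global. *)
Require Import Defs.
From mathcomp Require Import all_boot all_order all_algebra.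
From mathcomp Require Import all_classical all_reals all_analysis.
From mathcomp Require Import measurable_realfun.
From mathcomp Require Import ring lra.
Set Implicit Arguments.
Unset Strict Implicit.
Unset Printing Implicit Defensive.
Import Order.TTheory GRing.Theory Num.Theory.
Import numFieldNormedType.Exports.
Local Open Scope classical_set_scope.
Local Open Scope ring_scope.


(** * Lebesgue measure of boxes *)

(** Since Lebesgue measure is built as a product, boxes and products of one-variable functions play
    the part of balls and mollifiers. Two averages of [u] are compared by duality: the normalised
    indicators of two boxes have equal mass, so after smoothing their difference is a sum of partial
    derivatives of compactly supported C^1 functions. The weak gradient applies to these directly,
    and [u] is never approximated by smooth functions. The same comparison identifies [v] with [u]:
    it forces [u - v] to have zero integral over small boxes. Since the final constant may depend on
    the solution only through the Morrey norm, the boundary part never sees [u]: it treats at once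
    all the functions that obey one interior estimate. The two terms of alpha are the conditions
    under which the Morrey term and the remainder of the absorbed flux term are both dominated by
    rho^(N-1+alpha). *)

Section ProductSets.
Context {R : realType}.
Implicit Types n : nat.

Definition rV_pset n (B : 'I_n -> set R) : set 'rV[R]_n :=
  [set x | forall i, B i (x 0 i)].

Lemma borel_pset n (B : 'I_n -> set R) :
  (forall i, measurable (B i)) -> measurable (rV_pset B : set (borel_rV n)).
Proof.
move=> mB; rewrite (_ : rV_pset B = \bigcap_(i in [set: 'I_n])
   (@rV_coord R n i @^-1` (B i))); last first.
  by apply/seteqP; split => x /= h i; [move=> _|]; exact: h.
apply: fin_bigcap_measurable => // i _.
by rewrite -[_ @^-1` _]setTI; apply: (@measurable_rV_coord R n i) => //; exact: mB.
Qed.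

Lemma borel_leb_pset n (B : 'I_n -> set R) :
  (forall i, measurable (B i)) ->
  borel_leb n (rV_pset B) = (\prod_i (@lebesgue_measure R) (B i))%E.
Proof.
elim: n B => [|n IH] B mB.
  rewrite /= big_ord0 diracE (_ : _ \in _ = true)//.
  by apply/mem_set => -[].
rewrite /= /borel_leb_succ /pushforward.
rewrite (_ : _ @^-1` _ = B ord0 `*` rV_pset (fun i => B (lift ord0 i))).
  rewrite product_measure2E//; [|exact: mB|exact: borel_pset].
  by rewrite IH// big_ord_recl.
have E0 (z : measurableTypeR R * borel_rV n) : rV_cons z 0 ord0 = z.1.
  rewrite /rV_cons (_ : ord0 = lshift n (ord0 : 'I_1)); last exact: val_inj.
  by rewrite (row_mxEl (z.1%:M : 'rV[R]_1)) mxE eqxx.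
have E1 (z : measurableTypeR R * borel_rV n) i :
    rV_cons z 0 (lift ord0 i) = z.2 0 i.
  rewrite /rV_cons (_ : lift ord0 i = rshift 1 i); last exact: val_inj.
  by rewrite (row_mxEr (z.1%:M : 'rV[R]_1)).
apply/seteqP; split => [z /= h|z /= [h0 h1] i].
  by split=> [|i]; [rewrite -E0|rewrite -E1]; exact: h.
by case: (unliftP ord0 i) => [j ->|->]; rewrite ?E1 ?E0//; exact: h1.
Qed.

Lemma borel_leb_measurable n (A : set 'rV[R]_n) :
  measurable (A : set (borel_rV n)) -> measurable (A : set (leb_type R n)).
Proof. exact: caratheodory_measurable_mu_ext. Qed.

Lemma leb_borel n (A : set 'rV[R]_n) :
  measurable (A : set (borel_rV n)) -> leb A = borel_leb n A.
Proof. by move=> mA; rewrite /leb /completed_measure_extension measurable_mu_extE. Qed.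

Lemma pset_measurable n (B : 'I_n -> set R) :
  (forall i, measurable (B i)) -> measurable (rV_pset B : set (leb_type R n)).
Proof. by move=> mB; apply: borel_leb_measurable; exact: borel_pset. Qed.

Lemma leb_pset n (B : 'I_n -> set R) :
  (forall i, measurable (B i)) ->
  leb (rV_pset B) = (\prod_i (@lebesgue_measure R) (B i))%E.
Proof. by move=> mB; rewrite leb_borel ?borel_leb_pset//; exact: borel_pset. Qed.

(** Half-open, so that a cut across one coordinate leaves two disjoint boxes of the same kind. *)
Definition rV_box n (a b : 'rV[R]_n) : set 'rV[R]_n :=
  rV_pset (fun i => `[a 0 i, b 0 i[%classic).

Definition rV_cbox n (a b : 'rV[R]_n) : set 'rV[R]_n :=
  rV_pset (fun i => `[a 0 i, b 0 i]%classic).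

Lemma prod_EFin n (F : 'I_n -> R) :
  (\prod_i (F i)%:E)%E = (\prod_i F i)%:E.
Proof. by rewrite (big_morph EFin EFinM (erefl 1%E)). Qed.

Lemma leb_box n (a b : 'rV[R]_n) : (forall i, a 0 i <= b 0 i) ->
  leb (rV_box a b) = (\prod_i (b 0 i - a 0 i))%:E.
Proof.
move=> ab; rewrite leb_pset// -prod_EFin; apply: eq_bigr => i _.
rewrite lebesgue_measure_itv/= lte_fin; have := ab i.
by rewrite le_eqVlt => /predU1P[->|->]; rewrite ?ltxx ?subrr// EFinB.
Qed.

Lemma leb_cbox n (a b : 'rV[R]_n) : (forall i, a 0 i <= b 0 i) ->
  leb (rV_cbox a b) = (\prod_i (b 0 i - a 0 i))%:E.
Proof.
move=> ab; rewrite leb_pset// -prod_EFin; apply: eq_bigr => i _.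
rewrite lebesgue_measure_itv/= lte_fin; have := ab i.
by rewrite le_eqVlt => /predU1P[->|->]; rewrite ?ltxx ?subrr// EFinB.
Qed.

Lemma box_measurable n (a b : 'rV[R]_n) :
  measurable (rV_box a b : set (leb_type R n)).
Proof. exact: pset_measurable. Qed.

Lemma cbox_measurable n (a b : 'rV[R]_n) :
  measurable (rV_cbox a b : set (leb_type R n)).
Proof. exact: pset_measurable. Qed.

Lemma rV_normP n (x : 'rV[R]_n) (r : R) : 0 <= r ->
  reflect (forall i, `|x 0 i| <= r) (`|x| <= r).
Proof.
move=> r0; have -> : `|x| = mx_norm x by [].
rewrite mx_normrE; apply: (iffP (bigmax_leP _ _ _ _)).
  by move=> [_ h] i; exact: (h (0, i) isT).
by move=> h; split=> // -[i j] _ /=; rewrite (ord1 i).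
Qed.

Lemma rV_norm_ltP n (x : 'rV[R]_n) (r : R) : 0 < r ->
  reflect (forall i, `|x 0 i| < r) (`|x| < r).
Proof.
move=> r0; have -> : `|x| = mx_norm x by [].
rewrite mx_normrE; apply: (iffP (bigmax_ltP _ _ _ _)).
  by move=> [_ h] i; exact: (h (0, i) isT).
by move=> h; split=> // -[i j] _ /=; rewrite (ord1 i).
Qed.

Lemma coord_le_norm n (x : 'rV[R]_n) i : `|x 0 i| <= `|x|.
Proof. by move: i; apply/rV_normP. Qed.

Lemma cbox_compact n (a b : 'rV[R]_n) : compact (rV_cbox a b).
Proof.
by apply: (@rV_compact _ _ (fun i => `[a 0 i, b 0 i]%classic)) => i; exact: segment_compact.
Qed.

Lemma ball_pset n (z : 'rV[R]_n) (r : R) : 0 < r ->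
  ball z r = rV_pset (fun i => ball (z 0 i) r).
Proof.
move=> r0; rewrite -ball_normE; apply/seteqP; split => x /=.
  move/rV_norm_ltP => /(_ r0) h i; rewrite -ball_normE/=; have := h i.
  by rewrite !mxE.
move=> h; apply/rV_norm_ltP => // i; have := h i.
by rewrite -ball_normE/= !mxE.
Qed.

(** A sup-norm ball is a product of intervals, and countably many rational balls fill an open set.
    This links the topology to a sigma-algebra that is generated by the coordinates. *)
Lemma open_borel n (A : set 'rV[R]_n) : open A -> measurable (A : set (borel_rV n)).
Proof.
move=> oA.
pose c (q : 'rV[rat]_n * rat) : 'rV[R]_n := map_mx ratr q.1.
pose F (q : 'rV[rat]_n * rat) : set 'rV[R]_n :=
  if `[< 0 < q.2 /\ ball (c q) (ratr q.2) `<=` A >] then ball (c q) (ratr q.2)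
  else set0.
have -> : A = \bigcup_q F q.
  apply/seteqP; split => x; last first.
    by move=> [q _]; rewrite /F; case: asboolP => // -[_ ]; exact.
  move=> Ax; have /nbhs_ballP[e /= e0 eA] : nbhs x A by exact: open_nbhs_nbhs.
  have [s] := rat_in_itvoo (divr_gt0 e0 (ltr0n R 2)).
  rewrite in_itv/= => /andP[s0 se].
  have : forall i, exists q : rat, x 0 i - ratr s < ratr q < x 0 i + ratr s.
    move=> i; have [|q] := @rat_in_itvoo R (x 0 i - ratr s) (x 0 i + ratr s).
      by rewrite ltrBlDr -addrA ltrDl addr_gt0.
    by rewrite in_itv/=; exists q.
  move=> /choice[q qP]; exists (\row_i q i, s) => //.
  have xq : ball (c (\row_i q i, s)) (ratr s) x.
    rewrite ball_pset// => i; rewrite -ball_normE/= /c !mxE.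
    by rewrite ltr_distlC; move: (qP i); lra.
  rewrite /F; case: asboolP => // -[]; split; first by rewrite -(ltr0q R).
  move=> y xy; apply: eA; apply: (@le_ball _ _ _ (ratr s + ratr s)).
    by rewrite [leRHS]splitr lerD// ltW.
  by apply: ball_triangle xy; exact: ball_sym.
apply: countable_bigcupT_measurable => [|q]; first exact: countableP.
rewrite /F; case: asboolP => // -[q0 _].
rewrite ball_pset ?ltr0q//; apply: borel_pset => i.
by apply: open_measurable; exact: ball_open.
Qed.

Lemma open_leb_measurable n (A : set 'rV[R]_n) :
  open A -> measurable (A : set (leb_type R n)).
Proof. by move/open_borel/borel_leb_measurable. Qed.

Lemma closed_leb_measurable n (A : set 'rV[R]_n) :
  closed A -> measurable (A : set (leb_type R n)).
Proof.
by move=> cA; rewrite -[A]setCK; apply: measurableC; apply: open_leb_measurable; exact: closed_openC.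
Qed.

Lemma compact_leb_measurable n (A : set 'rV[R]_n) :
  compact A -> measurable (A : set (leb_type R n)).
Proof.
by move=> cA; apply: closed_leb_measurable; apply: compact_closed => //; exact: norm_hausdorff.
Qed.

Lemma open_continuous_leb_measurable n (D : set 'rV[R]_n) (f : 'rV[R]_n -> R) :
  open D -> (forall x, D x -> {for x, continuous f}) ->
  measurable_fun (D : set (leb_type R n)) f.
Proof.
move=> oD cf; apply: (measurability _ (RGenOpens.measurableE R)).
move=> _ [_ [a [b ->] <-]]; apply: open_leb_measurable.
rewrite openE => x [Dx /= fx]; apply: filterI.
  exact: open_nbhs_nbhs.
apply: cf => //; exact: open_nbhs_nbhs.
Qed.

Lemma continuous_leb_measurable n (f : 'rV[R]_n -> R) (D : set 'rV[R]_n) :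
  continuous f -> measurable (D : set (leb_type R n)) ->
  measurable_fun (D : set (leb_type R n)) f.
Proof.
move=> cf mD; apply: (@measurable_funS _ _ _ _ setT) => //.
apply: open_continuous_leb_measurable => [|x _]; [exact: openT|exact: cf].
Qed.

End ProductSets.

(** * Functions with vanishing integrals over boxes *)

Section AeZero.
Context {R : realType} {n : nat}.
Notation mu := (@leb R n).

Global Instance leb_ae_filter : Filter (almost_everywhere mu).
Proof. exact: (ae_filter_ringOfSetsType (mu : {measure set _ -> \bar R})). Qed.

(** The measure of [E] is an infimum over countable Borel covers; intersecting covers of excess
    [1/(k+1)] leaves a null excess. It carries statements about Borel sets over to Lebesgue
    measurable ones. *)
Lemma borel_hull (E : set (leb_type R n)) : measurable E -> (mu E < +oo)%E ->
  exists G : set 'rV[R]_n, [/\ measurable (G : set (borel_rV n)), E `<=` G &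
    mu (G `\` E) = 0%E].
Proof.
move=> mE Eoo.
have Efin : mu E \is a fin_num by rewrite ge0_fin_numE.
have cov k : exists G : set 'rV[R]_n, [/\ measurable (G : set (borel_rV n)),
    E `<=` G & (mu G <= mu E + (k.+1%:R^-1)%:E)%E].
  have [|_ [A [mA EA] <-] Ale] := @lb_ereal_inf_adherent _ _ k.+1%:R^-1 _ Efin.
    by rewrite invr_gt0.
  exists (\bigcup_i A i); split=> //; first exact: bigcup_measurable.
  apply: le_trans (ltW Ale).
  apply: (@le_trans _ _ (\sum_(i <oo) mu (A i))%E).
    apply: (@measure_sigma_subadditive _ _ _ mu) => //.
    - by move=> i; exact: borel_leb_measurable.
    - by apply: borel_leb_measurable; exact: bigcup_measurable.
  apply: lee_nneseries => // i _; rewrite leb_borel//.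
have [G GP] := choice cov.
have mG : measurable (\bigcap_k G k : set (borel_rV n)).
  by apply: bigcap_measurable => // k _; case: (GP k).
exists (\bigcap_k G k); split => //.
  by move=> x Ex k _; case: (GP k) => _ + _; exact.
apply/eqP; rewrite eq_le measure_ge0 andbT; apply/lee_addgt0Pr => e e0.
rewrite add0e; have [k ke] : exists k : nat, k.+1%:R^-1 < e.
  have := @near_infty_natSinv_lt R (PosNum e0) => -[k _ /(_ k (leqnn k))].
  by exists k.
have [mGk EGk Gkle] := GP k.
have mGk' := borel_leb_measurable mGk.
apply: (@le_trans _ _ (mu (G k `\` E))).
  apply: le_measure; rewrite ?inE.
  - by apply: measurableD => //; exact: borel_leb_measurable.
  - exact: measurableD.
  - by move=> x [Gx nEx]; split=> //; exact: Gx.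
have Gkoo : (mu (G k) < +oo)%E.
  by apply: le_lt_trans Gkle _; rewrite lte_add_pinfty// ltry.
rewrite measureD// (setIidr EGk) leeBlDl//.
by apply: (le_trans Gkle); rewrite leeD2l// lee_fin ltW.
Qed.

(** A pi-system that generates the Borel sets. Inside a box with upper corner [b], an orthant cuts
    out a box with the same upper corner, so it is enough to know integrals over such boxes. *)
Definition orthants : set (set 'rV[R]_n) :=
  [set A | exists a : 'rV[R]_n, A = [set x : 'rV[R]_n | forall i, a 0 i <= x 0 i]].

Lemma orthants_setI : setI_closed orthants.
Proof.
move=> _ _ [a ->] [b ->]; exists (\row_i Num.max (a 0 i) (b 0 i)).
apply/seteqP; split => x /=.
  by move=> [ax bx] i; rewrite mxE ge_max ax bx.
by move=> h; split=> i; have := h i; rewrite mxE ge_max => /andP[].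
Qed.

Lemma borel_sub_orthants : @measurable _ (borel_rV (R:=R) n) `<=` <<s orthants >>.
Proof.
pose T' := g_sigma_algebraType orthants.
have mc i : measurable_fun setT (fun x : T' => (x : 'rV[R]_n) 0 i : measurableTypeR R).
  apply: (measurability _ (RGenCInfty.measurableE R)).
  move=> _ [_ [a ->] <-]; rewrite setTI.
  (* A half-space in coordinate [i] is the increasing union of orthants whose other bounds are
     [- k]. *)
  rewrite (_ : _ @^-1` _ = \bigcup_k [set x : 'rV[R]_n |
      forall j, (if j == i then a else - k%:R) <= x 0 j]); last first.
    apply/seteqP; split => x /=; rewrite in_itv/= andbT.
      move=> ax; have [k kx] : exists k : nat, `|x| <= k%:R.
        by exists (Num.bound `|x|); apply/ltW; apply: (archi_boundP (normr_ge0 x)).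
      exists k => // j /=; case: eqP => [->//|_].
      have := le_trans (coord_le_norm x j) kx; rewrite ler_norml => /andP[]//.
    by move=> [k _ /(_ i)] /=; rewrite eqxx.
  apply: bigcupT_measurable => k; apply: sub_sigma_algebra.
  exists (\row_j (if j == i then a else - k%:R)).
  by apply/seteqP; split => x /= h j; have := h j; rewrite mxE.
apply: smallest_sub; first exact: smallest_sigma_algebra.
rewrite -bigcup_seq; apply: bigcup_sub => i _ A [B mB <-].
by apply: mc.
Qed.

Lemma box_fin (a b : 'rV[R]_n) : (mu (rV_box a b) < +oo)%E.
Proof.
pose b' : 'rV[R]_n := \row_i Num.max (a 0 i) (b 0 i).
apply: (@le_lt_trans _ _ (mu (rV_box a b'))).
  apply: le_measure; rewrite ?inE; try exact: box_measurable.
  move=> x /= h i; have := h i; rewrite /= !in_itv/= mxE => /andP[-> xb] /=.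
  by rewrite lt_max xb orbT.
by rewrite leb_box ?ltry// => i; rewrite mxE le_max lexx.
Qed.

(** Dynkin's argument: additivity of the integral makes the sets [E] with zero integral a
    lambda-system, and the hypothesis puts the orthants in it. *)
Lemma int_borel_eq0 (a b : 'rV[R]_n) (w : 'rV[R]_n -> R) :
  mu.-integrable (rV_box a b) (EFin \o w) ->
  (forall c, (\int[mu]_(x in rV_box c b `&` rV_box a b) (w x)%:E = 0)%E) ->
  forall E : set 'rV[R]_n, measurable (E : set (borel_rV n)) ->
    (\int[mu]_(x in E `&` rV_box a b) (w x)%:E = 0)%E.
Proof.
set D := rV_box a b => iw w0.
have mD : measurable (D : set (leb_type R n)) by exact: box_measurable.
pose H := [set E : set 'rV[R]_n | measurable (E : set (borel_rV n)) /\
  (\int[mu]_(x in E `&` D) (w x)%:E = 0)%E].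
have iwE (E : set (leb_type R n)) : measurable E -> mu.-integrable (E `&` D) (EFin \o w).
  move=> mE; apply: integrableS iw => //; exact: measurableI.
have wT : (\int[mu]_(x in D) (w x)%:E = 0)%E by rewrite -(w0 a) setIid.
suff sub : <<s orthants >> `<=` H.
  by move=> E /borel_sub_orthants/sub[].
apply: lambda_system_subset => //; first exact: orthants_setI.
- apply/dynkin_lambda_system; split.
  + by split; [exact: measurableT|rewrite setTI].
  + move=> E [mE E0]; split; first exact: measurableC.
    have mE' := borel_leb_measurable mE.
    have mCE' := measurableC mE'.
    have : (\int[mu]_(x in (E `&` D) `|` (~` E `&` D)) (w x)%:E = 0)%E.
      by rewrite -setIUl setUCr setTI.
    rewrite integral_setU//=.
    * by rewrite E0 add0e.
    * exact: measurableI.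
    * exact: measurableI.
    * by rewrite -setIUl setUCr setTI; case/integrableP: iw.
    * by apply/disj_setPS => x [[? _] []].
  + move=> F tF HF; have mF k := borel_leb_measurable (HF k).1.
    split; first by apply: bigcupT_measurable => k; exact: (HF k).1.
    rewrite setI_bigcupl integral_bigcup.
    * by rewrite eseries0// => k _ _; rewrite (HF k).2.
    * exact: trivIset_setIr.
    * by move=> k; exact: measurableI.
    * by rewrite -setI_bigcupl; apply: iwE; exact: bigcupT_measurable.
- move=> _ [c ->]; split.
    rewrite (_ : [set x | _] = rV_pset (fun i => `[c 0 i, +oo[%classic)).
      exact: borel_pset.
    by apply/seteqP; split => x /= h i; have := h i; rewrite /= in_itv/= andbT.
  rewrite -[RHS](w0 c); congr integral; apply/seteqP; split => x [xc xD];
    split=> //= i; have := xc i; have := xD i; rewrite /= !in_itv/=.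
    by move=> /andP[_ ->] ->.
  by move=> _ /andP[].
Qed.

(** The set where [w] is positive is only Lebesgue measurable, but it differs from its Borel hull by
    a null set. The integral of [w] over it therefore vanishes although [w] is positive there, so
    the set is null. *)
Lemma ae_le0_boxes (a b : 'rV[R]_n) (w : 'rV[R]_n -> R) :
  mu.-integrable (rV_box a b) (EFin \o w) ->
  (forall c, (\int[mu]_(x in rV_box c b `&` rV_box a b) (w x)%:E = 0)%E) ->
  {ae mu, forall x, rV_box a b x -> w x <= 0}.
Proof.
move=> iw w0; have wE := int_borel_eq0 iw w0.
set D := rV_box a b in iw w0 wE *.
have mD : measurable (D : set (leb_type R n)) by exact: box_measurable.
have mw : measurable_fun (D : set (leb_type R n)) w.
  by apply/measurable_EFinP; case/integrableP: iw.
pose E : set (leb_type R n) := D `&` [set x | 0 < w x].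
have mE : measurable E.
  rewrite /E (_ : [set x | _] = w @^-1` `]0, +oo[%classic); first exact: mw.
  by apply/seteqP; split => x /=; rewrite in_itv/= andbT.
have Eoo : (mu E < +oo)%E.
  apply: le_lt_trans (box_fin a b); apply: le_measure; rewrite ?inE//.
  exact: subIsetl.
have [G [mG EG GE]] := borel_hull mE Eoo.
have mG' := borel_leb_measurable mG.
have ED : E `<=` D by exact: subIsetl.
have intE : (\int[mu]_(x in E) `|(EFin \o w) x| = 0)%E.
  under eq_integral => x /set_mem[_ wx0].
    rewrite /= gtr0_norm//; over.
  rewrite -(wE _ mG) [RHS](@negligible_integral _ _ _ mu _ (G `\` E : set (leb_type R n)))//.
  - congr integral; apply/seteqP; split => x.
      by move=> Ex; split=> [|[]//]; split; [exact: EG|exact: ED].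
    by move=> [[Gx Dx] nGE]; apply: contrapT => nEx; exact: nGE.
  - exact: measurableD.
  - exact: measurableI.
  - by apply: integrableS iw => //; exact: measurableI.
have mwE : measurable_fun E (EFin \o w).
  by apply/measurable_EFinP; apply: measurable_funS mw.
have := (ae_eq_integral_abs mu mE mwE).1 intE.
apply: filterS => x /= h Dx; rewrite leNgt; apply/negP => wx.
by have := h (conj Dx wx) => -[] w0x; rewrite w0x ltxx in wx.
Qed.

Lemma ae_eq0_boxes (a b : 'rV[R]_n) (w : 'rV[R]_n -> R) :
  mu.-integrable (rV_box a b) (EFin \o w) ->
  (forall c, rV_box c b `<=` rV_box a b ->
    (\int[mu]_(x in rV_box c b) (w x)%:E = 0)%E) ->
  {ae mu, forall x, rV_box a b x -> w x = 0}.
Proof.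
move=> iw w0.
have box_max c : rV_box c b `&` rV_box a b = rV_box (\row_i Num.max (c 0 i) (a 0 i)) b.
  apply/seteqP; split => x /=.
    move=> [xc xa] i; have := xc i; have := xa i.
    rewrite /= !in_itv/= mxE ge_max.
    by move=> /andP[-> _] /andP[-> ->].
  by move=> h; split=> i; have := h i; rewrite /= !in_itv/= mxE ge_max => /andP[/andP[xc xa] ->]; rewrite ?xc ?xa.
have w0' c : (\int[mu]_(x in rV_box c b `&` rV_box a b) (w x)%:E = 0)%E.
  by rewrite box_max; apply: w0; rewrite -box_max; exact: subIsetr.
have N0 c : (\int[mu]_(x in rV_box c b `&` rV_box a b) (- w x)%:E = 0)%E.
  under eq_integral do rewrite EFinN.
  rewrite integralN ?w0' ?oppe0//.
  apply: integrable_add_def.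
    by rewrite box_max; exact: box_measurable.
  apply: (@integrableS _ _ _ mu (rV_box a b)); last exact: iw.
  - exact: box_measurable.
  - by rewrite box_max; exact: box_measurable.
  - exact: subIsetr.
have iNw : mu.-integrable (rV_box a b) (EFin \o (fun x => - w x)).
  by apply: eq_integrable (integrableN iw) => //; exact: box_measurable.
have h1 := ae_le0_boxes iw w0'; have h2 := ae_le0_boxes iNw N0.
have h12 : {ae mu, forall x, (rV_box a b x -> w x <= 0) /\ (rV_box a b x -> - w x <= 0)}.
  exact: filterI.
apply: filterS h12 => x [{}h1 {}h2] Dx.
by apply/eqP; rewrite eq_le h1//=; have := h2 Dx; rewrite oppr_le0.
Qed.

End AeZero.

(** * Test functions *)

Section TensorProducts.
Context {R : realType} {n : nat}.
Implicit Types (h dh : 'I_n -> R -> R) (x : 'rV[R]_n).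

(** All test functions have this shape: supports, bounds and partial derivatives then reduce to one
    variable. *)
Definition tprod h x : R := \prod_i h i (x 0 i).

Lemma differentiable_coord_comp (f : R -> R) i x :
  derivable f (x 0 i) 1 -> differentiable (fun x : 'rV[R]_n => f (x 0 i)) x.
Proof.
move=> /derivable1_diffP df.
by apply: (@differentiable_comp _ _ _ _ (fun x : 'rV[R]_n => x 0 i) f) => //;
  exact: differentiable_coord.
Qed.

Lemma differentiable_prod (I : Type) (s : seq I) (f : I -> 'rV[R]_n -> R) x :
  (forall i, differentiable (f i) x) ->
  differentiable (fun x => \prod_(i <- s) f i x) x.
Proof.
move=> df; elim: s => [|i s IH].
  by under eq_fun do rewrite big_nil; exact: differentiable_cst.
by under eq_fun do rewrite big_cons; exact: differentiableM.
Qed.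

Lemma partial_tprod h dh i x : (forall j (t : R), is_derive t 1 (h j) (dh j t)) ->
  partial i (tprod h) x = \prod_j (if j == i then dh j else h j) (x 0 j).
Proof.
move=> hd; pose P := \prod_(j | j != i) h j (x 0 j).
have E t : tprod h (t *: delta_mx 0 i + x) = h i (t + x 0 i) * P.
  rewrite /tprod (bigD1 i)//= !mxE !eqxx mulr1; congr (_ * _).
  by apply: eq_bigr => j ji; rewrite !mxE eqxx (negbTE ji) mulr0 add0r.
have Ex : tprod h x = h i (x 0 i) * P.
  by have := E 0; rewrite scale0r !add0r.
have hP : is_derive (x 0 i) 1 (fun t => h i t * P) (dh i (x 0 i) * P).
  have hdi := hd i (x 0 i).
  have : is_derive (x 0 i) 1 (h i * cst P) (h i (x 0 i) *: 0 + P *: dh i (x 0 i)).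
    exact: is_deriveM.
  by rewrite scaler0 add0r /GRing.scale/= [P * _]mulrC.
transitivity ('D_1 (fun t => h i t * P) (x 0 i)).
  rewrite /partial /derive.
  suff -> : (fun t : R => t^-1 *: ((tprod h \o shift x) (t *: delta_mx 0 i) - tprod h x)) =
    (fun t : R => t^-1 *: (((fun t : R => h i t * P) \o shift (x 0 i)) t%:A - h i (x 0 i) * P)) by [].
  by apply/funext => t /=; rewrite E Ex /GRing.scale/= mulr1.
rewrite derive_val (bigD1 i)//= eqxx; congr (_ * _).
by apply: eq_bigr => j ji; rewrite (negbTE ji).
Qed.

Lemma continuous_tprod h : (forall i, continuous (h i)) -> continuous (tprod h).
Proof.
move=> ch; rewrite /tprod; elim: (index_enum _) => [|i s IH].
  rewrite (_ : (fun _ => _) = cst 1); first exact: cst_continuous.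
  by apply/funext => x; rewrite big_nil.
rewrite (_ : (fun _ => _) =
    (fun x : 'rV[R]_n => h i (x 0 i) * \prod_(j <- s) h j (x 0 j))); last first.
  by apply/funext => x; rewrite big_cons.
have ci : continuous (fun x : 'rV[R]_n => h i (x 0 i)).
  move=> x; apply: (@continuous_comp _ _ _ (fun x : 'rV[R]_n => x 0 i) (h i)).
    exact: coord_continuous.
  exact: ch.
by move=> x; apply: (@continuousM _ _ _ _ x); [exact: ci|exact: IH].
Qed.

Lemma C1c_tprod (D : set 'rV[R]_n) h dh (a b : 'rV[R]_n) :
  (forall j (t : R), is_derive t 1 (h j) (dh j t)) ->
  (forall j, continuous (dh j)) ->
  (forall j t, ~ (a 0 j <= t <= b 0 j) -> h j t = 0) ->
  rV_cbox a b `<=` D -> C1c D (tprod h).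
Proof.
move=> hd cd h0 abD.
have dh_ j t : derivable (h j) t 1 by [].
have ch j : continuous (h j).
  by move=> t; apply: differentiable_continuous; apply/derivable1_diffP.
have sub : closure [set x | tprod h x != 0] `<=` rV_cbox a b.
  have /closure_id -> : closed (rV_cbox a b).
    by apply: compact_closed; [exact: norm_hausdorff|exact: cbox_compact].
  apply: closure_subset => x /= nz j; rewrite /= in_itv/=.
  apply: contra_notT (negP nz) => /negP xj.
  by rewrite /tprod (bigD1 j)//= h0// mul0r.
split.
- move=> x; apply: differentiable_prod => i; exact: differentiable_coord_comp.
- move=> i; rewrite (_ : partial i _ = tprod (fun j => if j == i then dh j else h j)).
    by apply: continuous_tprod => j; case: eqP => _.
  by apply/funext => x; rewrite (partial_tprod i x hd).
- apply: subclosed_compact sub; [exact: closed_closure|exact: cbox_compact].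
- exact: subset_trans sub abD.
Qed.

End TensorProducts.

(** * Piecewise polynomial steps and smoothed indicators *)

Section Ramps.
Context {R : realType}.

Definition pospow (k : nat) (t : R) := Num.max t 0 ^+ k.

Lemma continuous_pospow k : continuous (pospow k).
Proof.
move=> t; apply: (@continuous_comp _ _ _ (fun t : R => Num.max t 0) (fun y => y ^+ k)).
  by apply: continuous_max; [exact: cvg_id|exact: cvg_cst].
exact: exprn_continuous.
Qed.

Global Instance is_derive_pospow k (t : R) :
  is_derive t 1 (pospow k.+2) (k.+2%:R * pospow k.+1 t).
Proof.
have [t0|t0|->] := ltgtP t 0.
- apply: (@near_eq_is_derive _ _ _ (cst 0)).
  + near=> s; rewrite /pospow max_r ?expr0n//; apply: ltW; near: s.
    exact: lt_nbhsl.
  + by apply: is_derive_eq; rewrite /pospow max_r ?ltW// expr0n/= mulr0.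
- apply: (@near_eq_is_derive _ _ _ (fun s : R => s ^+ k.+2)).
  + near=> s; rewrite /pospow max_l//; apply: ltW; near: s.
    exact: lt_nbhsr.
  + have := @is_deriveX _ _ id k.+2 t 1 1 (is_derive_id _ _).
    by rewrite exprfctE /pospow max_l ?ltW// /GRing.scale/= mulr1.
(* At 0 the difference quotient of the truncated power of degree [k + 2] is the truncated power of
   degree [k + 1], which tends to 0. *)
- have lim0 : (fun h : R => h^-1 *: ((pospow k.+2 \o shift 0) h%:A - pospow k.+2 0))
      @ 0^' --> (0 : R).
    apply: cvg_trans (_ : pospow k.+1 @ 0^' --> (0 : R)).
      apply: near_eq_cvg; near=> h.
      rewrite /= addr0 /GRing.scale/= mulr1 /pospow maxxx expr0n subr0.
      have h0 : h != 0 by near: h; exact: nbhs_dnbhs_neq.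
      have [hle|hgt] := leP h 0; first by rewrite !expr0n/= mulr0.
      by rewrite [in RHS]exprS mulKf.
    have p0 : pospow k.+1 0 = 0 by rewrite /pospow maxxx expr0n.
    have := @continuous_pospow k.+1 0; rewrite /continuous_at p0.
    exact: cvg_within_filter.
  apply: DeriveDef; first by apply/cvg_ex; exists 0.
  have p0 : pospow k.+1 0 = 0 by rewrite /pospow maxxx expr0n.
  by rewrite p0 mulr0; exact: cvg_lim lim0.
Unshelve. all: by end_near. Qed.

End Ramps.

Section Steps.
Context {R : realType}.
Implicit Types a b c d e t : R.

Lemma is_derive_affine (f df : R -> R) c d t :
  (forall s : R, is_derive s 1 f (df s)) ->
  is_derive t 1 (fun s => f (c * s + d)) (c * df (c * t + d)).
Proof.
move=> fd.
have g : is_derive t 1 (fun s => c * s + d) c.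
  have : is_derive t 1 ((cst c * id) + cst d) ((c *: 1 + t *: 0) + 0).
    by apply: is_deriveD; apply: is_deriveM.
  by rewrite scaler0 !addr0 /GRing.scale/= mulr1.
have := @is_derive1_comp _ f (fun s => c * s + d) t (df (c * t + d)) c (fd _) g.
by rewrite mulrC.
Qed.

(** A second difference lowers the degree of a polynomial by two. Past the knots 0, 1, 2 the
    truncated powers of degree 1, 2, 3 thus become zero, a constant and an affine function. *)
Definition ddiff (g : R -> R) t : R := g t - 2 * g (t - 1) + g (t - 2).

Lemma is_derive_ddiff (g dg : R -> R) c t :
  (forall s : R, is_derive s 1 g (dg s)) ->
  is_derive t 1 (fun s => ddiff g s / c) (ddiff dg t / c).
Proof.
move=> gd.
have gdd d : is_derive t 1 (fun s => g (s - d)) (dg (t - d)).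
  have := is_derive_affine 1 (- d) t gd; rewrite !mul1r.
  by under eq_fun do rewrite mul1r.
have g1 := gdd 1; have g2 := gdd 2; have g0 := gd t.
have h := is_deriveZ c^-1 (is_deriveD (is_deriveB g0 (is_deriveZ 2 g1)) g2).
rewrite (_ : (fun s => _) = c^-1 *: ((g - 2 *: (fun s => g (s - 1))) + (fun s => g (s - 2)))).
  by rewrite /ddiff [_ / c]mulrC.
by apply/funext => s; rewrite /ddiff mulrC.
Qed.

Lemma continuous_ddiff (g : R -> R) c : continuous g -> continuous (fun s => ddiff g s / c).
Proof.
move=> cg; have cgd d : continuous (fun s => g (s - d)).
  move=> t; apply: (@continuous_comp _ _ _ (fun s => s - d) g); last exact: cg.
  by apply: (@continuousB _ _ _ id (cst d)); [exact: cvg_id|exact: cst_continuous].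
move=> t; apply: (@continuousM _ _ (ddiff g) (cst c^-1)); last exact: cst_continuous.
apply: (@continuousD _ _ _ (fun s => g s - 2 * g (s - 1))); last exact: cgd.
apply: (@continuousB _ _ _ g); first exact: cg.
by apply: (@continuousM _ _ (cst 2)); [exact: cst_continuous|exact: cgd].
Qed.

(* Second differences of truncated powers, i.e. B-splines: [dsstep] is the tent
   function on [0, 2]. *)
Definition sstep t : R := ddiff (pospow 2) t / 2.
Definition dsstep t : R := ddiff (pospow 1) t.
Definition ramp t : R := ddiff (pospow 3) t / 6.

Lemma is_derive_ramp t : is_derive t 1 ramp (sstep t).
Proof.
have := @is_derive_ddiff (pospow 3) (fun s => 3 * pospow 2 s) 6 t.
rewrite (_ : ddiff _ t / 6 = sstep t); last by rewrite /sstep /ddiff; field.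
by apply=> s; exact: is_derive_pospow.
Qed.

Lemma is_derive_sstep t : is_derive t 1 sstep (dsstep t).
Proof.
have := @is_derive_ddiff (pospow 2) (fun s => 2 * pospow 1 s) 2 t.
rewrite (_ : ddiff _ t / 2 = dsstep t); last by rewrite /dsstep /ddiff; field.
by apply=> s; exact: is_derive_pospow.
Qed.

Lemma continuous_sstep : continuous sstep.
Proof. exact/continuous_ddiff/continuous_pospow. Qed.

Lemma continuous_dsstep : continuous dsstep.
Proof.
have := @continuous_ddiff (pospow 1) 1 (@continuous_pospow R 1).
by under eq_fun do rewrite divr1.
Qed.

Lemma sstep_le0 t : t <= 0 -> sstep t = 0.
Proof.
move=> t0; rewrite /sstep /ddiff /pospow !max_r ?expr0n/=; first by ring.
all: lra.
Qed.

Lemma sstep_ge2 t : 2 <= t -> sstep t = 1.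
Proof.
by move=> t0; rewrite /sstep /ddiff /pospow !max_l; [field|lra..].
Qed.

Lemma ramp_le0 t : t <= 0 -> ramp t = 0.
Proof.
move=> t0; rewrite /ramp /ddiff /pospow !max_r ?expr0n/=; first by ring.
all: lra.
Qed.

Lemma ramp_ge2 t : 2 <= t -> ramp t = t - 1.
Proof.
by move=> t0; rewrite /ramp /ddiff /pospow !max_l; [field|lra..].
Qed.

Lemma sstep_bound t : 0 <= sstep t <= 1.
Proof.
have [t0|t0] := leP t 0; first by rewrite sstep_le0// lexx ler01.
have [t2|t2] := leP 2 t; first by rewrite sstep_ge2// lexx ler01.
rewrite /sstep /ddiff /pospow (max_l (ltW t0)) (max_r (_ : t - 2 <= 0)); last lra.
by have [t1|t1] := leP (t - 1) 0; nra.
Qed.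

Lemma dsstep_bound t : `|dsstep t| <= 1.
Proof.
rewrite /dsstep /ddiff /pospow !expr1.
by have [?|?] := leP t 0; have [?|?] := leP (t - 1) 0; have [?|?] := leP (t - 2) 0;
 rewrite ler_norml; apply/andP; split; lra.
Qed.

End Steps.

Section Densities.
Context {R : realType}.
Implicit Types a b e t : R.

Lemma ramp_lip (s t : R) : s <= t -> 0 <= ramp t - ramp s <= t - s.
Proof.
move=> st; have [c _ ->] := MVT_segment st (fun x _ => is_derive_ramp x)
  (derivable_within_continuous (fun x _ => @ex_derive _ _ _ _ _ _ _ (is_derive_ramp x))).
have := sstep_bound c; rewrite -subr_ge0 in st => /andP[c0 c1].
by rewrite mulr_ge0//= ler_piMl.
Qed.

(** Sends [a - 2 e] to 0 and [a] to 2. Each transition lies to the left of its endpoint, so that as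
    [e] tends to 0 the smoothed indicator takes the value 1 at [a] and 0 at [b], as half-open
    intervals require. *)
Definition sarg e a t := e^-1 * t + (2 - e^-1 * a).

(* [cdens e a b] is a C^2 approximation of the distribution function of the
   uniform law on [a, b[, and [sdens e a b] is its density. *)
Definition cdens e a b t := (b - a)^-1 * (e * (ramp (sarg e a t) - ramp (sarg e b t))).
Definition sdens e a b t := (b - a)^-1 * (sstep (sarg e a t) - sstep (sarg e b t)).
Definition dsdens e a b t :=
  (b - a)^-1 * (e^-1 * (dsstep (sarg e a t) - dsstep (sarg e b t))).

Lemma is_derive_cdens e a b t : 0 < e -> is_derive t 1 (cdens e a b) (sdens e a b t).
Proof.
move=> e0.
have ha := is_derive_affine e^-1 (2 - e^-1 * a) t (@is_derive_ramp R).
have hb := is_derive_affine e^-1 (2 - e^-1 * b) t (@is_derive_ramp R).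
have h := is_deriveZ (b - a)^-1 (is_deriveZ e (is_deriveB ha hb)).
have -> // : sdens e a b t = (b - a)^-1 *: (e *: (e^-1 * sstep (e^-1 * t + (2 - e^-1 * a)) -
   e^-1 * sstep (e^-1 * t + (2 - e^-1 * b)))).
by rewrite /sdens /GRing.scale/= -mulrBr mulVKf// gt_eqF.
Qed.

Lemma is_derive_sdens e a b t : is_derive t 1 (sdens e a b) (dsdens e a b t).
Proof.
have ha := is_derive_affine e^-1 (2 - e^-1 * a) t (@is_derive_sstep R).
have hb := is_derive_affine e^-1 (2 - e^-1 * b) t (@is_derive_sstep R).
have h := is_deriveZ (b - a)^-1 (is_deriveB ha hb).
have -> // : dsdens e a b t = (b - a)^-1 *: (e^-1 * dsstep (e^-1 * t + (2 - e^-1 * a)) -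
   e^-1 * dsstep (e^-1 * t + (2 - e^-1 * b))).
by rewrite /dsdens /GRing.scale/= -mulrBr.
Qed.

Lemma continuous_sarg e a : continuous (sarg e a).
Proof.
move=> t; apply: (@continuousD _ _ _ (fun t => e^-1 * t)); last exact: cst_continuous.
exact: mulrl_continuous.
Qed.

Lemma continuous_dsdens e a b : continuous (dsdens e a b).
Proof.
have c a' : continuous (fun t => dsstep (sarg e a' t)).
  by move=> t; apply: (@continuous_comp _ _ _ (sarg e a') dsstep);
    [exact: continuous_sarg|exact: continuous_dsstep].
move=> t; rewrite /dsdens; apply: cvgMr; apply: cvgMr.
by apply: cvgB; exact: c.
Qed.

Lemma sarg_le0 e a t : 0 < e -> t <= a - 2 * e -> sarg e a t <= 0.
Proof.
move=> e0 ta; rewrite /sarg (_ : _ + _ = e^-1 * (t - (a - 2 * e))).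
  by rewrite pmulr_rle0 ?invr_gt0// subr_le0.
by field; rewrite gt_eqF.
Qed.

Lemma sarg_ge2 e a t : 0 < e -> a <= t -> 2 <= sarg e a t.
Proof.
move=> e0 ta; rewrite /sarg addrCA lerDl -mulrBr mulr_ge0 ?invr_ge0 ?subr_ge0//.
exact: ltW.
Qed.

Lemma sdens_eq0 e a b t : 0 < e -> a < b -> ~ (a - 2 * e <= t <= b) -> sdens e a b t = 0.
Proof.
move=> e0 ab /negP; rewrite negb_and -!ltNge => /orP[ta|tb].
  by rewrite /sdens !sstep_le0 ?subrr ?mulr0//; apply: sarg_le0 => //; lra.
by rewrite /sdens !sstep_ge2 ?subrr ?mulr0//; apply: sarg_ge2 => //; lra.
Qed.

Lemma cdens_eq0 e a b t : 0 < e -> a < b -> t <= a - 2 * e -> cdens e a b t = 0.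
Proof.
by move=> e0 ab ta; rewrite /cdens !ramp_le0 ?subrr ?mulr0//; apply: sarg_le0 => //; lra.
Qed.

Lemma cdens_eq1 e a b t : 0 < e -> a < b -> b <= t -> cdens e a b t = 1.
Proof.
move=> e0 ab ta; rewrite /cdens !ramp_ge2; [|apply: sarg_ge2 => //; lra..].
by rewrite /sarg; field; rewrite subr_eq0 !gt_eqF.
Qed.

Lemma cdens_bound e a b t : 0 < e -> a < b -> 0 <= cdens e a b t <= 1.
Proof.
move=> e0 ab; rewrite /cdens; have ba : 0 < b - a by rewrite subr_gt0.
have E : sarg e a t - sarg e b t = e^-1 * (b - a) by rewrite /sarg; ring.
have /ramp_lip/andP[r0] : sarg e b t <= sarg e a t.
  by rewrite -subr_ge0 E mulr_ge0 ?invr_ge0// ltW.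
rewrite E => r1; apply/andP; split.
  by rewrite mulr_ge0 ?invr_ge0 ?mulr_ge0// ltW.
by rewrite ler_pdivrMl// mulr1 mulrC -ler_pdivlMr// mulrC.
Qed.

Lemma sdens_bound e a b t : a < b -> `|sdens e a b t| <= (b - a)^-1.
Proof.
move=> ab; have ba : 0 < b - a by rewrite subr_gt0.
have s1 : `|sstep (sarg e a t) - sstep (sarg e b t)| <= 1.
  have := sstep_bound (sarg e a t); have := sstep_bound (sarg e b t).
  by rewrite ler_norml; lra.
by rewrite /sdens normrM gtr0_norm ?invr_gt0// -[leRHS]mulr1 ler_pM2l ?invr_gt0.
Qed.

Lemma sdens_cvg (e_ : R^nat) a b t : (forall m, 0 < e_ m) -> e_ @ \oo --> (0 : R) -> a < b ->
  (fun m => sdens (e_ m) a b t) @ \oo --> (b - a)^-1 * (a <= t < b)%R%:R.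
Proof.
move=> e0 ecvg ab.
have s c : (fun m => sstep (sarg (e_ m) c t)) @ \oo --> ((c <= t)%R%:R : R).
  have [ct|tc] := leP c t.
    apply: cvg_near_cst; apply: nearW => m.
    by rewrite sstep_ge2//; exact: sarg_ge2.
  apply: cvg_near_cst; near=> m; rewrite sstep_le0//; apply: sarg_le0 => //.
  suff : e_ m < (c - t) / 2 by lra.
  by near: m; apply: (cvgr_lt 0) => //; lra.
rewrite (_ : (a <= t < b)%R%:R = (a <= t)%R%:R - (b <= t)%R%:R).
  by apply: cvgMr; apply: cvgB.
case: (leP b t) => bt; last by rewrite andbT subr0.
by rewrite andbF (le_trans (ltW ab) bt) subrr.
Unshelve. all: by end_near. Qed.

End Densities.

(** Factors are exchanged one at a time. For products of densities, the single difference in each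
    summand is the derivative of a difference of distribution functions. *)
Lemma prodrB_telescope {R : comPzRingType} n (F G : 'I_n -> R) :
  \prod_i F i - \prod_i G i =
  \sum_(i < n) \prod_(j < n) (if (j < i)%N then F j else if j == i then F i - G i else G j).
Proof.
elim: n F G => [|n IH] F G; first by rewrite !big_ord0 subrr.
rewrite !big_ord_recl/=.
transitivity ((F ord0 - G ord0) * \prod_(i < n) G (lift ord0 i) +
  F ord0 * (\prod_(i < n) F (lift ord0 i) - \prod_(i < n) G (lift ord0 i))); first ring.
rewrite IH mulr_sumr; congr (_ + _).
apply: eq_bigr => i _; rewrite big_ord_recl/=; congr (_ * _).
Qed.

(** * Comparison of averages over boxes *)

Section Testing.
Context {R : realType} {n : nat}.
Notation mu := (@leb R n).
Notation T := (leb_type R n).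
Implicit Types (D P : set 'rV[R]_n) (u : 'rV[R]_n -> R).

Lemma integral_supp D P (f : 'rV[R]_n -> \bar R) : P `<=` D ->
  (forall x, ~ P x -> f x = 0%E) ->
  (\int[mu]_(x in D) f x = \int[mu]_(x in P) f x)%E.
Proof.
move=> PD f0; rewrite [LHS]integral_mkcond [RHS]integral_mkcond.
congr integral; apply/funext => x; rewrite /patch.
have [xP|/negP xP] := boolP (x \in P).
  by rewrite ifT//; apply/mem_set/PD/set_mem.
case: ifPn => // _; apply: f0 => Px; apply: xP; exact/mem_set.
Qed.

Lemma integrableM_continuous P u (phi : 'rV[R]_n -> R) : compact P -> continuous phi ->
  mu.-integrable P (EFin \o u) -> mu.-integrable P (EFin \o (fun x => u x * phi x)).
Proof.
move=> cP cphi iu.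
have mP : measurable (P : set T) by exact: compact_leb_measurable.
have -> : EFin \o (fun x => u x * phi x) = ((EFin \o u) \* (EFin \o phi))%E.
  by apply/funext => x /=; rewrite EFinM.
apply: integrableMl => //; first exact: continuous_leb_measurable.
have /compact_bounded : compact (phi @` P).
  by apply: continuous_compact => //; exact: continuous_subspaceT.
move=> [M [Mr MP]]; exists M; split => // r Mr' x Px.
by apply: MP => //; exists x.
Qed.

Lemma tprod_outside h (A B x : 'rV[R]_n) :
  (forall j t, ~ (A 0 j <= t <= B 0 j) -> h j t = 0) -> ~ rV_cbox A B x -> tprod h x = 0.
Proof.
move=> h0 /existsNP[j]; rewrite /= in_itv/= => xj.
by rewrite /tprod (bigD1 j)//= (h0 _ _ xj) mul0r.
Qed.

Lemma derive_outside (f df : R -> R) (a b : R) :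
  (forall t : R, is_derive t 1 f (df t)) -> (forall t, ~ (a <= t <= b) -> f t = 0) ->
  forall t, ~ (a <= t <= b) -> df t = 0.
Proof.
move=> fd f0 t tab; rewrite -(@derive_val _ _ _ _ _ _ _ (fd t)).
rewrite (@near_eq_derive _ _ _ _ (cst 0)) ?derive_cst//.
move/negP: tab; rewrite negb_and -!ltNge => /orP[ta|tb]; near=> s; apply: f0.
  move=> /andP[as_ _]; move: as_; apply/negP; rewrite -ltNge.
  by near: s; exact: lt_nbhsl.
move=> /andP[_ bs]; move: bs; apply/negP; rewrite -ltNge.
by near: s; exact: lt_nbhsr.
Unshelve. all: by end_near. Qed.

Lemma weak_gradient_tprod D u Du h dh (A B : 'rV[R]_n) i :
  weak_gradient D u Du ->
  (forall j (t : R), is_derive t 1 (h j) (dh j t)) ->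
  (forall j, continuous (dh j)) ->
  (forall j t, ~ (A 0 j <= t <= B 0 j) -> h j t = 0) ->
  rV_cbox A B `<=` D ->
  \int[mu]_(x in rV_cbox A B) (u x * tprod (fun j => if j == i then dh j else h j) x) =
  - \int[mu]_(x in rV_cbox A B) (Du x 0 i * tprod h x).
Proof.
move=> wg hd cd h0 PD.
have C1 : C1c D (tprod h) by exact: (C1c_tprod hd cd h0 PD).
have h0' j := @derive_outside (h j) (dh j) _ _ (hd j) (h0 j).
have := wg _ C1 i.
rewrite (@integral_supp _ (rV_cbox A B) (fun x => (u x * _)%:E))//; last first.
  move=> x xP; rewrite (partial_tprod i x hd).
  rewrite [\prod_j _](tprod_outside (h := fun j => if j == i then dh j else h j) _ xP) ?mulr0//.
  by move=> j t ?; case: ifP => _; [exact: h0'|exact: h0].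
rewrite (@integral_supp _ (rV_cbox A B) (fun x => (_ * tprod h x)%:E))//; last first.
  by move=> x xP; rewrite (tprod_outside h0 xP) mulr0.
move=> /(congr1 fine); rewrite fineN => E.
rewrite /Rintegral -E; congr fine; apply: eq_integral => x _.
by rewrite (partial_tprod i x hd).
Qed.

End Testing.

Section Averages.
Context {R : realType} {n : nat}.
Notation mu := (@leb R n).
Notation T := (leb_type R n).
Implicit Types (D P : set 'rV[R]_n) (u : 'rV[R]_n -> R) (a b A B : 'rV[R]_n).

Definition box_avg u a b : R :=
  (\prod_j (b 0 j - a 0 j))^-1 * \int[mu]_(x in rV_box a b) u x.

Definition smooth_box e a b : 'rV[R]_n -> R :=
  tprod (fun j => sdens e (a 0 j) (b 0 j)).

Lemma continuous_smooth_box e a b : continuous (smooth_box e a b).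
Proof.
apply: continuous_tprod => j t; apply: differentiable_continuous.
by apply/derivable1_diffP; have := is_derive_sdens e (a 0 j) (b 0 j) t.
Qed.

Lemma integrable_mulrl (P : set T) (f : T -> R) r : measurable P ->
  mu.-integrable P (EFin \o f) -> mu.-integrable P (EFin \o (fun x => r * f x)).
Proof.
move=> mP fi; have := @integrableZl _ _ _ mu _ mP r _ fi.
by apply: eq_integrable => // x _ /=; rewrite EFinM.
Qed.

Lemma Rintegral_sum (P : set T) (I : Type) (s : seq I) (f : I -> T -> R) : measurable P ->
  (forall i, mu.-integrable P (EFin \o f i)) ->
  \int[mu]_(x in P) (\sum_(i <- s) f i x) = \sum_(i <- s) \int[mu]_(x in P) f i x.
Proof.
move=> mP fi; elim: s => [|i s IH].
  under eq_Rintegral do rewrite big_nil.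
  by rewrite big_nil Rintegral_cst// mul0r.
under eq_Rintegral do rewrite big_cons.
rewrite big_cons RintegralD//; first by rewrite IH.
rewrite (_ : _ \o _ = fun x => (\sum_(i <- s) (EFin \o f i) x)%E).
  exact: integrable_sum.
by apply/funext => x /=; rewrite sumEFin.
Qed.

(** Two product densities differ by a sum of partial derivatives of compactly supported products. In
    the [i]-th one, coordinate [i] carries a difference of distribution functions, bounded by 1, and
    the other [n - 1] coordinates carry densities bounded by [1/h]. *)
Lemma smooth_box_cmp D u Du A B a b a' b' (e h : R) :
  weak_gradient D u Du -> rV_cbox A B `<=` D ->
  mu.-integrable (rV_cbox A B) (EFin \o u) ->
  (forall i, mu.-integrable (rV_cbox A B) (EFin \o (fun x => Du x 0 i))) ->
  0 < h -> 0 < e ->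
  (forall j, [/\ A 0 j + 2 * e <= a 0 j, h <= b 0 j - a 0 j & b 0 j <= B 0 j]) ->
  (forall j, [/\ A 0 j + 2 * e <= a' 0 j, h <= b' 0 j - a' 0 j & b' 0 j <= B 0 j]) ->
  `|\int[mu]_(x in rV_cbox A B) (u x * smooth_box e a b x) -
    \int[mu]_(x in rV_cbox A B) (u x * smooth_box e a' b' x)| <=
  h^-1 ^+ n.-1 * \sum_i \int[mu]_(x in rV_cbox A B) `|Du x 0 i|.
Proof.
set P := rV_cbox A B => wg PD iu iDu h0 e0 ab ab'.
have cP : compact P by exact: cbox_compact.
have mP : measurable (P : set T) by exact: cbox_measurable.
have lt_ab j : a 0 j < b 0 j by have [_ + _] := ab j; lra.
have lt_ab' j : a' 0 j < b' 0 j by have [_ + _] := ab' j; lra.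
pose k j := sdens e (a 0 j) (b 0 j); pose k' j := sdens e (a' 0 j) (b' 0 j).
pose dk j := dsdens e (a 0 j) (b 0 j); pose dk' j := dsdens e (a' 0 j) (b' 0 j).
pose c j t := cdens e (a 0 j) (b 0 j) t - cdens e (a' 0 j) (b' 0 j) t.
pose g (i j : 'I_n) := if (j < i)%N then k j else if j == i then c j else k' j.
pose dg (i j : 'I_n) := if (j < i)%N then dk j else
  if j == i then (fun t => k j t - k' j t) else dk' j.
have gd i j (t : R) : is_derive t 1 (g i j) (dg i j t).
  rewrite /g /dg; case: ifP => _; first exact: is_derive_sdens.
  case: ifP => _; last exact: is_derive_sdens.
  by apply: is_deriveB; exact: is_derive_cdens.
have cdg i j : continuous (dg i j).
  rewrite /dg; case: ifP => _; first exact: continuous_dsdens.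
  case: ifP => _; last exact: continuous_dsdens.
  move=> t; apply: (@continuousB _ _ _ (k j)); apply: differentiable_continuous;
  by apply/derivable1_diffP; exact: (@ex_derive _ _ _ _ _ _ _ (is_derive_sdens _ _ _ _)).
have g0 i j t : ~ (A 0 j <= t <= B 0 j) -> g i j t = 0.
  have [p1 p2 p3] := ab j; have [p1' p2' p3'] := ab' j.
  move=> /negP tAB; rewrite /g /k /k' /c.
  case: ifP => _; first by apply: sdens_eq0 => //; apply/negP; move: tAB;
    rewrite !negb_and -!ltNge => /orP[?|?]; apply/orP; [left|right]; lra.
  case: ifP => _; last by apply: sdens_eq0 => //; apply/negP; move: tAB;
    rewrite !negb_and -!ltNge => /orP[?|?]; apply/orP; [left|right]; lra.
  (* To the left both distribution functions are 0 and to the right both are 1: equal masses make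
     the difference compactly supported. *)
  move: tAB; rewrite negb_and -!ltNge => /orP[tA|tB].
    by rewrite !cdens_eq0 ?subrr//; lra.
  by rewrite !cdens_eq1 ?subrr//; lra.
(* Each summand is the [i]-th partial derivative of [tprod (g i)]. *)
have tele x : smooth_box e a b x - smooth_box e a' b' x =
    \sum_(i < n) tprod (fun j => if j == i then dg i j else g i j) x.
  rewrite /smooth_box /tprod prodrB_telescope; apply: eq_bigr => i _.
  apply: eq_bigr => j _; rewrite /g /dg.
  by have [->|ji] := eqVneq j i; rewrite ?ltnn ?eqxx//; case: ifP.
have ct i : continuous (tprod (fun j => if j == i then dg i j else g i j)).
  apply: continuous_tprod => j; case: ifP => _; first exact: cdg.
  by move=> t; apply: differentiable_continuous; apply/derivable1_diffP;
     exact: (@ex_derive _ _ _ _ _ _ _ (gd i j t)).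
have ctg i : continuous (tprod (g i)).
  apply: continuous_tprod => j.
  by move=> t; apply: differentiable_continuous; apply/derivable1_diffP;
     exact: (@ex_derive _ _ _ _ _ _ _ (gd i j t)).
have gb i x : `|tprod (g i) x| <= h^-1 ^+ n.-1.
  rewrite /tprod normr_prod.
  apply: (@le_trans _ _ (\prod_j (if j == i then 1 else h^-1))).
    apply: ler_prod => j _; rewrite normr_ge0/= /g /c.
    have [p1 p2 p3] := ab j; have [p1' p2' p3'] := ab' j.
    case: ifP => [ji|_].
      rewrite (_ : j == i = false); last by apply/negbTE; rewrite -val_eqE/= neq_ltn ji.
      apply: (le_trans (sdens_bound _ _ (lt_ab j))).
      by rewrite lef_pV2// posrE subr_gt0.
    case: ifP => _.
      have /andP[] := cdens_bound (x 0 j) e0 (lt_ab j).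
      have /andP[] := cdens_bound (x 0 j) e0 (lt_ab' j).
      by rewrite ler_norml; lra.
    apply: (le_trans (sdens_bound _ _ (lt_ab' j))).
    by rewrite lef_pV2// posrE subr_gt0.
  rewrite (bigD1 i)//= eqxx mul1r (eq_bigr (fun=> h^-1)); last by move=> j /negbTE ->.
  by rewrite prodr_const cardC1 card_ord.
rewrite -RintegralB//; try by apply: integrableM_continuous => //; exact: continuous_smooth_box.
rewrite (_ : \int[mu]_(x in P) _ =
    \sum_(i < n) \int[mu]_(x in P) (u x * tprod (fun j => if j == i then dg i j else g i j) x)); last first.
  rewrite -Rintegral_sum//; last by move=> i; exact: integrableM_continuous.
  by apply: eq_Rintegral => x _; rewrite -mulrBr tele mulr_sumr.
apply: (le_trans (ler_norm_sum _ _ _)); rewrite mulr_sumr; apply: ler_sum => i _.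
rewrite (weak_gradient_tprod i wg (gd i) (cdg i) (g0 i) PD) normrN.
have iDg : mu.-integrable P (EFin \o (fun x => Du x 0 i * tprod (g i) x)).
  exact: integrableM_continuous.
apply: (le_trans (le_normr_Rintegral mP iDg)).
have iD : mu.-integrable P (EFin \o (fun x => `|Du x 0 i|)).
  exact: integrable_norm.
rewrite -RintegralZl//; apply: le_Rintegral => //.
- exact: integrable_norm.
- exact: integrable_mulrl.
- by move=> x _; rewrite normrM mulrC ler_wpM2r.
Qed.

End Averages.

Section BoxAverages.
Context {R : realType} {n : nat}.
Notation mu := (@leb R n).
Notation T := (leb_type R n).
Implicit Types (D P : set 'rV[R]_n) (u : 'rV[R]_n -> R) (a b A B : 'rV[R]_n).

Lemma cvg_prodr (I : Type) (s : seq I) (f : I -> R^nat) (l : I -> R) :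
  (forall i, f i @ \oo --> l i) ->
  (fun m => \prod_(i <- s) f i m) @ \oo --> \prod_(i <- s) l i.
Proof.
move=> fl; elim: s => [|i s IH].
  rewrite big_nil; under eq_fun do rewrite big_nil; exact: cvg_cst.
by rewrite big_cons; under eq_fun do rewrite big_cons; exact: cvgM.
Qed.

Lemma smooth_box_bound e a b x : (forall j, a 0 j < b 0 j) ->
  `|smooth_box e a b x| <= (\prod_j (b 0 j - a 0 j))^-1.
Proof.
move=> ab; rewrite /smooth_box /tprod normr_prod -prodfV.
by apply: ler_prod => j _; rewrite normr_ge0/= sdens_bound.
Qed.

Lemma smooth_box_cvg (e_ : R^nat) a b x : (forall m, 0 < e_ m) -> e_ @ \oo --> (0 : R) ->
  (forall j, a 0 j < b 0 j) ->
  (fun m => smooth_box (e_ m) a b x) @ \oo -->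
    (\prod_j (b 0 j - a 0 j))^-1 * \1_(rV_box a b) x.
Proof.
move=> e0 ecvg ab.
have -> : (\prod_j (b 0 j - a 0 j))^-1 * \1_(rV_box a b) x =
   \prod_j ((b 0 j - a 0 j)^-1 * (a 0 j <= x 0 j < b 0 j)%R%:R).
  rewrite big_split/= prodfV; congr (_ * _).
  rewrite indicE; case: (boolP (x \in rV_box a b)) => [/set_mem xab|/negP xab].
    by rewrite big1// => j _; have := xab j; rewrite /= in_itv/= => ->.
  apply/esym/eqP; have [j xj] : exists j, ~ (a 0 j <= x 0 j < b 0 j).
    apply/existsNP => h; apply: xab; apply/mem_set => j /=; rewrite in_itv/=; exact: h.
  by rewrite (bigD1 j)//=; move/negP/negbTE : xj => ->; rewrite mul0r.
by apply: cvg_prodr => j; exact: sdens_cvg.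
Qed.

(** Dominated convergence: the smoothed densities are bounded by the inverse volume of the box,
    whatever [e] is. *)
Lemma int_smooth_box_cvg (e_ : R^nat) A B a b u :
  (forall m, 0 < e_ m) -> e_ @ \oo --> (0 : R) ->
  (forall j, a 0 j < b 0 j) -> rV_box a b `<=` rV_cbox A B ->
  mu.-integrable (rV_cbox A B) (EFin \o u) ->
  (fun m => \int[mu]_(x in rV_cbox A B) (u x * smooth_box (e_ m) a b x)) @ \oo -->
    box_avg u a b.
Proof.
set P := rV_cbox A B; set Q := rV_box a b; set c := (\prod_j (b 0 j - a 0 j))^-1.
move=> e0 ecvg ab QP iu.
have cP : compact P by exact: cbox_compact.
have mP : measurable (P : set T) by exact: cbox_measurable.
have mQ : measurable (Q : set T) by exact: box_measurable.
have iuQ : mu.-integrable Q (EFin \o u) by exact: integrableS iu.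
have c0 : 0 < c by rewrite invr_gt0 prodr_gt0// => j _; rewrite subr_gt0.
have mu_ : measurable_fun (P : set T) u by apply/measurable_EFinP; case/integrableP: iu.
have im m : mu.-integrable P (EFin \o (fun x => u x * smooth_box (e_ m) a b x)).
  by apply: integrableM_continuous => //; exact: continuous_smooth_box.
pose f x := u x * (c * \1_Q x).
have iuR : mu.-integrable P (EFin \o (u \_ Q)).
  rewrite -restrict_EFin; apply/integrable_restrict => //.
  by rewrite (setIidr QP).
have fE x : f x = c * (u \_ Q) x.
  rewrite /f mulrCA indicE patchE.
  by case: ifP => _; rewrite ?mulr1// mulr0.
have iF : mu.-integrable P (EFin \o f).
  by rewrite (funext fE); exact: integrable_mulrl.
have ae1 : {ae mu, forall x, P x ->
    (fun m => (u x * smooth_box (e_ m) a b x)%:E) @ \oo --> (f x)%:E}.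
  apply: aeW => x _; apply: cvg_EFin; first exact: nearW.
  by apply: cvgMr; exact: smooth_box_cvg.
have ae2 : {ae mu, forall x m, P x ->
    (`|(u x * smooth_box (e_ m) a b x)%:E| <= (c * `|u x|)%:E)%E}.
  apply: aeW => x m _; rewrite /= lee_fin normrM mulrC ler_wpM2r//.
  exact: smooth_box_bound.
have ig : mu.-integrable P (EFin \o (fun x => c * `|u x|)).
  by apply: integrable_mulrl => //; exact: integrable_norm.
have [fi _ lim] := @dominated_convergence _ _ _ mu P mP _ _ _
  (fun m => measurable_int _ (im m)) (measurable_int _ iF) ae1 ig ae2.
have -> : box_avg u a b = \int[mu]_(x in P) f x.
  under [RHS]eq_Rintegral do rewrite fE.
  by rewrite RintegralZl// -Rintegral_mkcondr (setIidr QP).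
by apply: fine_cvg; rewrite fineK//; exact: integrable_fin_num.
Qed.

(** Only the lower corners need a strict margin, because the smoothed indicators reach [2 e] to the
    left of their intervals and not to the right. *)
Lemma box_avg_cmp D u Du A B a b a' b' (h : R) :
  weak_gradient D u Du -> rV_cbox A B `<=` D ->
  mu.-integrable (rV_cbox A B) (EFin \o u) ->
  (forall i, mu.-integrable (rV_cbox A B) (EFin \o (fun x => Du x 0 i))) ->
  0 < h ->
  (forall j, [/\ A 0 j < a 0 j, h <= b 0 j - a 0 j & b 0 j <= B 0 j]) ->
  (forall j, [/\ A 0 j < a' 0 j, h <= b' 0 j - a' 0 j & b' 0 j <= B 0 j]) ->
  `|box_avg u a b - box_avg u a' b'| <=
  h^-1 ^+ n.-1 * \sum_i \int[mu]_(x in rV_cbox A B) `|Du x 0 i|.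
Proof.
move=> wg PD iu iDu h0 ab ab'.
(* The smallest margin at the lower corners; [e_ m] never exceeds half of it. *)
pose m0 := \big[Num.min/1]_(j < n) Num.min (a 0 j - A 0 j) (a' 0 j - A 0 j).
have m00 : 0 < m0.
  apply/bigmin_gtP; split=> // j _.
  have [? _ _] := ab j; have [? _ _] := ab' j.
  by rewrite lt_min !subr_gt0; apply/andP; split.
pose e_ (m : nat) : R := m0 / 2 * m.+1%:R^-1.
have e0 m : 0 < e_ m by rewrite mulr_gt0 ?invr_gt0// divr_gt0.
have ecvg : e_ @ \oo --> (0 : R).
  rewrite -(mulr0 (m0 / 2)); apply: cvgMr; exact: cvg_harmonic.
have em m j : 2 * e_ m <= Num.min (a 0 j - A 0 j) (a' 0 j - A 0 j).
  apply: (@le_trans _ _ m0); last exact: bigmin_le_cond.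
  rewrite /e_ mulrA [2 * _]mulrC divfK ?pnatr_eq0// ler_piMr ?(ltW m00)//.
  by rewrite invf_le1// ler1n.
have boxP (c d : 'rV[R]_n) : (forall j, [/\ A 0 j < c 0 j, h <= d 0 j - c 0 j & d 0 j <= B 0 j]) ->
    rV_box c d `<=` rV_cbox A B.
  move=> cd x xcd j; have := xcd j; have [p1 _ p2] := cd j.
  by rewrite /= !in_itv/= => /andP[q1 q2]; apply/andP; split; lra.
have lt_ab j : a 0 j < b 0 j by have [_ + _] := ab j; lra.
have lt_ab' j : a' 0 j < b' 0 j by have [_ + _] := ab' j; lra.
have c1 := int_smooth_box_cvg e0 ecvg lt_ab (boxP _ _ ab) iu.
have c2 := int_smooth_box_cvg e0 ecvg lt_ab' (boxP _ _ ab') iu.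
apply: (cvgr_to_le (cvg_norm (cvgB c1 c2))).
apply: nearW => m; apply: (smooth_box_cmp wg PD iu iDu h0 (e0 m)) => j.
  have [p1 p2 p3] := ab j; split=> //.
  by have := em m j; rewrite le_min => /andP[+ _]; lra.
have [p1 p2 p3] := ab' j; split=> //.
by have := em m j; rewrite le_min => /andP[_]; lra.
Qed.

End BoxAverages.

(** The starting index matters: averages of [u] are controlled only from the scale at which their
    cubes lie well inside the domain. *)
Lemma geometric_tail {R : realType} (a : R^nat) (B t : R) (k0 : nat) :
  0 <= B -> 0 < t < 1 ->
  (forall k, (k0 <= k)%N -> `|a k - a k.+1| <= B * t ^+ k) ->
  forall k m, (k0 <= k)%N -> `|a k - a (k + m)%N| <= B * t ^+ k / (1 - t).
Proof.
move=> B0 /andP[t0 t1] ha k m k0k.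
have : `|a k - a (k + m)%N| <= B * t ^+ k * ((1 - t ^+ m) / (1 - t)).
  elim: m => [|m IH]; first by rewrite addn0 subrr normr0 expr0 subrr mul0r mulr0.
  rewrite addnS; have -> : a k - a (k + m).+1 = (a k - a (k + m)%N) +
      (a (k + m)%N - a (k + m).+1) by ring.
  apply: (le_trans (ler_normD _ _)).
  have := lerD IH (ha (k + m)%N (leq_trans k0k (leq_addr m k))).
  move=> /le_trans; apply; rewrite exprD exprS.
  by rewrite le_eqVlt; apply/orP; left; apply/eqP; field; rewrite subr_eq0 gt_eqF.
move=> /le_trans; apply; rewrite mulrA ler_pM2r ?invr_gt0 ?subr_gt0//.
rewrite ler_piMr ?mulr_ge0// ?exprn_ge0 ?(ltW t0)//.
by rewrite lerBlDr lerDl exprn_ge0// ltW.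
Qed.

Lemma geometric_cvg {R : realType} (a : R^nat) (B t : R) (k0 : nat) :
  0 <= B -> 0 < t < 1 ->
  (forall k, (k0 <= k)%N -> `|a k - a k.+1| <= B * t ^+ k) ->
  cvgn a /\ `|a k0 - limn a| <= B * t ^+ k0 / (1 - t).
Proof.
move=> B0 t01 ha.
have tail := geometric_tail B0 t01 ha; have /andP[t0 t1] := t01.
have ca : cvgn a.
  suff : cauchy (a @ \oo) by exact: cauchy_cvg.
  suff : cauchy_ex (a @ \oo) by exact: cauchy_exP.
  move=> e e0.
  have c0 : (fun k => B / (1 - t) * t ^+ k) @ \oo --> (0 : R).
    rewrite -(mulr0 (B / (1 - t))); apply: cvgMr; apply: cvg_expr.
    by rewrite gtr0_norm.
  have [k _ /(_ (k + k0)%N (leq_addr _ _)) kP] := cvgr_lt 0 c0 _ e0.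
  exists (a (k + k0)%N); exists (k + k0)%N => // m /= km; rewrite -ball_normE/=.
  apply: le_lt_trans kP; rewrite mulrAC -(subnKC km); apply: tail.
  exact: leq_addl.
split=> //; have c1 : (fun k => `|a k0 - a k|) @ \oo --> `|a k0 - limn a|.
  by apply: cvg_norm; apply: cvgB => //; exact: cvg_cst.
apply: (cvgr_to_le c1); exists k0 => // k /= k0k.
by rewrite -(subnKC k0k); exact: tail.
Qed.

Section Splitting.
Context {R : realType} {n : nat}.
Notation mu := (@leb R n).
Notation T := (leb_type R n).
Implicit Types (c : 'rV[R]_n) (w : 'rV[R]_n -> R).

Definition dyadic_side (s : 'I_n -> R) (m : 'I_n -> nat) : 'rV[R]_n :=
  \row_j (s j * 2 ^+ m j).

(** The exponents may differ between coordinates so that one side is halved at a time, by induction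
    on the total number of halvings. *)
Lemma dyadic_split w (Q : set 'rV[R]_n) (s : 'I_n -> R) (e : R) : (forall j, 0 < s j) ->
  measurable (Q : set T) -> mu.-integrable Q (EFin \o w) ->
  (forall c, rV_box c (c + \row_j s j) `<=` Q ->
    `|\int[mu]_(x in rV_box c (c + \row_j s j)) w x| <= e * \prod_j s j) ->
  forall m c, rV_box c (c + dyadic_side s m) `<=` Q ->
    `|\int[mu]_(x in rV_box c (c + dyadic_side s m)) w x| <=
      e * \prod_j (s j * 2 ^+ m j).
Proof.
move=> s0 mQ iw base m; have [M] := ubnP (\sum_j m j)%N.
elim: M m => // M IH m mM c cQ.
have [/eqP|] := eqVneq (\sum_j m j)%N 0%N.
  rewrite sum_nat_eq0 => /forallP m0.
  have mj j : m j = 0%N by apply/eqP; exact: (m0 j).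
  have E : dyadic_side s m = \row_j s j.
    by apply/rowP => j; rewrite !mxE mj expr0 mulr1.
  rewrite E in cQ *; under eq_bigr do rewrite mj expr0 mulr1.
  exact: base.
rewrite sum_nat_eq0 => /forallPn[/= i mi].
have {}mi : (0 < m i)%N by rewrite lt0n.
pose m' j := if j == i then (m j).-1 else m j.
have m'M : (\sum_j m' j < M)%N.
  rewrite -ltnS; apply: leq_trans mM.
  rewrite ltnS (bigD1 i)//= [X in (_ < X)%N](bigD1 i)//= {1}/m' eqxx.
  rewrite (eq_bigr m); last by move=> j /negbTE ji; rewrite /m' ji.
  by rewrite ltn_add2r prednK.
pose c' : 'rV[R]_n := c + (s i * 2 ^+ m' i) *: delta_mx 0 i.
have m'i : 2 ^+ m i = 2 * 2 ^+ m' i :> R.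
  by rewrite /m' eqxx -exprS prednK.
have si0 : 0 < s i * 2 ^+ m' i by rewrite mulr_gt0 ?exprn_gt0.
have U : rV_box c (c + dyadic_side s m) =
   rV_box c (c + dyadic_side s m') `|` rV_box c' (c' + dyadic_side s m').
  apply/seteqP; split => x.
    move=> xc; have [xi|xi] := ltP (x 0 i) (c 0 i + s i * 2 ^+ m' i).
      left=> j; have := xc j; rewrite /= !in_itv/= !mxE.
      have [->|ji] := eqVneq j i; first by rewrite xi => /andP[->].
      by rewrite /m' (negbTE ji).
    right=> j; have := xc j; rewrite /= !in_itv/= !mxE eqxx/=.
    have [->|ji] := eqVneq j i; first by rewrite m'i mulr1; lra.
    by rewrite /m' (negbTE ji) mulr0 addr0.
  move=> [xc|xc] j; have := xc j; rewrite /= !in_itv/= !mxE.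
    have [->|ji] := eqVneq j i; first by rewrite m'i; lra.
    by rewrite /m' (negbTE ji).
  rewrite eqxx/=; have [->|ji] := eqVneq j i; first by rewrite m'i mulr1; lra.
  by rewrite /m' (negbTE ji) mulr0 addr0.
rewrite U Rintegral_setU; [|exact: box_measurable|exact: box_measurable| |].
- apply: (le_trans (ler_normD _ _)).
  have h1 := IH m' m'M c (subset_trans (@subsetUl _ _ _) (eq_ind _ (fun X => X `<=` Q) cQ _ U)).
  have h2 := IH m' m'M c' (subset_trans (@subsetUr _ _ _) (eq_ind _ (fun X => X `<=` Q) cQ _ U)).
  apply: (le_trans (lerD h1 h2)).
  rewrite -mulr2n -mulrnAr (bigD1 i)//= [X in _ <= _ * X](bigD1 i)//= m'i.
  rewrite (eq_bigr (fun j => s j * 2 ^+ m j)); last by move=> j /negbTE ji; rewrite /m' ji.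
  by rewrite le_eqVlt; apply/orP; left; apply/eqP; ring.
- apply: integrableS iw => //; rewrite -U => //; exact: box_measurable.
- apply/disj_setPS => x [/(_ i) + /(_ i)]; rewrite /= !in_itv/= !mxE !eqxx/= mulr1.
  by move=> /andP[_ x1] /andP[x2 _]; lra.
Qed.

End Splitting.

(** * The continuous representative *)

Section Cubes.
Context {R : realType} {n : nat}.
Implicit Types (x z : 'rV[R]_n).

Definition cube z (r : R) : set 'rV[R]_n := rV_cbox (z - const_mx r) (z + const_mx r).

Lemma cubeP z r x : 0 <= r -> cube z r x <-> `|x - z| <= r.
Proof.
move=> r0; split.
  move=> h; apply/rV_normP => // i; have := h i; rewrite /= in_itv/= !mxE.
  by rewrite ler_norml; lra.
move=> /rV_normP => /(_ r0) h i; have := h i; rewrite /= in_itv/= !mxE.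
by rewrite ler_norml; lra.
Qed.

Lemma cube_sub z r z' r' : 0 <= r -> `|z - z'| + r <= r' -> cube z r `<=` cube z' r'.
Proof.
move=> r0 h x /(cubeP _ _ r0) xz; apply/cubeP; first exact: le_trans (addr_ge0 _ _) h.
have -> : x - z' = (z - z') + (x - z) by rewrite [RHS]addrC subrKA.
by apply: le_trans h; apply: (le_trans (ler_normD _ _)); rewrite lerD2l.
Qed.

Lemma cube_ball z r : ball z r `<=` cube z r.
Proof.
move=> x; rewrite -ball_normE/= => xz; apply/cubeP; last by rewrite distrC ltW.
exact: le_trans (ltW xz).
Qed.

Lemma cube_sub_ball z r s : 0 <= r -> r < s -> cube z r `<=` ball z s.
Proof.
move=> r0 rs x /(cubeP _ _ r0) xz; rewrite -ball_normE/= distrC.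
exact: le_lt_trans rs.
Qed.

Lemma open_cube (D : set 'rV[R]_n) z : open D -> D z -> exists2 r, 0 < r & cube z r `<=` D.
Proof.
move=> oD Dz; have /nbhs_ballP[e /= e0 eD] : nbhs z D by exact: open_nbhs_nbhs.
exists (e / 2); first by rewrite divr_gt0.
apply: subset_trans eD; apply: cube_sub_ball; first by rewrite ltW// divr_gt0.
by rewrite ltr_pdivrMr// ltr_pMr// ltr1n.
Qed.

Lemma cube_compact z r : compact (cube z r).
Proof. exact: cbox_compact. Qed.

End Cubes.

Lemma powR_exprn {R : realType} (x a : R) k : 0 <= x -> (x ^+ k) `^ a = (x `^ a) ^+ k.
Proof.
move=> x0; elim: k => [|k IH]; first by rewrite !expr0 powR1.
by rewrite !exprS powRM ?exprn_ge0// IH.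
Qed.

Lemma shifted_cell {R : realType} (h x y : R) : 0 < h -> - h <= x - y -> x - y <= h ->
  [/\ h <= y + h - (y - h), x - 2 * h <= y - h & y + h <= x + 2 * h].
Proof. by move=> *; split; lra. Qed.

Lemma three_dist {R : realType} (p q a b c t X : R) : t < 1 ->
  `|p - a| <= c / (1 - t) * X -> `|p - q| <= c * X -> `|q - b| <= c / (1 - t) * X ->
  `|a - b| <= c * (1 + 2 / (1 - t)) * X.
Proof.
move=> t1 e1 e2 e3.
have -> : c * (1 + 2 / (1 - t)) * X = c / (1 - t) * X + c * X + c / (1 - t) * X.
  by field; rewrite subr_eq0 gt_eqF.
have -> : a - b = - (p - a) + (p - q) + (q - b) by ring.
apply: (le_trans (ler_normD _ _)); apply: lerD => //.
by apply: (le_trans (ler_normD _ _)); rewrite normrN; apply: lerD.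
Qed.

(** * Interior Hölder estimate for the limit of the averages *)

Section InteriorHolder.
Context {R : realType} {n : nat}.
Notation mu := (@leb R n).
Notation T := (leb_type R n).
Context (Om : set 'rV[R]_n) (oOm : open Om).
Context (u : 'rV[R]_n -> R) (Du : 'rV[R]_n -> 'rV[R]_n) (wg : weak_gradient Om u Du).
Context (iu : forall K : set 'rV[R]_n, compact K -> K `<=` Om -> mu.-integrable K (EFin \o u)).
Context (iDu : forall (K : set 'rV[R]_n) i, compact K -> K `<=` Om ->
  mu.-integrable K (EFin \o (fun x => Du x 0 i))).
Context (C al kap : R) (C0 : 0 <= C) (al0 : 0 < al) (kap1 : 1 <= kap).
Context (decay : forall z (r : R), 0 < r <= 1 -> cube z (kap * r) `<=` Om ->
  \sum_i \int[mu]_(x in cube z r) `|Du x 0 i| <= C * r `^ (n.-1%:R + al)).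

Let cavg (x : 'rV[R]_n) (h : R) := box_avg u (x - const_mx h) (x + const_mx h).
Let C1 := C * 3 `^ (n.-1%:R + al).

Let C1_ge0 : 0 <= C1. Proof. by rewrite mulr_ge0// powR_ge0. Qed.

(** The comparison costs [(s h)^-(n-1)] and the decay on the cube of radius [3 h] gives
    [(3 h)^(n-1+al)], which leaves [h^al]. The boxes stay within [2 h] of [x], and the 3 leaves the
    strict margin that smoothing needs. The ratio [s] admits boxes that are not cubes. *)
Lemma avg_close (x a b : 'rV[R]_n) (h s : R) : 0 < h -> 3 * h <= 1 -> cube x (kap * (3 * h)) `<=` Om ->
  0 < s <= 1 ->
  (forall j, [/\ s * h <= b 0 j - a 0 j, x 0 j - 2 * h <= a 0 j & b 0 j <= x 0 j + 2 * h]) ->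
  `|cavg x h - box_avg u a b| <= s^-1 ^+ n.-1 * C1 * h `^ al.
Proof.
move=> h0 h1 xOm /andP[s0 s1] ab.
have sh0 : 0 < s * h by rewrite mulr_gt0.
have shh : s * h <= h by rewrite ler_piMl// ltW.
have subOm : cube x (3 * h) `<=` Om.
  apply: subset_trans xOm; apply: cube_sub; first by lra.
  by rewrite subrr normr0 add0r ler_peMl//; lra.
have := @box_avg_cmp _ _ Om u Du (x - const_mx (3 * h)) (x + const_mx (3 * h))
  (x - const_mx h) (x + const_mx h) a b (s * h) wg subOm (iu (@cube_compact _ _ x (3 * h)) subOm)
  (fun i => iDu i (@cube_compact _ _ x (3 * h)) subOm) sh0 _ _.
have h31 : 0 < 3 * h <= 1 by apply/andP; split => //; lra.
move=> /(_ _ _)/le_trans; apply.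
- by move=> j; rewrite !mxE; split; lra.
- by move=> j; have [? ? ?] := ab j; rewrite !mxE; split; lra.
apply: (@le_trans _ _ ((s * h)^-1 ^+ n.-1 * (C * (3 * h) `^ (n.-1%:R + al)))).
  rewrite ler_wpM2l ?exprn_ge0 ?invr_ge0 ?(ltW sh0)//.
  exact: decay.
rewrite powRM ?(ltW h0)// [h `^ _]powRD; last by rewrite (gt_eqF h0) implybT.
rewrite powR_mulrn ?(ltW h0)// invfM exprMn !exprVn /C1.
rewrite le_eqVlt; apply/orP; left; apply/eqP; field.
by rewrite !expf_neq0 ?gt_eqF.
Qed.

Definition holder_rep x := limn (fun k => cavg x (2^-1 ^+ k)).
Let v := holder_rep.
Let t := 2^-1 `^ al : R.

Let t01 : 0 < t < 1.
Proof.
have : 2^-1 `^ al < 1 `^ al :> R.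
  by rewrite gt0_ltr_powR ?nnegrE ?invr_ge0// invf_lt1 ?ltr1n.
by rewrite /t powR_gt0 ?invr_gt0//= powR1.
Qed.

Let hk k : R := 2^-1 ^+ k.
Let hk0 k : 0 < hk k. Proof. by rewrite exprn_gt0// invr_gt0. Qed.
Let hkS k : hk k.+1 = hk k / 2. Proof. by rewrite /hk exprSr. Qed.
Let hkal k : hk k `^ al = t ^+ k. Proof. by rewrite powR_exprn// invr_ge0. Qed.
Let hk_le k j : (k <= j)%N -> hk j <= hk k.
Proof. by move=> kj; rewrite ler_wiXn2l ?invr_ge0// invf_le1 ?ler1n. Qed.

Lemma avg_cvg_rep x k : 3 * hk k <= 1 -> cube x (kap * (3 * hk k)) `<=` Om ->
  `|cavg x (hk k) - v x| <= C1 / (1 - t) * t ^+ k.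
Proof.
move=> k3 kOm.
have [|_] := @geometric_cvg _ (fun j => cavg x (hk j)) C1 t k C1_ge0 t01.
  move=> j kj; have hj := hk_le kj.
  have hj0 := hk0 j; have kap0 : 0 <= kap := le_trans ler01 kap1.
  (* The smaller cube has side [2 * hk j.+1 = hk j], so the ratio of sides is 1. *)
  have := @avg_close x (x - const_mx (hk j.+1)) (x + const_mx (hk j.+1)) (hk j) 1 hj0.
  rewrite invr1 expr1n !mul1r -hkal; apply.
  - by lra.
  - apply: subset_trans kOm; apply: cube_sub; first by rewrite mulr_ge0//; lra.
    by rewrite subrr normr0 add0r ler_wpM2l//; lra.
  - by rewrite ltr01 lexx.
  - by move=> i; rewrite !mxE hkS; split; lra.
by rewrite mulrAC.
Qed.

Let C3 := C1 * (1 + 2 / (1 - t)).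

Lemma rep_holder_dyadic x y k : 3 * hk k <= 1 -> cube x (4 * kap * hk k) `<=` Om ->
  `|x - y| <= hk k -> `|v x - v y| <= C3 * t ^+ k.
Proof.
move=> k3 kOm xy; have h0 := hk0 k.
have kh : hk k <= kap * hk k by rewrite ler_peMl// ltW.
have xOm : cube x (kap * (3 * hk k)) `<=` Om.
  apply: subset_trans kOm; apply: cube_sub; first by lra.
  by rewrite subrr normr0; lra.
have yOm : cube y (kap * (3 * hk k)) `<=` Om.
  apply: subset_trans kOm; apply: cube_sub; first by lra.
  by rewrite distrC; lra.
have e1 := avg_cvg_rep k3 xOm; have e2 := avg_cvg_rep k3 yOm.
have := @avg_close x (y - const_mx (hk k)) (y + const_mx (hk k)) (hk k) 1 h0 k3 xOm.
rewrite ltr01 lexx invr1 expr1n !mul1r hkal => /(_ isT) e3.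
have {}e3 : `|cavg x (hk k) - cavg y (hk k)| <= C1 * t ^+ k.
  apply: e3 => j; rewrite !mxE; have := coord_le_norm (x - y) j; rewrite !mxE => xyj.
  have := le_trans xyj xy; rewrite ler_norml => /andP[q1 q2].
  exact: shifted_cell.
by apply: three_dist e1 e3 e2; case/andP: t01.
Qed.

Lemma rep_holder x y : 6 * `|x - y| <= 1 -> cube x (8 * kap * `|x - y|) `<=` Om ->
  `|v x - v y| <= C3 * 2 `^ al * `|x - y| `^ al.
Proof.
have C30 : 0 <= C3.
  by case/andP: t01 => _ t1; rewrite mulr_ge0// addr_ge0// divr_ge0// subr_ge0 ltW.
have [->|xy] := eqVneq x y.
  move=> _ _; rewrite !subrr normr0.
  by apply: mulr_ge0; [apply: mulr_ge0 => //|]; exact: powR_ge0.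
have d0 : 0 < `|x - y| by rewrite normr_gt0 subr_eq0.
move: d0; set d := `|x - y| => d0 d6 xOm.
have [k kd] : exists k, hk k.+1 < d.
  have c0 : hk @ \oo --> (0 : R) by apply: cvg_expr; rewrite ger0_norm ?invr_ge0// invf_lt1 ?ltr1n.
  have [k _ kP] := cvgr_lt 0 c0 _ d0.
  by exists k; apply: (kP k.+1) => /=.
(* Minimality gives [hk k.+1 < d <= hk k], hence [hk k <= 2 * d]. This 2 turns [4 * kap] into
   [8 * kap] and puts the power [al] of 2 into the constant. *)
case: (ex_minnP (ex_intro (fun k => hk k.+1 < d) k kd)) => {kd}k kd kmin.
have dk : d <= hk k.
  case: k kd kmin => [|k] kd kmin; first by rewrite /hk expr0; lra.
  by rewrite leNgt; apply/negP => /kmin; rewrite ltnn.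
have hk2 : hk k <= 2 * d by move: kd; rewrite hkS; lra.
have k3 : 3 * hk k <= 1 by lra.
have kap0 : 0 <= kap := le_trans ler01 kap1.
have kOm : cube x (4 * kap * hk k) `<=` Om.
  apply: subset_trans xOm; apply: cube_sub; first by rewrite !mulr_ge0// ltW.
  rewrite subrr normr0 add0r (_ : 8 * kap * d = 4 * kap * (2 * d)); last by ring.
  by rewrite ler_wpM2l// mulr_ge0.
apply: (le_trans (rep_holder_dyadic k3 kOm dk)).
rewrite -mulrA ler_wpM2l// -powRM ?(ltW d0)// -hkal ge0_ler_powR ?(ltW al0)//.
- by rewrite nnegrE ltW.
- by rewrite nnegrE mulr_ge0// ltW.
Qed.

Let C3_ge0 : 0 <= C3.
Proof.
by case/andP: t01 => _ t1; rewrite mulr_ge0// addr_ge0// divr_ge0// subr_ge0 ltW.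
Qed.

(** Equality with [u] almost everywhere is not yet available, so the integrability of [v] on compact
    sets has to come from continuity. *)
Lemma rep_continuous x : Om x -> {for x, continuous v}.
Proof.
move=> Omx; have [r0 r00 r0Om] := open_cube oOm Omx.
have kap0 : 0 < kap := lt_le_trans ltr01 kap1.
apply/(@cvgrPdist_le _ _ _ (nbhs x) (@nbhs_filter _ x)) => e e0; set C4 := C3 * 2 `^ al.
have C40 : 0 <= C4 by rewrite mulr_ge0// powR_ge0.
have C4p : 0 < C4 + 1 by rewrite ltr_wpDl.
pose d := Num.min (Num.min 6^-1 (r0 / (8 * kap))) ((e / (C4 + 1)) `^ al^-1).
have d0 : 0 < d.
  rewrite !lt_min -andbA; apply/and3P; split;
  by rewrite ?powR_gt0 ?invr_gt0 ?divr_gt0 ?mulr_gt0.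
near=> y.
have xyd : `|x - y| <= d.
  near: y; apply/nbhs_ballP; exists d => //= y; rewrite -ball_normE/=; exact: ltW.
have [d1 d2 d3] : [/\ `|x - y| <= 6^-1, `|x - y| <= r0 / (8 * kap) &
    `|x - y| <= (e / (C4 + 1)) `^ al^-1].
  by move: xyd; rewrite !le_min => /andP[/andP[]].
have h : `|v x - v y| <= C4 * `|x - y| `^ al.
  apply: rep_holder; first by rewrite mulrC -ler_pdivlMr// mul1r.
  apply: subset_trans r0Om; apply: cube_sub; first by rewrite !mulr_ge0// ltW.
  by rewrite subrr normr0 add0r mulrC -ler_pdivlMr// mulr_gt0.
apply: (le_trans h); apply: (@le_trans _ _ (C4 * (e / (C4 + 1)))).
  rewrite ler_wpM2l//.
  have : `|x - y| `^ al <= ((e / (C4 + 1)) `^ al^-1) `^ al.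
    by rewrite ge0_ler_powR ?(ltW al0)// nnegrE ?powR_ge0.
  by rewrite -powRrM mulVf ?gt_eqF// powRr1// divr_ge0// ltW.
by rewrite mulrCA ler_piMr ?(ltW e0)// ler_pdivrMr// mul1r lerDl.
Unshelve. all: by end_near. Qed.

Lemma rep_integrable a b (K : set 'rV[R]_n) : compact K -> K `<=` Om -> rV_box a b `<=` K ->
  mu.-integrable (rV_box a b) (EFin \o v).
Proof.
move=> cK KOm abK; apply: measurable_bounded_integrable.
- exact: box_measurable.
- exact: box_fin.
- apply: (@measurable_funS _ _ T R (Om : set T)); first exact: open_leb_measurable.
    exact: subset_trans KOm.
  exact: (open_continuous_leb_measurable oOm rep_continuous).
have /compact_bounded : compact (v @` K).
  apply: continuous_compact => //; apply: continuous_in_subspaceT => x /set_mem Kx.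
  exact/rep_continuous/KOm.
move=> [M [Mr MP]]; exists M; split => // r Mr' x Px.
by apply: MP => //; exists x => //; exact: abK.
Qed.

(** The average of [u] over the cell is close to [v c] by comparison with the cube at [c] (the terms
    in [C1]), and [v] stays close to [v c] on the cell (the term [C3]). *)
Lemma cell_estimate c (s : 'I_n -> R) (q : R) k : 0 < q <= 1 ->
  (forall j, q * hk k <= s j <= hk k) -> 3 * hk k <= 1 -> cube c (4 * kap * hk k) `<=` Om ->
  `|\int[mu]_(x in rV_box c (c + \row_j s j)) (u x - v x)| <=
    (q^-1 ^+ n.-1 * C1 + C1 / (1 - t) + C3) * t ^+ k * \prod_j s j.
Proof.
move=> /andP[q0 q1] sq k3 kOm; have h0 := hk0 k.
have s0 j : 0 < s j by have /andP[+ _] := sq j; apply: lt_le_trans; rewrite mulr_gt0.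
have kap0 : 0 <= kap := le_trans ler01 kap1.
have kap3 : cube c (kap * (3 * hk k)) `<=` Om.
  apply: subset_trans kOm; apply: cube_sub; first by rewrite !mulr_ge0// ltW.
  rewrite subrr normr0 add0r (_ : 4 * kap * hk k = kap * (4 * hk k)); last by ring.
  by rewrite ler_wpM2l// ler_wpM2r ?ler_nat// ltW.
have kOm' : cube c (hk k) `<=` Om.
  apply: subset_trans kOm; apply: cube_sub; first exact: ltW.
  rewrite subrr normr0 add0r ler_peMl ?(ltW h0)//.
  by apply: (le_trans kap1); rewrite ler_peMl// ler1n.
set b := c + _; have bE j : b 0 j = c 0 j + s j by rewrite !mxE.
have cellsub : rV_box c b `<=` cube c (hk k).
  move=> x xc j; have := xc j; have /andP[_ sj] := sq j.
  by rewrite /= !in_itv/= bE !mxE => /andP[x1 x2]; apply/andP; split; lra.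
have mcell : measurable (rV_box c b : set T) by exact: box_measurable.
have iuc : mu.-integrable (rV_box c b) (EFin \o u).
  apply: integrableS (iu (@cube_compact _ _ c (hk k)) kOm') => //.
  exact: cbox_measurable.
have ivc := rep_integrable (@cube_compact _ _ c (hk k)) kOm' cellsub.
have prodE : \prod_j (b 0 j - c 0 j) = \prod_j s j.
  by apply: eq_bigr => j _; rewrite bE addrAC subrr add0r.
have P0 : 0 < \prod_j s j by apply: prodr_gt0 => j _.
have mucell : fine (mu (rV_box c b)) = \prod_j s j.
  by rewrite leb_box ?prodE//= => j; rewrite bE lerDl ltW.
have icst (y : R) : mu.-integrable (rV_box c b) (EFin \o cst y).
  by apply: measurable_bounded_integrable => //; [exact: box_fin|exact: bounded_cst].
have ivd : mu.-integrable (rV_box c b) (EFin \o (fun x => v x - v c)).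
  by have := integrableB mcell ivc (icst (v c)); apply: eq_integrable.
have Eu : \int[mu]_(x in rV_box c b) u x = \prod_j s j * box_avg u c b.
  by rewrite /box_avg prodE mulVKf// gt_eqF.
have Ev : \int[mu]_(x in rV_box c b) v x = \prod_j s j * v c +
    \int[mu]_(x in rV_box c b) (v x - v c).
  have EB := RintegralB mcell ivc (icst (v c)).
  have EC := Rintegral_cst mu mcell (v c).
  rewrite mucell in EC.
  have EBC := etrans EB (congr1 (fun y => _ - y) EC).
  by rewrite EBC [_ * v c]mulrC subrKC.
rewrite (RintegralB mcell iuc ivc) Eu Ev.
have e1 : `|box_avg u c b - v c| <= (q^-1 ^+ n.-1 * C1 + C1 / (1 - t)) * t ^+ k.
  have a1 : `|cavg c (hk k) - box_avg u c b| <= q^-1 ^+ n.-1 * C1 * hk k `^ al.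
    apply: avg_close => //; first by rewrite q0.
    move=> j; rewrite bE; have /andP[sj1 sj2] := sq j.
    by split; [rewrite addrAC subrr add0r|rewrite gerBl mulr_ge0// ltW|rewrite lerD2l; lra].
  have a2 := avg_cvg_rep k3 kap3.
  rewrite hkal in a1; rewrite mulrDl.
  rewrite (_ : box_avg u c b - v c =
    - (cavg c (hk k) - box_avg u c b) + (cavg c (hk k) - v c)); last first.
    by rewrite opprB subrKA.
  by apply: (le_trans (ler_normD _ _)); rewrite normrN; apply: lerD.
have e2 : `|\int[mu]_(x in rV_box c b) (v x - v c)| <= C3 * t ^+ k * \prod_j s j.
  apply: (le_trans (le_normr_Rintegral mcell ivd)).
  rewrite -mucell -Rintegral_cst//; apply: le_Rintegral => //; first exact: integrable_norm.
    exact: icst.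
  move=> x /cellsub/(cubeP _ _ (ltW h0)) xc; rewrite distrC.
  by apply: rep_holder_dyadic => //; rewrite distrC.
rewrite opprD addrA -mulrBr (mulrDl _ C3) (mulrDl _ (C3 * _)).
apply: (le_trans (ler_normB _ _)); apply: lerD => //.
by rewrite normrM gtr0_norm// mulrC ler_wpM2r// ltW.
Qed.

(** The box is cut into copies of itself scaled by [2^-k]. On each of them the mean of [u - v] is at
    most a fixed multiple of [t ^+ k], hence so it is on the whole box, and [k] is arbitrarily
    large. *)
Lemma box_int_eq0 z (r : R) (a b : 'rV[R]_n) : 0 < r <= 2^-1 -> cube z (2 * r) `<=` Om ->
  (forall j, a 0 j < b 0 j) -> rV_box a b `<=` cube z r ->
  \int[mu]_(x in rV_box a b) (u x - v x) = 0.
Proof.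
move=> /andP[r0 r2] zOm ab abz.
have aab : rV_box a b a by move=> j; rewrite /= in_itv/= lexx ab.
have kap0 : 0 <= kap := le_trans ler01 kap1.
have zrOm : cube z r `<=` Om.
  by apply: subset_trans zOm; apply: cube_sub; [exact: ltW|rewrite subrr normr0; lra].
(* The cells keep the proportions of the box, so one lower bound [q] on the relative sides serves at
   every level. *)
pose q := \big[Num.min/1]_(j < n) (b 0 j - a 0 j).
have q0 : 0 < q by apply/bigmin_gtP; split=> // j _; rewrite subr_gt0.
have q1 : q <= 1 by exact: bigmin_le_id.
have ab1 j : b 0 j - a 0 j <= 1.
  rewrite leNgt; apply/negP => ab1.
  (* If side [j] were longer than 1, this point would differ from [a] by more than 1 in coordinate
     [j], while the cube has width [2 r <= 1]. The corner [b] cannot be used, as the half-open box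
     omits it. *)
  pose y : 'rV[R]_n := \row_i if i == j then a 0 j + (1 + (b 0 j - a 0 j)) / 2 else a 0 i.
  have : rV_box a b y.
    move=> i; rewrite /= in_itv/= mxE; case: eqP => [->|_]; last by rewrite lexx ab.
    by apply/andP; split; lra.
  move=> /abz /(_ j); have := abz _ aab j; rewrite /= !in_itv/= !mxE eqxx.
  by move=> /andP[+ _] /andP[_]; lra.
pose w x := u x - v x.
have abOm : rV_box a b `<=` Om by exact: subset_trans zrOm.
have iw : mu.-integrable (rV_box a b) (EFin \o w).
  have iuab : mu.-integrable (rV_box a b) (EFin \o u).
    apply: integrableS (iu (@cube_compact _ _ z r) zrOm) => //.
      exact: cbox_measurable.
    exact: box_measurable.
  have ivab := rep_integrable (@cube_compact _ _ z r) zrOm abz.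
  by have := integrableB (box_measurable a b) iuab ivab; apply: eq_integrable => //; exact: box_measurable.
set C5 := q^-1 ^+ n.-1 * C1 + C1 / (1 - t) + C3.
have main k : 3 * hk k <= 1 -> 4 * kap * hk k <= r ->
    `|\int[mu]_(x in rV_box a b) w x| <= C5 * (\prod_j (b 0 j - a 0 j)) * t ^+ k.
  move=> k3 kr; have h0 := hk0 k.
  pose s j := (b 0 j - a 0 j) * hk k.
  have s2 j : s j * 2 ^+ k = b 0 j - a 0 j.
    by rewrite /s /hk -mulrA exprVn mulVf ?mulr1// expf_neq0.
  have bE : a + dyadic_side s (fun=> k) = b.
    by apply/rowP => j; rewrite !mxE s2 subrKC.
  have := @dyadic_split _ _ w (rV_box a b) s (C5 * t ^+ k) _ (box_measurable a b) iw _ (fun=> k) a.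
  rewrite bE => h; rewrite mulrAC.
  rewrite (_ : \prod_j (b 0 j - a 0 j) = \prod_j (s j * 2 ^+ k)); last first.
    by apply: eq_bigr => j _; rewrite s2.
  apply: h => //.
    by move=> j; rewrite mulr_gt0// subr_gt0.
  move=> c cab; apply: (cell_estimate (q := q)) => //.
  - by rewrite q0.
  - move=> j; rewrite /s ler_wpM2r ?(ltW h0)//=; last exact: bigmin_le_cond.
    by rewrite ler_piMl ?(ltW h0).
  - apply: subset_trans zOm; apply: cube_sub; first by rewrite !mulr_ge0// ltW.
    have : rV_box c (c + \row_j s j) c.
      by move=> j; rewrite /= in_itv/= !mxE lexx ltrDl mulr_gt0// subr_gt0.
    move=> /cab/abz/(cubeP _ _ (ltW r0)) cz.
    by rewrite (_ : 2 * r = r + r); [exact: lerD|ring].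
have C5c : (fun k => C5 * (\prod_j (b 0 j - a 0 j)) * t ^+ k) @ \oo --> (0 : R).
  rewrite -(mulr0 (C5 * (\prod_j (b 0 j - a 0 j)))); apply: cvgMr; apply: cvg_expr.
  by case/andP: t01 => *; rewrite gtr0_norm.
have hc : hk @ \oo --> (0 : R).
  by apply: cvg_expr; rewrite ger0_norm ?invr_ge0// invf_lt1 ?ltr1n.
have kap4 : 0 < 4 * kap by rewrite mulr_gt0// (lt_le_trans ltr01).
apply/eqP; rewrite -normr_le0; apply: (cvgr_to_ge C5c); near=> k; apply: main.
  by rewrite mulrC -ler_pdivlMr//; near: k; apply: (cvgr_le 0 hc); rewrite divr_gt0.
rewrite [4 * kap * _]mulrC -ler_pdivlMr//.
near: k; apply: (cvgr_le 0 hc); exact: divr_gt0.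
Unshelve. all: by end_near. Qed.

End InteriorHolder.

(** Rational balls are countable, and for each of them the guarded statement [F q] holds almost
    everywhere. A point then uses a rational ball that contains it and lies inside its own good
    ball. *)
Lemma ae_in_local {R : realType} {n : nat} (D : set 'rV[R]_n) (P : 'rV[R]_n -> Prop) :
  open D -> (forall z, D z -> exists2 r : R, 0 < r &
    {ae @leb R n, forall x, ball z r x -> P x}) -> ae_in D P.
Proof.
move=> oD loc.
pose c (q : 'rV[rat]_n * rat) : 'rV[R]_n := map_mx ratr q.1.
pose F (q : 'rV[rat]_n * rat) (x : 'rV[R]_n) : Prop :=
  {ae @leb R n, forall x, ball (c q) (ratr q.2) x -> P x} -> ball (c q) (ratr q.2) x -> P x.
have Fae q : {ae @leb R n, forall x, F q x}.
  have [h|h] := pselect {ae @leb R n, forall x, ball (c q) (ratr q.2) x -> P x}.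
    by apply: filterS h => x h _.
  by apply: (filterS _ (@filterT _ _ _)) => x _ /h.
have : {ae @leb R n, forall x, forall k : nat, forall q, unpickle k = Some q -> F q x}.
  apply/ae_foralln => k; case: (unpickle k) => [q|].
    by apply: filterS (Fae q) => x Fx _ [<-].
  by apply: (filterS _ (@filterT _ _ _)) => x _ q.
apply: filterS => z Fz Dz; have [r r0 rP] := loc z Dz.
have [s] := rat_in_itvoo (divr_gt0 r0 (ltr0n R 2)).
rewrite in_itv/= => /andP[s0 sr].
have : forall i, exists q : rat, z 0 i - ratr s < ratr q < z 0 i + ratr s.
  move=> i; have [|q] := @rat_in_itvoo R (z 0 i - ratr s) (z 0 i + ratr s).
    by rewrite ltrBlDr -addrA ltrDl addr_gt0.
  by rewrite in_itv/=; exists q.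
move=> /choice[q qP]; pose Q : 'rV[rat]_n * rat := (\row_i q i, s).
have zQ : ball (c Q) (ratr Q.2) z.
  rewrite ball_pset// => i; rewrite -ball_normE/= /c !mxE.
  by rewrite ltr_distlC; move: (qP i); lra.
apply: (Fz (pickle Q) Q) => //; first exact: pickleK.
apply: filterS rP => y yP Qy; apply: yP.
apply: (@le_ball _ _ _ (ratr s + ratr s)); first by rewrite [leRHS]splitr lerD// ltW.
by apply: ball_triangle Qy; exact: ball_sym.
Qed.

Section Representative.
Context {R : realType} {n : nat}.
Notation mu := (@leb R n).
Notation T := (leb_type R n).

Lemma interior_holder (Om : set 'rV[R]_n) (u : 'rV[R]_n -> R) (Du : 'rV[R]_n -> 'rV[R]_n)
    (C al kap : R) :
  open Om -> weak_gradient Om u Du ->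
  (forall K : set 'rV[R]_n, compact K -> K `<=` Om -> mu.-integrable K (EFin \o u)) ->
  (forall (K : set 'rV[R]_n) i, compact K -> K `<=` Om ->
    mu.-integrable K (EFin \o (fun x => Du x 0 i))) ->
  0 <= C -> 0 < al -> 1 <= kap ->
  (forall z (r : R), 0 < r <= 1 -> cube z (kap * r) `<=` Om ->
    \sum_i \int[mu]_(x in cube z r) `|Du x 0 i| <= C * r `^ (n.-1%:R + al)) ->
  exists v : 'rV[R]_n -> R, ae_in Om (fun x => v x = u x) /\
    forall x y, 6 * `|x - y| <= 1 -> cube x (8 * kap * `|x - y|) `<=` Om ->
      `|v x - v y| <= C * 3 `^ (n.-1%:R + al) * (1 + 2 / (1 - 2^-1 `^ al)) * 2 `^ al *
        `|x - y| `^ al.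
Proof.
move=> oOm wg iu iDu C0 al0 kap1 decay; exists (holder_rep u); split; last first.
  by move=> x y; exact: (rep_holder wg iu iDu C0 al0 kap1 decay).
apply: ae_in_local => // z Omz; have [r r0 rOm] := open_cube oOm Omz.
pose d := Num.min (r / 2) 2^-1.
have d0 : 0 < d by rewrite lt_min invr_gt0 ltr0n andbT divr_gt0.
have d2 : 0 < d <= 2^-1 by rewrite d0 ge_min lexx orbT.
have dOm2 : cube z (2 * d) `<=` Om.
  apply: subset_trans rOm; apply: cube_sub; first by rewrite mulr_ge0// ltW.
  rewrite subrr normr0 add0r mulrC -ler_pdivlMr//.
  by rewrite ge_min lexx.
have dOm : cube z d `<=` Om.
  apply: subset_trans dOm2; apply: cube_sub; first exact: ltW.
  by rewrite subrr normr0 add0r; lra.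
pose a : 'rV[R]_n := z - const_mx d; pose b : 'rV[R]_n := z + const_mx d.
have boxsub : rV_box a b `<=` cube z d.
  by move=> x xab j; have := xab j; rewrite /= !in_itv/= => /andP[-> /ltW ->].
have iuab c : rV_box c b `<=` rV_box a b -> mu.-integrable (rV_box c b) (EFin \o u).
  move=> cb; apply: integrableS (iu (cube z d) (@cube_compact _ _ z d) dOm).
  - exact: cbox_measurable.
  - exact: box_measurable.
  - exact: subset_trans boxsub.
have ivab c : rV_box c b `<=` rV_box a b -> mu.-integrable (rV_box c b) (EFin \o holder_rep u).
  move=> cb; apply: (rep_integrable oOm wg iu iDu C0 al0 kap1 decay (@cube_compact _ _ z d) dOm).
  exact: subset_trans boxsub.
have iw c : rV_box c b `<=` rV_box a b ->
    mu.-integrable (rV_box c b) (EFin \o (fun x => u x - holder_rep u x)).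
  move=> cb; have := integrableB (box_measurable c b) (iuab c cb) (ivab c cb).
  by apply: eq_integrable => //; exact: box_measurable.
exists d => //.
have : {ae mu, forall x, rV_box a b x -> u x - holder_rep u x = 0}.
  apply: ae_eq0_boxes; first exact: iw.
  move=> c cb; have iwc := iw c cb.
  have [cltb|] := pselect (forall j, c 0 j < b 0 j).
    rewrite -[LHS]fineK; last exact: (integrable_fin_num (box_measurable c b) iwc).
    congr EFin; apply: (box_int_eq0 oOm wg iu iDu C0 al0 kap1 decay d2 dOm2 cltb).
    exact: subset_trans boxsub.
  move=> /existsNP[j /negP]; rewrite -leNgt => bcj.
  rewrite (_ : rV_box c b = set0) ?integral_set0//.
  apply/seteqP; split => // x /(_ j); rewrite /= in_itv/= => /andP[x1 x2].
  by have := le_lt_trans x1 x2; rewrite ltNge bcj.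
apply: filterS => x h; rewrite -ball_normE/= => xz.
apply/esym/eqP; rewrite -subr_eq0; apply/eqP; apply: h => j.
have := coord_le_norm (z - x) j; move=> /le_lt_trans/(_ xz).
by rewrite /= in_itv/= !mxE ltr_norml => /andP[]; lra.
Qed.

End Representative.

(** * Regularity up to a Lipschitz boundary *)

Section Geometry.
Context {R : realType} {n : nat}.
Implicit Types (D : set 'rV[R]_n) (x y z : 'rV[R]_n).

(** The 6 comes from the dyadic scale of the interior estimate: [hk k <= 2 |x - y|] and
    [3 * hk k <= 1] are both needed there. *)
Definition interior_holder_on D (al M kp : R) (v : 'rV[R]_n -> R) : Prop :=
  forall x y, 6 * `|x - y| <= 1 -> cube x (kp * `|x - y|) `<=` D ->
    `|v x - v y| <= M * `|x - y| `^ al.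

Lemma enorm_le_sum m (y : 'rV[R]_m) : enorm y <= \sum_i `|y 0 i|.
Proof.
have S0 : 0 <= \sum_i `|y 0 i| by exact: sumr_ge0.
rewrite /enorm -[leRHS](ger0_norm S0) -sqrtr_sqr ler_wsqrtr// /dotp expr2 mulr_suml.
apply: ler_sum => i _; apply: (le_trans (ler_norm _)); rewrite normrM ler_wpM2l//.
by rewrite (bigD1 i)//= lerDl; exact: sumr_ge0.
Qed.

Lemma coord_le_enorm m (y : 'rV[R]_m) i : `|y 0 i| <= enorm y.
Proof.
rewrite /enorm -sqrtr_sqr ler_wsqrtr// /dotp (bigD1 i)//= expr2 lerDl.
by apply: sumr_ge0 => j _; exact: sqr_ge0.
Qed.

Lemma enorm_mulmx_le m (B : 'M[R]_(n, m)) :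
  exists2 q : R, 0 <= q & forall w : 'rV[R]_n, enorm (w *m B) <= q * `|w|.
Proof.
exists (\sum_(j < m) \sum_(i < n) `|B i j|).
  by apply: sumr_ge0 => j _; exact: sumr_ge0.
move=> w; apply: (le_trans (enorm_le_sum _)); rewrite mulr_suml; apply: ler_sum => j _.
rewrite mxE; apply: (le_trans (ler_norm_sum _ _ _)); rewrite mulr_suml; apply: ler_sum => i _.
by rewrite normrM mulrC ler_wpM2l//; exact: coord_le_norm.
Qed.

Lemma dotp_le (w e : 'rV[R]_n) : enorm e = 1 -> `|dotp w e| <= n%:R * `|w|.
Proof.
move=> e1; rewrite /dotp; apply: (le_trans (ler_norm_sum _ _ _)).
apply: (@le_trans _ _ (\sum_(i < n) `|w|)); last first.
  by rewrite sumr_const card_ord mulr_natl.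
apply: ler_sum => i _; rewrite normrM -[leRHS]mulr1 ler_pM//; first exact: coord_le_norm.
by rewrite -e1; exact: coord_le_enorm.
Qed.

(* Over the graph of a Lipschitz function, a point of the domain sees an
   interior cone of fixed opening in the direction [- e]. *)
Lemma lipschitz_cone D x0 : open D -> lipschitz_boundary D -> bdry D x0 ->
  exists (e : 'rV[R]_n) (c r : R), [/\ `|e| <= 1, 0 < c <= 1, 0 < r &
    forall x (t : R), D x -> ball x0 r x -> 0 < t <= r -> cube (x - t *: e) (c * t) `<=` D].
Proof.
move=> oD lip bx0; have [Q [e [psi [QQ Qe e1 [L psiL] [U Ux0 UD]]]]] := lip x0 bx0.
have ee : dotp e e = 1.
  have := e1; rewrite /enorm => /(congr1 (fun t => t ^+ 2)); rewrite sqr_sqrtr ?expr1n//.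
  by apply: sumr_ge0 => i _; exact: sqr_ge0.
have en : `|e| <= 1.
  by apply/rV_normP => // i; rewrite -e1; exact: coord_le_enorm.
have [q q0 qP] := enorm_mulmx_le Q^T.
have /nbhs_ballP[s /= s0 sU] : nbhs x0 U by [].
(* [L] comes without a sign. *)
pose L' := Num.max L 0.
have L'0 : 0 <= L' by rewrite le_max lexx orbT.
(* The displacement [- t e + w] lowers the height by [t] up to an error [n |w|], and the graph moves
   by at most [L' q |w|]. So [|w| <= t / k] keeps the point below the graph, and the 1 also ensures
   [|w| <= t]. *)
set k := 1 + n%:R + L' * q.
have k1 : 1 <= k by rewrite /k -addrA lerDl addr_ge0// mulr_ge0.
have k0 : 0 < k := lt_le_trans ltr01 k1.
have s4 : 0 < s / 4 by rewrite divr_gt0.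
exists e, k^-1, (s / 4); split => //; first by rewrite invr_gt0 k0 invf_le1.
move=> x t Dx xx0 /andP[t0 ts] y.
have kt0 : 0 <= k^-1 * t by rewrite mulr_ge0 ?invr_ge0 ?ltW.
move=> /(cubeP _ _ kt0); set w := y - _ => wt.
have yE : y = x - t *: e + w by rewrite /w subrKC.
have wt' : `|w| <= t by apply: (le_trans wt); rewrite ler_piMl ?invf_le1// ltW.
have te : `|t *: e| <= t by rewrite normrZ gtr0_norm// ler_piMr// ltW.
have Ux : U x by apply: sU; apply: le_ball xx0; rewrite ler_pdivrMr// ler_peMr ?ler1n// ltW.
have Uy : U y.
  apply: sU; move: xx0; rewrite -!ball_normE/= => xx0.
  have -> : x0 - y = (x0 - x) + t *: e - w by rewrite yE; apply/rowP => i; rewrite !mxE; ring.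
  apply: (le_lt_trans (ler_normB _ _)); apply: (@lt_le_trans _ _ (s / 4 + s / 4 + s / 4)).
    apply: ltr_leD; last exact: le_trans ts.
    apply: (le_lt_trans (ler_normD _ _)); apply: ltr_leD => //; exact: le_trans ts.
  by lra.
apply/(UD y Uy); move/(UD x Ux): Dx => Dx.
have eQ : e *m Q^T = 0 by rewrite -[e]trmxK -trmx_mul Qe trmx0.
have yQ : y *m Q^T = x *m Q^T + w *m Q^T.
  by rewrite yE mulmxDl mulmxBl -scalemxAl eQ scaler0 subr0.
have ye : dotp y e = dotp x e - t + dotp w e.
  rewrite -[X in _ - X + _]mulr1 -ee yE /dotp mulr_sumr -sumrB -big_split/=.
  by apply: eq_bigr => i _; rewrite !mxE; ring.
have p1 : psi (x *m Q^T) - psi (y *m Q^T) <= L' * (q * `|w|).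
  apply: (le_trans (ler_norm _)); apply: (le_trans (psiL _ _)).
  rewrite yQ opprD addrA subrr add0r -mulNmx.
  apply: (@le_trans _ _ (L' * enorm (- w *m Q^T))).
    by rewrite ler_wpM2r ?sqrtr_ge0// le_max lexx.
  by rewrite ler_wpM2l// -[`|w|]normrN.
have p2 : dotp w e <= n%:R * `|w| := le_trans (ler_norm _) (dotp_le w e1).
have p3 : (1 + n%:R + L' * q) * `|w| <= t by rewrite -/k mulrC -ler_pdivlMr// mulrC.
have w0 : 0 <= `|w| by [].
rewrite ye; move: p1 p2 p3 Dx w0; rewrite !mulrDl mul1r !mulrA.
move: (dotp w e) (dotp x e) (psi _) (psi _) (n%:R * _) (L' * q * _) => *; lra.
Qed.

End Geometry.

Section GlobalHolder.
Context {R : realType} {n : nat}.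
Implicit Types (D : set 'rV[R]_n) (x y z : 'rV[R]_n).
Context (D : set 'rV[R]_n) (al M kp : R).
Context (oD : open D) (al0 : 0 < al) (M0 : 0 <= M) (kp1 : 1 <= kp).
Let class := interior_holder_on D al M kp.
Let kp0 : 0 < kp. Proof. exact: lt_le_trans kp1. Qed.

(* The radius and the constant are uniform over all the functions of [class], so
   that the final constant does not depend on the solution. *)
Definition locally_holder z :=
  exists2 r : R, 0 < r & exists2 K : R, 0 <= K & forall v, class v ->
    forall x y, D x -> D y -> ball z r x -> ball z r y -> `|v x - v y| <= K * `|x - y| `^ al.

Lemma ball_dist z r x y : ball z r x -> ball z r y -> `|x - y| <= 2 * r.
Proof.
rewrite -ball_normE/= => xz yz.
have -> : x - y = (z - y) - (z - x) by apply/rowP => i; rewrite !mxE; ring.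
by apply: (le_trans (ler_normB _ _)); rewrite mulr_natl mulr2n lerD// ltW.
Qed.

Lemma interior_locally_holder z : D z -> locally_holder z.
Proof.
move=> Dz; have [r0 r00 r0D] := open_cube oD Dz.
(* With 1/12 two points of the ball are at distance at most 1/6. The other bound lets a cube of
   radius [2 kp r], centred within [r] of [z], fit into the cube of radius [r0]. *)
pose r := Num.min 12^-1 (r0 / (1 + 2 * kp)).
have k0 : 0 < 1 + 2 * kp by rewrite addr_gt0// mulr_gt0.
have r_gt0 : 0 < r by rewrite lt_min invr_gt0 ltr0n divr_gt0.
have r12 : r <= 12^-1 by rewrite ge_min lexx.
have rr0 : r * (1 + 2 * kp) <= r0 by rewrite -ler_pdivlMr// ge_min lexx orbT.
exists r => //; exists M => // v vc x y _ _ xz yz.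
have xy := ball_dist xz yz.
apply: vc; first by lra.
apply: subset_trans r0D; apply: cube_sub; first by rewrite mulr_ge0// ltW.
have : `|x - z| <= r by move: xz; rewrite -ball_normE/= distrC; exact: ltW.
have := ler_wpM2l (ltW kp0) xy; move: rr0; rewrite mulrDr mulr1 mulrCA [kp * (2 * r)]mulrCA [r * kp]mulrC.
by move: (kp * r) (kp * `|x - y|) (`|x - z|) => *; lra.
Qed.

Lemma boundary_locally_holder z : lipschitz_boundary D -> bdry D z -> locally_holder z.
Proof.
move=> lip bz; have [e [c [r1 [e1 /andP[c0 c1] r10 cone]]]] := lipschitz_cone oD lip bz.
pose t0 := Num.min r1 6^-1.
have t00 : 0 < t0 by rewrite lt_min r10/= invr_gt0 ltr0n.
have t0r : t0 <= r1 by rewrite ge_min lexx.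
have t06 : t0 <= 6^-1 by rewrite ge_min lexx orbT.
(* With this ratio, the step from [X k] to [X k.+1] below is short compared with
   the cube around [X k] that the cone provides. *)
pose th := 1 - c / (2 * kp).
have ck : 0 < c / (2 * kp) <= 2^-1.
  rewrite divr_gt0 ?mulr_gt0//= invfM mulrCA ler_piMr//.
  by rewrite ler_pdivrMr// mul1r (le_trans c1).
have th0 : 0 < th < 1 by rewrite /th; lra.
have th01 : 0 < th `^ al < 1.
  have /andP[h0 h1] := th0.
  have : th `^ al < 1 `^ al by rewrite gt0_ltr_powR ?nnegrE ?ler01// ltW.
  by rewrite powR_gt0//= powR1.
(* The inverse sums the geometric chain from [x - t e] towards [x]; the 1 pays for the last jump to
   [x] itself. *)
pose K1 := M * (1 + (1 - th `^ al)^-1).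
have K10 : 0 <= K1.
  by rewrite mulr_ge0// addr_ge0// invr_ge0 subr_ge0 ltW//; case/andP: th01.
have chain v x t : class v -> D x -> ball z r1 x -> 0 < t <= t0 ->
    `|v (x - t *: e) - v x| <= K1 * t `^ al.
  move=> vc Dx xz /andP[tp tt0].
  pose X k := x - (t * th ^+ k) *: e.
  have tk k : 0 < t * th ^+ k <= t0.
    have /andP[h0 h1] := th0; rewrite mulr_gt0 ?exprn_gt0//=.
    by apply: le_trans tt0; rewrite ler_piMr ?(ltW tp)// exprn_ile1// ltW.
  have XD k : cube (X k) (c * (t * th ^+ k)) `<=` D.
    by have /andP[p1 p2] := tk k; apply: cone => //; rewrite p1 (le_trans p2).
  have step k : `|X k - X k.+1| <= t * th ^+ k * (c / (2 * kp)).
    have -> : X k - X k.+1 = - ((t * th ^+ k) * (c / (2 * kp))) *: e.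
      apply/rowP => i; rewrite !mxE exprSr /th; ring.
    have /andP[p1 p2] := tk k; have /andP[q1 q2] := ck.
    have pq : 0 < t * th ^+ k * (c / (2 * kp)) := mulr_gt0 p1 q1.
    by rewrite normrZ normrN (gtr0_norm pq) ler_piMr// ltW.
  have vX k : `|v (X k) - v (X k.+1)| <= M * t `^ al * (th `^ al) ^+ k.
    have /andP[p1 p2] := tk k; have /andP[q1 q2] := ck; have /andP[h0 h1] := th0.
    have st : `|X k - X k.+1| <= t * th ^+ k.
      by apply: (le_trans (step k)); rewrite ler_piMr ?(ltW p1)//; lra.
    have : `|v (X k) - v (X k.+1)| <= M * `|X k - X k.+1| `^ al.
      apply: vc; first by lra.
      apply: subset_trans (XD k); apply: cube_sub; first by rewrite mulr_ge0// ltW.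
      rewrite subrr normr0 add0r.
      apply: (le_trans (ler_wpM2l (ltW kp0) (step k))).
      rewrite (_ : kp * _ = c * (t * th ^+ k) / 2); last by field; rewrite gt_eqF.
      by rewrite ler_pdivrMr// ler_peMr ?ler1n// ltW// mulr_gt0.
    move=> /le_trans; apply; rewrite -mulrA ler_wpM2l//.
    rewrite -powR_exprn ?(ltW h0)// -powRM ?(ltW tp) ?exprn_ge0 ?(ltW h0)//.
    by rewrite ge0_ler_powR ?(ltW al0) ?nnegrE// ltW.
  have Mt0 : 0 <= M * t `^ al by rewrite mulr_ge0// powR_ge0.
  have tail k : `|v (X 0%N) - v (X k)| <= M * t `^ al / (1 - th `^ al).
    have := @geometric_tail _ (v \o X) _ _ 0 Mt0 th01 (fun k _ => vX k) 0 k (leqnn 0).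
    by rewrite add0n expr0 mulr1.
  have X0 : X 0%N = x - t *: e by rewrite /X expr0 mulr1.
  (* The chain is stopped once [X k] is so close to [x] that a cube around [x] inside [D] allows a
     direct comparison. The number of steps depends on [x], the bound does not. *)
  have [r0 r00 r0D] := open_cube oD Dx.
  have [k kr] : exists k, t * th ^+ k <= r0 / kp.
    have h : (fun k => t * th ^+ k) @ \oo --> (0 : R).
      rewrite -(mulr0 t); apply: cvgMr; apply: cvg_expr.
      by case/andP: th0 => *; rewrite gtr0_norm.
    have [k _ kP] := cvgr_le 0 h _ (divr_gt0 r00 kp0).
    by exists k; exact: (kP k (leqnn k)).
  have xX : `|x - X k| <= t * th ^+ k.
    have /andP[p1 p2] := tk k.
    by rewrite /X opprB addrC subrK normrZ gtr0_norm// ler_piMr// ltW.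
  have last : `|v x - v (X k)| <= M * t `^ al.
    have /andP[p1 p2] := tk k; have /andP[h0 h1] := th0.
    have : `|v x - v (X k)| <= M * `|x - X k| `^ al.
      apply: vc; first by lra.
      apply: subset_trans r0D; apply: cube_sub; first by rewrite mulr_ge0// ltW.
      rewrite subrr normr0 add0r mulrC -ler_pdivlMr//; exact: le_trans kr.
    move=> /le_trans; apply; rewrite ler_wpM2l// ge0_ler_powR ?(ltW al0) ?nnegrE ?(ltW tp)//.
    by apply: (le_trans xX); rewrite ler_piMr ?(ltW tp)// exprn_ile1// ltW.
  rewrite -X0.
  have -> : v (X 0%N) - v x = (v (X 0%N) - v (X k)) - (v x - v (X k)).
    by rewrite opprB addrC subrKA addrC.
  apply: (le_trans (ler_normB _ _)); apply: (le_trans (lerD (tail k) last)).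
  by rewrite /K1 mulrDr mulr1 mulrDl addrC mulrAC.
pose r := Num.min r1 (t0 * c / (2 * kp)).
have r_gt0 : 0 < r by rewrite lt_min r10/= divr_gt0 ?mulr_gt0.
have rr1 : r <= r1 by rewrite ge_min lexx.
have rt0 : 2 * r * kp / c <= t0.
  rewrite ler_pdivrMr// mulrAC [2 * kp * _]mulrC -ler_pdivlMr ?mulr_gt0//.
  by rewrite ge_min lexx orbT.
have KK0 : 0 <= 2 * K1 * (kp / c) `^ al + M.
  by apply: addr_ge0 => //; apply: mulr_ge0; [exact: mulr_ge0|exact: powR_ge0].
exists r => //; exists (2 * K1 * (kp / c) `^ al + M) => //.
move=> v vc x y Dx Dy xz yz.
have [->|xy] := eqVneq x y.
  by rewrite !subrr normr0; apply: mulr_ge0 => //; exact: powR_ge0.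
have d0 : 0 < `|x - y| by rewrite normr_gt0 subr_eq0.
have dr := ball_dist xz yz.
(* With this [t] the cube of radius [c * t] supplied by the cone is exactly the cube of radius
   [kp * |x - y|] that [class] asks for; the choice of [r] keeps [t] below [t0]. *)
pose t := kp / c * `|x - y|.
have t_gt0 : 0 < t by rewrite mulr_gt0// divr_gt0.
have tt0 : t <= t0.
  apply: le_trans rt0; rewrite /t mulrC -mulrA ler_wpM2r// divr_ge0// ltW//.
have tP : 0 < t <= t0 by rewrite t_gt0.
have dt : `|x - y| <= t.
  by rewrite /t ler_peMl// ler_pdivlMr// mul1r (le_trans c1).
have mid : `|v (x - t *: e) - v (y - t *: e)| <= M * `|x - y| `^ al.
  have E : x - t *: e - (y - t *: e) = x - y by apply/rowP => i; rewrite !mxE; ring.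
  rewrite -[in leRHS]E; apply: vc; rewrite E; first by lra.
  rewrite (_ : kp * `|x - y| = c * t).
    by apply: cone => //; [exact: le_ball xz|rewrite t_gt0 (le_trans tt0)].
  by rewrite /t mulrA mulrCA divff ?mulr1// gt_eqF.
have cx := chain v x t vc Dx (le_ball rr1 xz) tP.
have cy := chain v y t vc Dy (le_ball rr1 yz) tP.
have -> : v x - v y = - (v (x - t *: e) - v x) + (v (x - t *: e) - v (y - t *: e)) +
    (v (y - t *: e) - v y).
  by move: (v _) (v _) (v _) (v _) => *; ring.
apply: (le_trans (ler_normD _ _)); apply: (le_trans (lerD (ler_normD _ _) (lexx _))).
rewrite normrN; apply: (le_trans (lerD (lerD cx mid) cy)).
rewrite /t powRM ?divr_ge0 ?(ltW kp0) ?(ltW c0)//.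
move: (_ `^ al) (_ `^ al) => p s; rewrite le_eqVlt; apply/orP; left; apply/eqP; ring.
Qed.

End GlobalHolder.

(** Each share [c / (a + b)] lies between 0 and 1, so it is at most its own power [al], and the two
    shares add up to 1. This yields the triangle inequality for the power [al] of the distance. *)
Lemma powRD_le {R : realType} (a b al : R) : 0 <= a -> 0 <= b -> 0 < al <= 1 ->
  (a + b) `^ al <= a `^ al + b `^ al.
Proof.
move=> a0 b0 /andP[al0 al1].
have [ab0|ab0] := eqVneq (a + b) 0.
  by rewrite ab0 powR0 ?gt_eqF// addr_ge0 ?powR_ge0.
have ab : 0 < a + b by rewrite lt_def ab0 addr_ge0.
have frac c : 0 <= c -> c <= a + b -> c / (a + b) * (a + b) `^ al <= c `^ al.
  move=> c0 cab; have [->|cn0] := eqVneq c 0; first by rewrite !mul0r powR_ge0.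
  have cp : 0 < c by rewrite lt_def cn0.
  rewrite -[in leRHS](divfK ab0 c) powRM ?divr_ge0 ?(ltW ab)// ler_wpM2r ?powR_ge0//.
  by apply: ger1_powR => //; rewrite divr_gt0//= ler_pdivrMr// mul1r.
have := lerD (frac a a0 _) (frac b b0 _); rewrite lerDl lerDr -mulrDl -mulrDl divff// mul1r.
exact.
Qed.

Section McShane.
Context {R : realType} {n : nat}.

(** An extension to the whole space with the same constant supplies the boundary values at once,
    without limits of [v] at boundary points. *)
Lemma holder_extension (D : set 'rV[R]_n) (v : 'rV[R]_n -> R) (K al : R) :
  0 <= K -> 0 < al <= 1 ->
  (forall x y, D x -> D y -> `|v x - v y| <= K * `|x - y| `^ al) ->
  exists w : 'rV[R]_n -> R, (forall x, D x -> w x = v x) /\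
    forall x y, `|w x - w y| <= K * `|x - y| `^ al.
Proof.
move=> K0 al1 vH; have [[z Dz]|D0] := pselect (exists z, D z); last first.
  exists (cst 0); split=> [x Dx|x y]; first by exfalso; apply: D0; exists x.
  by rewrite /= subrr normr0 mulr_ge0// powR_ge0.
have tri (x y p : 'rV[R]_n) : `|x - p| `^ al <= `|x - y| `^ al + `|y - p| `^ al :> R.
  apply: le_trans (powRD_le (normr_ge0 _) (normr_ge0 _) al1).
  have /andP[a0 _] := al1; rewrite ge0_ler_powR ?nnegrE ?(ltW a0)// ?addr_ge0//.
  exact: ler_distD.
pose S (x : 'rV[R]_n) := [set t | exists2 y, D y & t = v y - K * `|x - y| `^ al].
have Sub x : ubound (S x) (v z + K * `|x - z| `^ al).
  move=> _ [y Dy ->]; rewrite lerBlDr.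
  have h1 : v y - v z <= K * `|y - z| `^ al := le_trans (ler_norm _) (vH _ _ Dy Dz).
  have h2 := ler_wpM2l K0 (tri y x z); rewrite mulrDr [`|y - x|]distrC in h2.
  have h3 := le_trans h1 h2; rewrite lerBlDr in h3.
  by rewrite -addrA addrC [X in _ <= X + _]addrC.
have hS x : has_sup (S x).
  by split; [exists (v z - K * `|x - z| `^ al); exists z|exists (v z + K * `|x - z| `^ al)].
(* McShane's formula. *)
exists (fun x => sup (S x)); split.
  move=> x Dx; apply/eqP; rewrite eq_le; apply/andP; split.
    apply: ge_sup; first by case: (hS x).
    move=> _ [y Dy ->].
    have h1 : v y - v x <= K * `|y - x| `^ al := le_trans (ler_norm _) (vH _ _ Dy Dx).
    by rewrite distrC; move: h1; move: (K * _) => *; lra.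
  apply: (ub_le_sup (hS x).2); exists x => //.
  have /andP[a0 _] := al1.
  by rewrite subrr normr0 powR0 ?gt_eqF// mulr0 subr0.
have half x y : sup (S x) - sup (S y) <= K * `|x - y| `^ al.
  rewrite lerBlDr; apply: ge_sup; first by case: (hS x).
  move=> _ [p Dp ->].
  have h : v p - K * `|y - p| `^ al <= sup (S y).
    by apply: (ub_le_sup (hS y).2); exists p.
  have h2 := ler_wpM2l K0 (tri y x p); rewrite mulrDr [`|y - x|]distrC in h2.
  rewrite lerBlDr in h; rewrite lerBlDr; apply: (le_trans h).
  rewrite -addrA addrCA; exact: (lerD (lexx _) h2).
move=> x y; rewrite ler_norml half andbT lerNl opprB distrC; exact: half.
Qed.

End McShane.

(** * From local to global Hölder bounds *)

Section Globalization.
Context {R : realType} {n : nat}.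
Implicit Types (D : set 'rV[R]_n).

(** Nearby points are covered by the local bounds, so distant points need only a bound on the
    oscillation that is uniform over the class. Connectedness gives it point by point, and
    compactness makes it uniform in the point. *)
Lemma global_holder D (al M kp : R) : open D -> bounded_set D -> connected D ->
  lipschitz_boundary D -> 0 < al -> 0 <= M -> 1 <= kp ->
  exists2 K : R, 0 <= K & forall v, interior_holder_on D al M kp v ->
    forall x y, D x -> D y -> `|v x - v y| <= K * `|x - y| `^ al.
Proof.
move=> oD bD cD lip al0 M0 kp1; pose class := interior_holder_on D al M kp.
have [[z0 Dz0]|D0] := pselect (exists z, D z); last first.
  by exists 0 => // v _ x y Dx; exfalso; apply: D0; exists x.
have loc z : closure D z -> locally_holder D al M kp z.
  move=> cz; have [Dz|nDz] := pselect (D z).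
    exact: interior_locally_holder.
  by apply: boundary_locally_holder => //; split => //; rewrite (interior_id _).1.
(* [S] is open and closed in the connected set [D]. *)
pose S := [set x | D x /\ exists B, forall v, class v -> `|v x - v z0| <= B].
have Sball x r K : 0 <= K -> (forall v, class v -> forall x' y', D x' -> D y' ->
      ball x r x' -> ball x r y' -> `|v x' - v y'| <= K * `|x' - y'| `^ al) ->
    forall y y', D y -> D y' -> ball x r y -> ball x r y' -> S y -> S y'.
  move=> K0 h y y' Dy Dy' xy xy' [_ [B BP]]; split=> //.
  exists (K * `|y' - y| `^ al + B) => v vc.
  have -> : v y' - v z0 = (v y' - v y) + (v y - v z0) by rewrite addrA subrK.
  by apply: (le_trans (ler_normD _ _)); apply: lerD; [exact: h|exact: BP].
have inner x : D x -> exists2 r : R, 0 < r & ball x r `<=` D /\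
    forall y y', ball x r y -> ball x r y' -> S y -> S y'.
  move=> Dx; have [r r0 [K K0 KP]] := loc x (subset_closure Dx).
  have [r' r'0 r'D] := open_cube oD Dx.
  have sr : ball x (Num.min r r') `<=` ball x r by apply: le_ball; rewrite ge_min lexx.
  have sD : ball x (Num.min r r') `<=` D.
    apply: subset_trans r'D; apply: subset_trans (@cube_ball _ _ x r').
    by apply: le_ball; rewrite ge_min lexx orbT.
  exists (Num.min r r'); first by rewrite lt_min r0.
  split=> // y y' xy xy'.
  by apply: (Sball x r K K0 KP); [exact: sD|exact: sD|exact: sr|exact: sr].
have SD : S = D.
  apply: cD.
  - by exists z0; split=> //; exists 0 => v _; rewrite subrr normr0.
  - exists S; last by apply/seteqP; split=> [x [Dx Bx]|x []].
    rewrite openE => x Sx; have [r r0 [rD rS]] := inner x Sx.1.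
    by apply/nbhs_ballP; exists r => //= y xy; apply: (rS x y) => //; exact: ballxx.
  - exists (~` (D `\` S)).
      apply: open_closedC; rewrite openE => x [Dx nSx]; have [r r0 [rD rS]] := inner x Dx.
      apply/nbhs_ballP; exists r => //= y xy; split; first exact: rD.
      by move=> Sy; apply: nSx; apply: (rS y x) => //; exact: ballxx.
    apply/seteqP; split=> [x Sx|x [Dx nDS]]; first by split; [exact: Sx.1|move=> []].
    by apply: contrapT => nSx; exact: nDS.
(* In this form, compactness turns integers valid near each point into one integer valid on the
   whole closure. *)
have nc : near_covering (closure D).
  apply/compact_near_coveringP; have [B0 [_ BP]] := bD.
  have B1 : 0 <= Num.max B0 0 + 1 by rewrite addr_ge0// le_max lexx orbT.
  apply: (subclosed_compact _ (@cube_compact R n 0 (Num.max B0 0 + 1))).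
    exact: closed_closure.
  have /closure_id -> : closed (cube (0 : 'rV[R]_n) (Num.max B0 0 + 1)).
    by apply: compact_closed; [exact: norm_hausdorff|exact: cube_compact].
  apply: closure_subset => x Dx; apply/cubeP => //; rewrite subr0.
  by apply: (BP (Num.max B0 0 + 1)) => //; rewrite ltr_pwDr// le_max lexx.
(* The integer [k] is at once the bound and the Hölder constant and, through [k.+1], the inverse of
   the scale, so that all three become uniform together. *)
pose P (k : nat) x := forall v, class v -> D x ->
  `|v x - v z0| <= k%:R /\
  forall y, D y -> `|x - y| <= k.+1%:R^-1 -> `|v x - v y| <= k%:R * `|x - y| `^ al.
have [k _ /(_ k (leqnn k)) kP] : \forall k \near \oo, closure D `<=` P k.
  apply: nc => z cz; have [r r0 [K K0 KP]] := loc z cz.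
  (* The point [z] may lie on the boundary, where [S] says nothing; a nearby point of [D] replaces
     it. *)
  have [x1 [Dx1 zx1]] : exists x1, D x1 /\ ball z r x1.
    have [x1 [? ?]] := cz (ball z r) (nbhsx_ballx z r r0); by exists x1.
  have [_ [B BP]] : S x1 by rewrite SD.
  (* Large enough for the Hölder constant, for the bound at [x1] plus the step from [x1], and for
     the scale [1/(k+1)] to be at most [r / 2]. *)
  pose X := K + `|B| + K * (2 * r) `^ al + 2 / r.
  have p1 : 0 <= K * (2 * r) `^ al by rewrite mulr_ge0// powR_ge0.
  have p2 : 0 < 2 / r by rewrite divr_gt0.
  have p3 := ler_norm B; have p4 := normr_ge0 B.
  have X0 : 0 <= X by rewrite /X; lra.
  have [k0 Xk0] : exists k0 : nat, X <= k0%:R.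
    by exists (Num.bound X); apply/ltW; exact: archi_boundP.
  exists (ball z (r / 2), [set k | (k0 <= k)%N]).
    split; first by apply: nbhsx_ballx; rewrite divr_gt0.
    by exists k0.
  move=> [x k] /= [zx kk0] v vc Dx.
  have r2 : r / 2 < r by rewrite ltr_pdivrMr// ltr_pMr// ltr1n.
  have zx' : ball z r x by apply: le_ball zx; exact: ltW.
  have Xk : X <= k%:R by apply: (le_trans Xk0); rewrite ler_nat.
  have KXk : K <= k%:R by apply: le_trans Xk; rewrite /X; lra.
  have al0' : 0 <= al := ltW al0.
  split.
    have -> : v x - v z0 = (v x - v x1) + (v x1 - v z0) by rewrite addrA subrK.
    apply: (le_trans (ler_normD _ _)); have h1 := BP v vc.
    have h2 := KP v vc x x1 Dx Dx1 zx' zx1.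
    have h3 : K * `|x - x1| `^ al <= K * (2 * r) `^ al.
      rewrite ler_wpM2l// ge0_ler_powR ?nnegrE//; first by rewrite mulr_ge0// ltW.
      exact: (ball_dist zx' zx1).
    apply: (le_trans (lerD (le_trans h2 h3) h1)); apply: le_trans Xk; rewrite /X; lra.
  move=> y Dy xy; apply: le_trans (KP v vc x y Dx Dy zx' _) _; last first.
    by rewrite ler_wpM2r// powR_ge0.
  have kr : k.+1%:R^-1 <= r / 2.
    rewrite -[leRHS]invrK lef_pV2 ?posrE ?invr_gt0 ?divr_gt0// invf_div.
    apply: (@le_trans _ _ k%:R); last by rewrite ler_nat.
    by apply: le_trans Xk; rewrite /X; lra.
  move: zx; rewrite -ball_normE/= => zx.
  have -> : z - y = (z - x) + (x - y) by rewrite addrA subrK.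
  by apply: (le_lt_trans (ler_normD _ _)); rewrite [r]splitr; apply: ltr_leD => //; exact: le_trans kr.
exists (k%:R + 2 * k%:R * k.+1%:R `^ al).
  by rewrite addr_ge0// mulr_ge0// ?powR_ge0// mulr_ge0.
move=> v vc x y Dx Dy; have cDx := subset_closure Dx; have cDy := subset_closure Dy.
have [vx vxy] := kP x cDx v vc Dx; have [vy _] := kP y cDy v vc Dy.
have [xy|xy] := leP `|x - y| k.+1%:R^-1.
  by apply: (le_trans (vxy y Dy xy)); rewrite ler_wpM2r ?powR_ge0// lerDl mulr_ge0// ?powR_ge0// mulr_ge0.
(* Distant points: the oscillation bound suffices, because [(k + 1) |x - y|] is at least 1. *)
apply: (@le_trans _ _ (2 * k%:R)).
  have -> : v x - v y = (v x - v z0) - (v y - v z0) by rewrite opprB addrA subrK.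
  by apply: (le_trans (ler_normB _ _)); rewrite mulr_natl mulr2n lerD.
have h : 1 <= k.+1%:R `^ al * `|x - y| `^ al.
  have : 1 `^ al <= (k.+1%:R * `|x - y|) `^ al.
    rewrite ge0_ler_powR ?nnegrE ?ler01 ?mulr_ge0 ?(ltW al0)//.
    by rewrite mulrC -ler_pdivrMr// div1r ltW.
  by rewrite powR1 powRM.
apply: (@le_trans _ _ (2 * k%:R * k.+1%:R `^ al * `|x - y| `^ al)).
  by rewrite -[X in _ <= X]mulrA ler_peMr// mulr_ge0.
by rewrite [leRHS]mulrDl lerDr mulr_ge0// powR_ge0.
Qed.

End Globalization.

(** * Decay of the gradient *)

Section Bump.
Context {R : realType}.
Implicit Types r z t : R.

(** Sends [z - 2 r] to 0 and [z - r] to 2, the two ends of the transition of [sstep]; [bump_arg'] is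
    its mirror image about [z]. *)
Definition bump_arg r z t := 2 / r * t + (4 - 2 / r * z).
Definition bump_arg' r z t := - (2 / r) * t + (4 + 2 / r * z).

Definition bump r z t := sstep (bump_arg r z t) * sstep (bump_arg' r z t).
Definition dbump r z t := sstep (bump_arg r z t) * (- (2 / r) * dsstep (bump_arg' r z t)) +
  sstep (bump_arg' r z t) * (2 / r * dsstep (bump_arg r z t)).

Lemma is_derive_bump r z t : is_derive t 1 (bump r z) (dbump r z t).
Proof.
have h1 := is_derive_affine (2 / r) (4 - 2 / r * z) t (@is_derive_sstep R).
have h2 := is_derive_affine (- (2 / r)) (4 + 2 / r * z) t (@is_derive_sstep R).
exact: is_deriveM.
Qed.

Lemma continuous_dbump r z : continuous (dbump r z).
Proof.
have aff c d : continuous (fun t : R => c * t + d).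
  move=> t; apply: (@continuousD _ _ _ (fun t => c * t)); last exact: cst_continuous.
  exact: mulrl_continuous.
have comp (f : R -> R) c d : continuous f -> continuous (fun t => f (c * t + d)).
  by move=> cf t; apply: (@continuous_comp _ _ _ (fun t => c * t + d) f); [exact: aff|exact: cf].
have c1 := comp _ (2 / r) (4 - 2 / r * z) (@continuous_sstep R).
have c2 := comp _ (- (2 / r)) (4 + 2 / r * z) (@continuous_sstep R).
have d1 := comp _ (2 / r) (4 - 2 / r * z) (@continuous_dsstep R).
have d2 := comp _ (- (2 / r)) (4 + 2 / r * z) (@continuous_dsstep R).
move=> t; apply: cvgD; apply: cvgM; [exact: c1| |exact: c2|].
  by apply: cvgMr; exact: d2.
by apply: cvgMr; exact: d1.
Qed.

Lemma bump_bound r z t : 0 <= bump r z t <= 1.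
Proof.
have /andP[a0 a1] := sstep_bound (bump_arg r z t).
have /andP[b0 b1] := sstep_bound (bump_arg' r z t).
by rewrite mulr_ge0//= mulr_ile1.
Qed.

Lemma dbump_bound r z t : 0 < r -> `|dbump r z t| <= 4 / r.
Proof.
move=> r0; have r2 : 0 <= 2 / r by rewrite divr_ge0// ltW.
have /andP[a0 a1] := sstep_bound (bump_arg r z t).
have /andP[b0 b1] := sstep_bound (bump_arg' r z t).
rewrite (_ : 4 / r = 2 / r + 2 / r); last by rewrite -mulrDl -natrD.
have e (A c d : R) : 0 <= A -> A <= 1 -> `|c| = 2 / r -> `|A * (c * dsstep d)| <= 2 / r.
  move=> A0 A1 cr; rewrite !normrM (ger0_norm A0) cr mulrCA ler_piMr//.
  by rewrite mulr_ile1// dsstep_bound.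
apply: (le_trans (ler_normD _ _)); apply: lerD; apply: e => //; rewrite ?normrN ger0_norm//.
Qed.

Lemma bump_eq1 r z t : 0 < r -> z - r <= t <= z + r -> bump r z t = 1.
Proof.
move=> r0 /andP[t1 t2]; have r2 : 0 < 2 / r by rewrite divr_gt0.
rewrite /bump !sstep_ge2 ?mulr1//.
  rewrite /bump_arg' [leRHS](_ : _ = 2 + 2 / r * (z + r - t)); last by field; rewrite gt_eqF.
  by rewrite lerDl mulr_ge0 ?subr_ge0// ltW.
rewrite /bump_arg [leRHS](_ : _ = 2 + 2 / r * (t - (z - r))); last by field; rewrite gt_eqF.
by rewrite lerDl mulr_ge0 ?subr_ge0// ltW.
Qed.

Lemma bump_eq0 r z t : 0 < r -> ~ (z - 2 * r <= t <= z + 2 * r) -> bump r z t = 0.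
Proof.
move=> r0 /negP; rewrite negb_and -!ltNge; have r2 : 0 < 2 / r by rewrite divr_gt0.
move=> /orP[h|h]; rewrite /bump.
  rewrite sstep_le0 ?mul0r// /bump_arg [leLHS](_ : _ = 2 / r * (t - (z - 2 * r))).
    by rewrite pmulr_rle0// subr_le0 ltW.
  by field; rewrite gt_eqF.
rewrite mulrC sstep_le0 ?mul0r// /bump_arg' [leLHS](_ : _ = 2 / r * (z + 2 * r - t)).
  by rewrite pmulr_rle0// subr_le0 ltW.
by field; rewrite gt_eqF.
Qed.

End Bump.

Section Cutoff.
Context {R : realType} {n : nat}.
Implicit Types (z x : 'rV[R]_n) (r : R) (m : nat).

Definition cutoff_base r z : 'rV[R]_n -> R := tprod (fun j => bump r (z 0 j)).

(** The power sits on each factor, so the cutoff remains a product of one-variable functions.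
    Differentiation costs one power and a factor of order [1/r]: what remains is the power [m] of
    the base, which the Young-type inequality below can absorb. *)
Definition cutoff m r z : 'rV[R]_n -> R := tprod (fun j t => bump r (z 0 j) t ^+ m.+1).

Lemma cutoffE m r z x : cutoff m r z x = cutoff_base r z x ^+ m.+1.
Proof. by rewrite /cutoff /tprod prodrXl. Qed.

Lemma cutoff_base_bound r z x : 0 <= cutoff_base r z x <= 1.
Proof.
apply/andP; split; first by apply: prodr_ge0 => j _; case/andP: (bump_bound r (z 0 j) (x 0 j)).
by apply: prodr_ile1 => j _; exact: bump_bound.
Qed.

Let dcut m r z (j : 'I_n) t := m.+1%:R * bump r (z 0 j) t ^+ m * dbump r (z 0 j) t.

Let is_derive_cut m r z (j : 'I_n) (t : R) :
  is_derive t 1 (fun t => bump r (z 0 j) t ^+ m.+1) (dcut m r z j t).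
Proof.
have h := is_derive_bump r (z 0 j) t.
have := @is_deriveX _ _ (bump r (z 0 j)) m.+1 t 1 (dbump r (z 0 j) t) h.
by rewrite exprfctE.
Qed.

Let continuous_dcut m r z (j : 'I_n) : continuous (dcut m r z j).
Proof.
have cb : continuous (bump r (z 0 j)).
  move=> t; apply: differentiable_continuous; apply/derivable1_diffP.
  exact: (@ex_derive _ _ _ _ _ _ _ (is_derive_bump r (z 0 j) t)).
move=> t; apply: cvgM; last exact: continuous_dbump.
apply: cvgMr; apply: (@continuous_comp _ _ _ (bump r (z 0 j)) (fun s => s ^+ m)); first exact: cb.
exact: exprn_continuous.
Qed.

Let cut_out m r z : 0 < r -> forall (j : 'I_n) t,
  ~ ((z - const_mx (2 * r)) 0 j <= t <= (z + const_mx (2 * r)) 0 j) ->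
  bump r (z 0 j) t ^+ m.+1 = 0.
Proof. by move=> r0 j t; rewrite !mxE => h; rewrite bump_eq0// expr0n. Qed.

Let cbox2 r z : set 'rV[R]_n := rV_cbox (z - const_mx (2 * r)) (z + const_mx (2 * r)).

Lemma cutoff_C1c D m r z : 0 < r -> cbox2 r z `<=` D -> C1c D (cutoff m r z).
Proof.
move=> r0 PD.
apply: (@C1c_tprod R n D _ (dcut m r z) (z - const_mx (2 * r)) (z + const_mx (2 * r))).
- by move=> j t; exact: is_derive_cut.
- by move=> j; exact: continuous_dcut.
- by move=> j t; exact: cut_out.
- exact: PD.
Qed.

Lemma partial_cutoff_bound m r z i x : 0 < r ->
  `|partial i (cutoff m r z) x| <= m.+1%:R * (4 / r) * cutoff_base r z x ^+ m.
Proof.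
move=> r0; rewrite (partial_tprod i x (@is_derive_cut m r z)) (bigD1 i)//= eqxx.
rewrite /cutoff_base /tprod -prodrXl [X in _ <= _ * X](bigD1 i)//=.
rewrite normrM /dcut !normrM normr_nat.
have b0 j : 0 <= bump r (z 0 j) (x 0 j) <= 1 := bump_bound _ _ _.
have bm0 j k : 0 <= bump r (z 0 j) (x 0 j) ^+ k by rewrite exprn_ge0//; case/andP: (b0 j).
rewrite (ger0_norm (bm0 i m)) normr_prod.
have arith (N X Y Y' P P' : R) : 0 <= N -> 0 <= X -> 0 <= Y -> Y <= Y' -> 0 <= P -> P <= P' ->
    N * X * Y * P <= N * Y' * (X * P').
  move=> N0 X0 Y0 YY P0 PP; rewrite (_ : N * Y' * (X * P') = N * X * Y' * P'); last by ring.
  by apply: ler_pM => //; rewrite ?mulr_ge0// ler_wpM2l// mulr_ge0.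
apply: arith => //; [exact: dbump_bound|by apply: prodr_ge0|].
apply: ler_prod => j /negbTE ji; rewrite ji normr_ge0/=.
have /andP[c0 c1] := b0 j; rewrite (ger0_norm (bm0 j m.+1)) exprS ler_piMl//; exact: bm0.
Qed.

Lemma partial_cutoff_out m r z i x : 0 < r -> ~ cbox2 r z x -> partial i (cutoff m r z) x = 0.
Proof.
move=> r0 xP; rewrite (partial_tprod i x (@is_derive_cut m r z)).
rewrite [LHS](tprod_outside (h := fun j => if j == i then dcut m r z j else
   (fun t => bump r (z 0 j) t ^+ m.+1)) _ xP)//.
move=> j t h; case: ifP => _; last exact: (@cut_out m r z r0 j t h).
exact: (derive_outside (@is_derive_cut m r z j) (@cut_out m r z r0 j) h).
Qed.

Lemma cutoff_out m r z x : 0 < r -> ~ cbox2 r z x -> cutoff m r z x = 0.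
Proof. by move=> r0; exact: (tprod_outside (@cut_out m r z r0)). Qed.

Lemma cutoff_eq1 m r z x : 0 < r -> (forall j, z 0 j - r <= x 0 j <= z 0 j + r) ->
  cutoff m r z x = 1.
Proof.
by move=> r0 h; rewrite cutoffE /cutoff_base /tprod big1 ?expr1n// => j _; exact: bump_eq1.
Qed.

Lemma cutoff_bound m r z x : 0 <= cutoff m r z x <= 1.
Proof.
have /andP[h0 h1] := cutoff_base_bound r z x.
by rewrite cutoffE exprn_ge0//= exprn_ile1.
Qed.

End Cutoff.

Section PointwiseYoung.
Context {R : realType}.

(* If [b <= c a^(g-p+1) H] the first term on the right dominates, and otherwise
   [a^(g-p+1) H < b / c] lets the second one dominate. *)
Lemma absorb_gradient (a H b c p g : R) (m : nat) : 0 <= a -> 0 <= H <= 1 -> 0 <= b ->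
  0 < c -> 1 < p -> p < g -> (p - 1) / (g - (p - 1)) <= m%:R ->
  b * a `^ (p - 1) * H ^+ m <= c * a `^ g * H ^+ m.+1 +
    c^-1 `^ ((p - 1) / (g - (p - 1))) * b `^ (1 + (p - 1) / (g - (p - 1))).
Proof.
move=> a0 /andP[H0 H1] b0 c0 p1 pg; set d := g - (p - 1); set s := (p - 1) / d => sm.
have d0 : 0 < d by rewrite /d; lra.
have p0 : 0 < p - 1 by lra.
have s0 : 0 < s by rewrite divr_gt0.
have R0 : 0 <= c^-1 `^ s * b `^ (1 + s) by rewrite mulr_ge0// powR_ge0.
have L0 : 0 <= c * a `^ g * H ^+ m.+1 by rewrite !mulr_ge0 ?powR_ge0 ?exprn_ge0// ltW.
have m0 : (0 < m)%N by rewrite -(ltr_nat R); exact: lt_le_trans sm.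
have [bd|bd] := leP b (c * a `^ d * H).
  apply: (@le_trans _ _ (c * a `^ g * H ^+ m.+1)); last by rewrite lerDl.
  have -> : a `^ g = a `^ d * a `^ (p - 1).
    rewrite -powRD; first by rewrite /d subrK.
    by rewrite /d subrK gt_eqF// (lt_trans _ pg)// (lt_trans _ p1).
  rewrite exprS (_ : c * (a `^ d * a `^ (p - 1)) * (H * H ^+ m) =
     (c * a `^ d * H) * a `^ (p - 1) * H ^+ m); last by ring.
  by rewrite ler_wpM2r ?exprn_ge0// ler_wpM2r// powR_ge0.
apply: (@le_trans _ _ (c^-1 `^ s * b `^ (1 + s))); last by rewrite lerDr.
have bp : 0 < b by apply: le_lt_trans bd; rewrite !mulr_ge0 ?powR_ge0// ltW.
have -> : a `^ (p - 1) = (a `^ d) `^ s.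
  by rewrite -powRrM /s mulrCA divff ?mulr1// gt_eqF.
(* This is where the exponent of the cutoff is used: [H <= 1] and [m >= s]. *)
have Hs : H ^+ m <= H `^ s.
  have [->|Hn0] := eqVneq H 0; first by rewrite expr0n (gtn_eqF m0) powR0// gt_eqF.
  by rewrite -powR_mulrn// ger_powR// H1 andbT lt_def Hn0.
apply: (@le_trans _ _ (b * ((a `^ d) `^ s * H `^ s))).
  by rewrite mulrA ler_wpM2l// mulr_ge0// powR_ge0.
rewrite -powRM ?powR_ge0// [b `^ (1 + s)]powRD; last by rewrite gt_eqF// addr_gt0.
rewrite powRr1// mulrCA -powRM ?invr_ge0 ?(ltW c0)// ler_wpM2l//.
rewrite ge0_ler_powR ?nnegrE ?(ltW s0) ?mulr_ge0 ?powR_ge0 ?invr_ge0 ?(ltW c0)//.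
by rewrite ler_pdivlMl// mulrA ltW.
Qed.

(** When [a > s] the power [g - 1] of [s] is at most that of [a]; otherwise the left side is
    nonpositive. It does the work of Hölder's inequality, with a threshold [s] that can be adapted
    to the scale. *)
Lemma linear_le_powR (a s g : R) : 0 <= a -> 0 < s -> 1 <= g ->
  s `^ (g - 1) * (a - s) <= a `^ g.
Proof.
move=> a0 s0 g1; have [as_|sa] := leP a s.
  by apply: (@le_trans _ _ 0); rewrite ?powR_ge0// mulr_ge0_le0 ?powR_ge0// subr_le0.
have a1 : 0 < a := lt_trans s0 sa.
apply: (@le_trans _ _ (a `^ (g - 1) * a)).
  apply: ler_pM; rewrite ?powR_ge0 ?subr_ge0 ?(ltW sa)//.
    by rewrite ge0_ler_powR ?subr_ge0 ?nnegrE// ltW.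
  by rewrite gerBl ltW.
rewrite -{2}(powRr1 a0) -powRD ?subrK//.
by rewrite (gt_eqF a1) implybT.
Qed.

End PointwiseYoung.

(** Both terms of alpha originate here. After division by the power [g - 1] of [r^(al-1)], the data
    term [r^(n-n/q)] and the cutoff term [r^(n-1-s)] are at most a constant times [r^(n-1+al)] when
    [(1 - al) g] is at least [n/q] and at least [1 + s = g/(g-p+1)]; these are the two upper bounds
    on [al]. The threshold term has exactly the order [r^(n-1+al)]. *)
Lemma decay_arith {R : realType} (n : nat) (X M k c cY b0 s p g q al r : R) :
  0 < r <= 1 -> 0 < c -> 0 < k -> 0 <= M -> 0 <= cY -> 0 <= b0 -> 1 < p -> p < g -> 0 < q ->
  s = (p - 1) / (g - (p - 1)) ->
  al <= 1 - n%:R / (q * g) -> al <= (g - p) / (g - (p - 1)) ->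
  c * (r `^ (al - 1)) `^ (g - 1) * X <= M * (k * r) `^ (n%:R - n%:R / q) +
    (cY * (b0 / r) `^ (1 + s) + c * (r `^ (al - 1)) `^ (g - 1) * r `^ (al - 1)) * (4 * r) ^+ n ->
  X <= (c^-1 * (M * k `^ (n%:R - n%:R / q) + cY * b0 `^ (1 + s) * 4 ^+ n) + 4 ^+ n) *
    r `^ (n%:R - 1 + al).
Proof.
move=> /andP[r0 r1] c0 k0 M0 cY0 b00 p1 pg q0 sE al1 al2 h.
have rr : 0 < r <= 1 by rewrite r0.
have rn0 : r != 0 by rewrite gt_eqF.
have g0 : 0 < g by lra.
have d0 : 0 < g - (p - 1) by lra.
pose sg := (r `^ (al - 1)) `^ (g - 1).
have sg0 : 0 < sg by rewrite !powR_gt0.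
have rD x y : r `^ (x + y) = r `^ x * r `^ y by rewrite powRD// rn0 implybT.
have rn : r ^+ n = r `^ n%:R by rewrite powR_mulrn// ltW.
have sgE : sg * r `^ (n%:R - 1 + al) = r `^ (n%:R + (al - 1) * g).
  by rewrite /sg -powRrM -rD; congr (_ `^ _); ring.
have mono x y : y <= x -> r `^ x <= r `^ y by exact: ger_powR.
have e1 : r `^ (n%:R - n%:R / q) <= sg * r `^ (n%:R - 1 + al).
  rewrite sgE; apply: mono; rewrite lerD2l.
  have := ler_wpM2r (ltW g0) al1; rewrite mulrBl mul1r (_ : n%:R / (q * g) * g = n%:R / q).
    by rewrite mulrBl mul1r; lra.
  by field; rewrite !gt_eqF.
have e2 : r `^ (- (1 + s)) * r ^+ n <= sg * r `^ (n%:R - 1 + al).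
  rewrite sgE rn -rD; apply: mono; rewrite [leRHS]addrC lerD2l.
  have := ler_wpM2r (ltW g0) al2.
  have -> : (g - p) / (g - (p - 1)) * g = g - (1 + s).
    by rewrite sE; field; rewrite gt_eqF.
  by lra.
have e3 : r `^ (al - 1) * r ^+ n = r `^ (n%:R - 1 + al).
  by rewrite rn -rD; congr (_ `^ _); ring.
rewrite -(ler_pM2l (mulr_gt0 c0 sg0)); apply: (le_trans h).
have -> : (b0 / r) `^ (1 + s) = b0 `^ (1 + s) * r `^ (- (1 + s)).
  by rewrite powRM ?invr_ge0 ?(ltW r0)// -powR_inv1 ?(ltW r0)// -powRrM mulN1r.
rewrite powRM ?(ltW k0) ?(ltW r0)// exprMn -/sg.
have f1 : M * (k `^ (n%:R - n%:R / q) * r `^ (n%:R - n%:R / q)) <=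
    M * k `^ (n%:R - n%:R / q) * (sg * r `^ (n%:R - 1 + al)).
  by rewrite mulrA ler_wpM2l// mulr_ge0// powR_ge0.
have f2 : cY * (b0 `^ (1 + s) * r `^ (- (1 + s))) * (4 ^+ n * r ^+ n) <=
    cY * b0 `^ (1 + s) * 4 ^+ n * (sg * r `^ (n%:R - 1 + al)).
  rewrite (_ : cY * (b0 `^ (1 + s) * r `^ (- (1 + s))) * (4 ^+ n * r ^+ n) =
    cY * b0 `^ (1 + s) * 4 ^+ n * (r `^ (- (1 + s)) * r ^+ n)); last by ring.
  by rewrite ler_wpM2l// !mulr_ge0 ?powR_ge0 ?exprn_ge0.
rewrite mulrDl (_ : c * sg * r `^ (al - 1) * (4 ^+ n * r ^+ n) =
    c * sg * 4 ^+ n * (r `^ (al - 1) * r ^+ n)); last by ring.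
rewrite e3 [leRHS](_ : _ = M * k `^ (n%:R - n%:R / q) * (sg * r `^ (n%:R - 1 + al)) +
   (cY * b0 `^ (1 + s) * 4 ^+ n * (sg * r `^ (n%:R - 1 + al)) + c * sg * 4 ^+ n * r `^ (n%:R - 1 + al))).
  by apply: lerD => //; rewrite lerD2r.
by field; rewrite gt_eqF.
Qed.

(** * Integrability on cubes, and cubes against Euclidean balls *)

Section Integrability.
Context {R : realType} {n : nat}.
Notation mu := (@leb R n).
Notation T := (leb_type R n).

(** On a set of finite measure, the constant 1 plus the power [s] of [|h|] dominates [|h|]. *)
Lemma Lp_on_integrable (K : set 'rV[R]_n) (s : R) (h : 'rV[R]_n -> R) : 1 <= s ->
  measurable (K : set T) -> (mu K < +oo)%E -> Lp_on K s h -> mu.-integrable K (EFin \o h).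
Proof.
move=> s1 mK Koo hK.
have ih := Lfun_integrable s1 hK.
have mh : measurable_fun setT (h \_ K : T -> R).
  by move/sub_Lfun_mfun: hK; rewrite inE.
apply/(integrable_mkcond _ mK).2; rewrite restrict_EFin.
have i1 : mu.-integrable setT (EFin \o (\1_K : T -> R)).
  have h1 : mu.-integrable K (EFin \o cst (1 : R)).
    by apply: measurable_bounded_integrable => //; exact: bounded_cst.
  have := (integrable_mkcond _ mK).1 h1; apply: eq_integrable => // x _.
  by rewrite /= patchE indicE; case: ifP.
pose G x := (\1_K : T -> R) x + `|(h \_ K) x| `^ s.
have iG : mu.-integrable setT (EFin \o G).
  by have := integrableD measurableT i1 ih; apply: eq_integrable.
have mEh : measurable_fun setT (EFin \o (h \_ K) : T -> \bar R) by exact/measurable_EFinP.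
apply: (@le_integrable _ _ _ mu setT measurableT _ _ mEh _ iG) => x _.
rewrite /= lee_fin [leRHS]ger0_norm ?addr_ge0 ?powR_ge0// /G indicE patchE.
case: ifP => [_|_]; last by rewrite normr0 add0r powR_ge0.
have [hx|hx] := leP `|h x| 1; first by rewrite (le_trans hx)// lerDl powR_ge0.
by rewrite (le_trans (le1r_powR (ltW hx) s1))// lerDr.
Qed.

Lemma ae_Rintegral_ge0 (K : set T) (F : T -> R) : measurable K -> mu.-integrable K (EFin \o F) ->
  {ae mu, forall x, K x -> 0 <= F x} -> 0 <= \int[mu]_(x in K) F x.
Proof.
move=> mK iF F0; rewrite /Rintegral fine_ge0//.
have mF := measurable_int _ iF.
rewrite (@ae_eq_integral _ _ _ mu K ((EFin \o F)^\+)%E)//.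
- by apply: integral_ge0 => x _; exact: funepos_ge0.
- exact: measurable_funepos.
- by apply: filterS F0 => x h Kx; rewrite funepos.unlock /= max_l// lee_fin h.
Qed.

Lemma cube_measure z (r : R) : 0 <= r -> mu (cube z r : set T) = ((2 * r) ^+ n)%:E.
Proof.
move=> r0; rewrite leb_cbox; last by move=> i; rewrite !mxE; lra.
congr EFin; rewrite (eq_bigr (fun=> 2 * r)); last by move=> i _; rewrite !mxE; ring.
by rewrite prodr_const card_ord.
Qed.

Lemma cube_measurable z (r : R) : measurable (cube z r : set T).
Proof. exact: cbox_measurable. Qed.

(** The Morrey condition speaks of Euclidean balls. The factor [2 n] comes from bounding the
    Euclidean norm by the sum of the coordinates, and the added 1 from the ball being open. *)
Lemma cube_sub_eball (z : 'rV[R]_n) (r : R) : 0 < r -> cube z (2 * r) `<=` eball z ((2 * n%:R + 1) * r).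
Proof.
move=> r0 x xz; rewrite /eball/=; apply: (le_lt_trans (enorm_le_sum _)).
have r2 : 0 <= 2 * r by rewrite mulr_ge0// ltW.
apply: (@le_lt_trans _ _ (\sum_(i < n) (2 * r))).
  apply: ler_sum => i _; have /(cubeP _ _ r2) := xz; exact: le_trans (coord_le_norm _ _).
rewrite sumr_const card_ord (_ : 2 * r *+ n = 2 * n%:R * r); last by rewrite -[2 * r *+ n]mulr_natl; ring.
by rewrite [ltRHS]mulrDl mul1r ltrDl.
Qed.

Lemma enorm_ge0 (x : 'rV[R]_n) : 0 <= enorm x.
Proof. exact: sqrtr_ge0. Qed.

Lemma le_ediam (D : set 'rV[R]_n) x y : bounded_set D -> D x -> D y -> enorm (x - y) <= ediam D.
Proof.
move=> [B [_ BP]] Dx Dy; apply: ub_le_sup; last by exists x, y.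
exists (\sum_(i < n) (2 * (B + 1))) => _ [a [b [Da Db ->]]].
apply: (le_trans (enorm_le_sum _)); apply: ler_sum => i _; rewrite !mxE.
apply: (le_trans (ler_normB _ _)); rewrite mulr_natl mulr2n.
by apply: lerD; apply: (le_trans (coord_le_norm _ i)); apply: BP => //; rewrite ltrDl.
Qed.

(** The Morrey condition is available only up to the diameter. The centre and its translate by [r]
    along one axis, both in [D], show that [r] is admissible. *)
Lemma cube_ediam (D : set 'rV[R]_n) (z : 'rV[R]_n) (r : R) : (0 < n)%N -> 0 < r -> bounded_set D ->
  cube z r `<=` D -> r <= ediam D.
Proof.
move=> n0 r0 bD zD; pose i0 := Ordinal n0.
pose y : 'rV[R]_n := z + r *: delta_mx 0 i0.
have Dz : D z by apply: zD; apply/cubeP; rewrite ?subrr ?normr0 ltW.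
have Dy : D y.
  apply: zD; apply/cubeP; first exact: ltW.
  rewrite /y addrC addKr; apply/rV_normP; first exact: ltW.
  move=> i; rewrite !mxE eqxx/=; case: eqP => _; rewrite ?mulr1 ?mulr0 ?normr0 ?(ltW r0)//.
  by rewrite gtr0_norm.
apply: le_trans (le_ediam bD Dy Dz); rewrite /y addrC addKr.
apply: le_trans (coord_le_enorm _ i0); rewrite !mxE !eqxx mulr1; exact: ler_norm.
Qed.

End Integrability.

Section Pointwise.
Context {R : realType} {n : nat}.

(** Here [a] is [|Du|], [d] is [|D_i u|], [s] is the value of [u] and [F] that of [f]. Of the
    coefficient [2 c], one half absorbs the flux term and the other pays for the bound by a linear
    expression in [a] with threshold [t]. *)
Lemma pointwise_caccioppoli (a d Bv s lam F p g nu c H b0 r t : R) (m : nat)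
    (Av dphi : 'rV[R]_n) :
  0 <= H <= 1 -> 0 <= d <= a -> 0 < r -> 0 < t -> 0 < nu -> 0 < c -> 0 <= lam ->
  1 < p -> p < g ->
  (p - 1) / (g - (p - 1)) <= m%:R ->
  b0 = n%:R * nu * m.+1%:R * 4 ->
  enorm Av <= nu * a `^ (p - 1) ->
  2 * c * a `^ g - lam * s - F <= Bv ->
  (forall i, `|dphi 0 i| <= m.+1%:R * (4 / r) * H ^+ m) ->
  0 <= Bv * H ^+ m.+1 - dotp Av dphi - c * t `^ (g - 1) * (d * H ^+ m.+1) +
    `|F + lam * Num.max s 0| +
    (c^-1 `^ ((p - 1) / (g - (p - 1))) * (b0 / r) `^ (1 + (p - 1) / (g - (p - 1))) +
     c * t `^ (g - 1) * t).
Proof.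
move=> H01 /andP[d0 da] r0 t0 nu0 c0 lam0 p1 pg sm b0E hA hB hphi.
have a0 : 0 <= a := le_trans d0 da.
have [H0 H1] := andP H01.
set Y := _ `^ _ * _ `^ _; set sg := t `^ (g - 1); set P := H ^+ m.+1.
have b00 : 0 <= b0 / r by rewrite b0E divr_ge0 ?(ltW r0)// !mulr_ge0// ltW.
have young : b0 / r * a `^ (p - 1) * H ^+ m <= c * a `^ g * P + Y by exact: absorb_gradient.
have lin : sg * (a - t) <= a `^ g by apply: linear_le_powR => //; lra.
have sg0 : 0 <= sg by exact: powR_ge0.
have P0 : 0 <= P by exact: exprn_ge0.
have P1 : P <= 1 by exact: exprn_ile1.
have dA : dotp Av dphi <= b0 / r * a `^ (p - 1) * H ^+ m.
  apply: (@le_trans _ _ (\sum_(i < n) nu * a `^ (p - 1) * (m.+1%:R * (4 / r) * H ^+ m))).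
    apply: ler_sum => i _; apply: (le_trans (ler_norm _)); rewrite normrM.
    by apply: ler_pM => //; exact: le_trans (coord_le_enorm _ _) hA.
  rewrite sumr_const card_ord -[_ *+ n]mulr_natl b0E.
  by rewrite le_eqVlt; apply/orP; left; apply/eqP; field; rewrite gt_eqF.
have hBP : (2 * c * a `^ g - lam * s - F) * P <= Bv * P by exact: ler_wpM2r.
have hs : lam * s <= lam * Num.max s 0 by rewrite ler_wpM2l// le_max lexx.
have hG : (lam * s + F) * P <= `|F + lam * Num.max s 0|.
  apply: (@le_trans _ _ (`|F + lam * Num.max s 0| * P)); last by rewrite ler_piMr.
  by apply: ler_wpM2r => //; apply: le_trans (ler_norm _); rewrite addrC lerD2l.
have hlin : c * (sg * (a - t)) * P <= c * a `^ g * P by rewrite ler_wpM2r// ler_wpM2l// ltW.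
have csg : 0 <= c * sg by rewrite mulr_ge0// ltW.
have h1 : c * sg * (d * P) <= c * sg * (a * P) by rewrite ler_wpM2l// ler_wpM2r.
have h2 : c * sg * t * P <= c * sg * t by rewrite ler_piMr// mulr_ge0// ltW.
move: dA hBP hG hlin h1 h2 young.
move: (dotp _ _) `|_| (b0 / r * _ * _) (a `^ g) => x1 x2 x3 x4.
clearbody Y sg P; clear; nra.
Qed.

End Pointwise.

Section Decay.
Context {R : realType} {n : nat}.
Notation mu := (@leb R n).
Notation T := (leb_type R n).

(** Once the pointwise bound is integrated, [F0 - F1] has a nonpositive total by the weak inequality
    and drops out. *)
Lemma tested_inequality (P : set T) (F0 F1 w G : T -> R) (c k : R) : measurable P ->
  (mu P < +oo)%E ->
  mu.-integrable P (EFin \o F0) -> mu.-integrable P (EFin \o F1) ->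
  mu.-integrable P (EFin \o w) -> mu.-integrable P (EFin \o G) ->
  (\int[mu]_(x in P) (F0 x)%:E <= \int[mu]_(x in P) (F1 x)%:E)%E ->
  {ae mu, forall x, P x -> 0 <= F0 x - F1 x - c * w x + G x + k} ->
  c * \int[mu]_(x in P) w x <= \int[mu]_(x in P) G x + k * fine (mu P).
Proof.
move=> mP Poo i0 i1 iw iG h01 hae.
have icw := integrable_mulrl c mP iw.
have ik : mu.-integrable P (EFin \o (fun=> k)).
  by apply: measurable_bounded_integrable => //; exact: bounded_cst.
have i01 : mu.-integrable P (EFin \o (fun x => F0 x - F1 x)).
  by have := integrableB mP i0 i1; apply: eq_integrable.
have i01w : mu.-integrable P (EFin \o (fun x => F0 x - F1 x - c * w x)).
  by have := integrableB mP i01 icw; apply: eq_integrable.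
have i01wG : mu.-integrable P (EFin \o (fun x => F0 x - F1 x - c * w x + G x)).
  by have := integrableD mP i01w iG; apply: eq_integrable.
have iall : mu.-integrable P (EFin \o (fun x => F0 x - F1 x - c * w x + G x + k)).
  by have := integrableD mP i01wG ik; apply: eq_integrable.
have := ae_Rintegral_ge0 mP iall hae.
rewrite (RintegralD mP i01wG ik) (RintegralD mP i01w iG) (RintegralB mP i01 icw).
rewrite (RintegralB mP i0 i1) (RintegralZl _ mP iw) (Rintegral_cst mu mP k).
have : \int[mu]_(x in P) F0 x <= \int[mu]_(x in P) F1 x.
  by rewrite /Rintegral fine_le//; exact: integrable_fin_num.
lra.
Qed.

Lemma continuous_enorm_sub (z : 'rV[R]_n) : continuous (fun x : 'rV[R]_n => enorm (x - z)).
Proof.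
move=> x; apply: (@continuous_comp _ _ _ (fun x : 'rV[R]_n => dotp (x - z) (x - z))); last first.
  exact: sqrt_continuous.
rewrite /dotp; elim: (index_enum _) => [|i l IH].
  rewrite (_ : (fun _ => _) = cst 0); first exact: cst_continuous.
  by apply/funext => y; rewrite big_nil.
rewrite (_ : (fun _ => _) = (fun y : 'rV[R]_n => (y - z) 0 i * (y - z) 0 i +
    \sum_(j <- l) (y - z) 0 j * (y - z) 0 j)); last first.
  by apply/funext => y; rewrite big_cons.
have c : {for x, continuous (fun y : 'rV[R]_n => (y - z) 0 i)}.
  rewrite (_ : (fun y : 'rV[R]_n => _) = (fun y => y 0 i - z 0 i)); last first.
    by apply/funext => y; rewrite !mxE.
  by apply: continuousB; [exact: coord_continuous|exact: cst_continuous].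
apply: (@continuousD _ _ _ (fun y : 'rV[R]_n => (y - z) 0 i * (y - z) 0 i)) => //.
exact: (@continuousM _ _ _ _ x).
Qed.

Lemma eball_measurable (z : 'rV[R]_n) (r : R) : measurable (eball z r : set T).
Proof.
apply: open_leb_measurable.
rewrite (_ : eball z r = (fun x : 'rV[R]_n => enorm (x - z)) @^-1` [set t | t < r])//.
apply: open_comp; last exact: open_lt.
by move=> x _; exact: continuous_enorm_sub.
Qed.

(** [C] is chosen before the domain, the data and the solution, all of which enter through the
    Morrey bound [M] only. Each partial derivative is estimated separately, hence the factor [n]. *)
Lemma gradient_decay (p g nu cH q al M : R) : (0 < n)%N ->
  1 < p -> p < g -> 0 < nu -> 0 < cH -> 0 < q -> 0 <= M ->
  al <= 1 - n%:R / (q * g) -> al <= (g - p) / (g - (p - 1)) ->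
  exists2 C : R, 0 <= C &
  forall Om lambda f A B u Du, open Om -> bounded_set Om -> 0 <= lambda ->
    let G x := f x + lambda * Num.max (u x) 0 in
    ae_in Om (fun x => forall s xi, enorm (A x s xi) <= nu * enorm xi `^ (p - 1)) ->
    ae_in Om (fun x => forall s xi,
      cH * enorm xi `^ g - lambda * s - f x <= B x s xi) ->
    W1_loc Om g u Du -> distributional_supersolution Om p A B u Du ->
    mu.-integrable (Om : set T) (EFin \o G) ->
    (forall z (r : R), Om z -> 0 < r <= ediam Om ->
      (\int[mu]_(x in eball z r `&` Om) `|G x|%:E <= (M * r `^ (n%:R - n%:R / q))%:E)%E) ->
    forall z (r : R), 0 < r <= 1 -> cube z ((2 * n%:R + 1) * r) `<=` Om ->
      \sum_i \int[mu]_(x in cube z r) `|Du x 0 i| <= C * r `^ (n.-1%:R + al).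
Proof.
move=> n0 p1 pg nu0 cH0 q0 M0 al1 al2.
have [m sm] : exists m : nat, (p - 1) / (g - (p - 1)) <= m%:R.
  by exists (Num.truncn ((p - 1) / (g - (p - 1)))).+1; exact/ltW/truncnS_gt.
set s := (p - 1) / (g - (p - 1)) in sm *.
pose c := cH / 2; have c0 : 0 < c by rewrite divr_gt0.
have c2 : 2 * c = cH by rewrite /c; field.
pose k : R := 2 * n%:R + 1; have k0 : 0 < k by rewrite ltr_wpDl ?mulr_ge0.
pose cY := c^-1 `^ s; have cY0 : 0 <= cY by exact: powR_ge0.
pose b0 := n%:R * nu * m.+1%:R * 4.
have b00 : 0 <= b0 by rewrite !mulr_ge0// ltW.
pose C := c^-1 * (M * k `^ (n%:R - n%:R / q) + cY * b0 `^ (1 + s) * 4 ^+ n) + 4 ^+ n.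
have C0 : 0 <= C.
  by rewrite addr_ge0 ?exprn_ge0// mulr_ge0 ?invr_ge0 ?(ltW c0)// addr_ge0// !mulr_ge0 ?powR_ge0 ?exprn_ge0.
exists (n%:R * C); first by rewrite mulr_ge0.
move=> Om lambda f A B u Du oOm bOm lam0 G hA hB [Lu LDu _] [[_ _ wg] LA LB test] iG hM z r r01 zOm.
have /andP[r0 r1] := r01.
have n1 : n.-1%:R = n%:R - 1 :> R by rewrite -{2}(prednK n0) -natr1 addrK.
rewrite n1 -mulrA mulr_natl -[X in _ *+ X]card_ord -sumr_const; apply: ler_sum => i _.
set P := cube z (2 * r).
have r2 : 0 <= 2 * r by rewrite mulr_ge0// ltW.
have POm : P `<=` Om.
  apply: subset_trans zOm; apply: cube_sub => //; rewrite subrr normr0 add0r ler_wpM2r ?(ltW r0)//.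
  have : 1 <= n%:R :> R by rewrite ler1n.
  by rewrite /k; lra.
have cP : compact P by exact: cube_compact.
have mP : measurable (P : set T) by exact: cube_measurable.
have muP : mu P = ((2 * (2 * r)) ^+ n)%:E by exact: cube_measure.
have Poo : (mu P < +oo)%E by rewrite muP ltry.
have mOm : measurable (Om : set T) by exact: open_leb_measurable.
pose t := r `^ (al - 1); have t0 : 0 < t by exact: powR_gt0.
pose phi := cutoff m r z.
have phiC : C1c Om phi by exact: cutoff_C1c.
have [dphi cdphi _ _] := phiC.
have cphi : continuous phi by move=> x; exact: differentiable_continuous.
have phi01 x : 0 <= phi x <= 1 by exact: cutoff_bound.
pose Bv x := B x (u x) (Du x); pose Av x := A x (u x) (Du x).
have iB : mu.-integrable P (EFin \o (fun x => Bv x * phi x)).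
  by apply: integrableM_continuous => //; apply: (@Lp_on_integrable _ _ _ 1) => //; exact: LB.
have p'1 : 1 <= p / (p - 1).
  by rewrite ler_pdivlMr ?subr_gt0//; lra.
have iAj j : mu.-integrable P (EFin \o (fun x => Av x 0 j * partial j phi x)).
  apply: integrableM_continuous => //; apply: (@Lp_on_integrable _ _ _ (p / (p - 1))) => //.
  exact: LA.
have iA : mu.-integrable P (EFin \o (fun x => dotp (Av x) (grad phi x))).
  have := @integrable_sum _ _ _ mu P mP _ (index_enum _) xpredT _ (fun j _ => iAj j).
  apply: eq_integrable => // x _.
  by rewrite /= sumEFin; congr EFin; apply: eq_bigr => j _; rewrite mxE.
have iD : mu.-integrable P (EFin \o (fun x => `|Du x 0 i|)).
  apply: integrable_norm; apply: (@Lp_on_integrable _ _ _ g) => //; first by lra.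
  exact: LDu.
have iDphi : mu.-integrable P (EFin \o (fun x => `|Du x 0 i| * phi x)).
  exact: integrableM_continuous.
have iGP : mu.-integrable P (EFin \o (fun x => `|G x|)).
  by apply: integrable_norm; exact: integrableS iG.
pose kk := cY * (b0 / r) `^ (1 + s) + c * t `^ (g - 1) * t.
have hae : {ae mu, forall x, P x -> 0 <= Bv x * phi x - dotp (Av x) (grad phi x) -
    c * t `^ (g - 1) * (`|Du x 0 i| * phi x) + `|G x| + kk}.
  rewrite /ae_in in hA hB; apply: filterS (filterI hA hB) => x [hAx hBx] Px.
  have Omx := POm _ Px.
  rewrite /phi cutoffE; apply: (@pointwise_caccioppoli _ _ (enorm (Du x)) _ _ _ _ _ p g nu) => //.
  - exact: cutoff_base_bound.
  - by rewrite normr_ge0 coord_le_enorm.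
  - exact: hAx Omx _ _.
  - by rewrite c2; exact: hBx Omx _ _.
  - by move=> j; rewrite mxE; exact: partial_cutoff_bound.
have hBA : (\int[mu]_(x in P) (Bv x * phi x)%:E <=
    \int[mu]_(x in P) (dotp (Av x) (grad phi x))%:E)%E.
  have := test phi phiC (fun x => proj1 (andP (phi01 x))).
  rewrite (integral_supp POm); last first.
    by move=> x xP; rewrite /phi cutoff_out ?mulr0.
  rewrite (integral_supp POm)//.
  move=> x xP; congr EFin; rewrite /dotp big1// => j _.
  by rewrite mxE /phi partial_cutoff_out ?mulr0.
have main := tested_inequality mP Poo iB iA iDphi iGP hBA hae.
apply: (@decay_arith _ _ _ M k c cY b0 s p g q al r) => //.
have fP : fine (mu P) = (4 * r) ^+ n.
  by rewrite muP /=; congr (_ ^+ _); ring.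
rewrite fP in main.
apply: (le_trans _ (le_trans main _)).
  apply: ler_wpM2l; first exact: (mulr_ge0 (ltW c0) (powR_ge0 _ _)).
  have QP : cube z r `<=` P.
    by apply: cube_sub; [exact: ltW|rewrite subrr normr0 add0r ler_peMl ?(ltW r0)// ler1n].
  rewrite /Rintegral fine_le//.
  - exact: (integrable_fin_num (cube_measurable _ _) (integrableS mP (cube_measurable _ _) QP iD)).
  - exact: (integrable_fin_num mP iDphi).
  rewrite (@eq_integral _ _ _ mu _ (EFin \o (fun x => `|Du x 0 i| * phi x))); last first.
    move=> x /set_mem /(cubeP _ _ (ltW r0)) xz; rewrite /= /phi cutoff_eq1 ?mulr1// => j.
    have := le_trans (coord_le_norm _ j) xz; rewrite !mxE ler_norml.
    by move=> /andP[]; lra.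
  apply: ge0_subset_integral => //; first exact: cube_measurable.
    exact: measurable_int iDphi.
  by move=> x _; rewrite lee_fin mulr_ge0//; case/andP: (phi01 x).
apply: lerD => //.
have Omz : Om z by apply: zOm; apply/cubeP; rewrite ?subrr ?normr0 ?mulr_ge0// ltW.
have kr0 : 0 < k * r by exact: mulr_gt0.
(* The Morrey bound is used on the Euclidean ball of radius [k * r], which contains [P]. The
   enlarged cube lies in [Om], so this radius is at most the diameter. *)
have hz := hM z (k * r) Omz _.
rewrite -lee_fin; apply: le_trans (hz _); last first.
  by rewrite kr0 (cube_ediam n0 kr0 bOm zOm).
rewrite /Rintegral fineK; last exact: (integrable_fin_num mP iGP).
have mE : measurable (eball z (k * r) `&` Om : set T).
  by apply: measurableI => //; exact: eball_measurable.
apply: (@ge0_subset_integral _ _ _ mu _ _ mP mE).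
- have iGE : mu.-integrable (eball z (k * r) `&` Om : set T) (EFin \o (fun x => `|G x|)).
    by apply: integrable_norm; exact: integrableS iG.
  exact: measurable_int iGE.
- by move=> x _; rewrite lee_fin.
- by move=> x Px; split; [exact: cube_sub_eball|exact: POm].
Qed.

End Decay.

(** * Morrey norms *)

Lemma powR_subK {R : realType} (r a b : R) : 0 < r -> r `^ (a - b) * r `^ (b - a) = 1.
Proof.
move=> r0; rewrite -powRD; last by rewrite (gt_eqF r0) implybT.
by rewrite addrC subrKA subrr powRr0.
Qed.

Section Morrey.
Context {R : realType} {n : nat}.
Notation mu := (@leb R n).
Notation T := (leb_type R n).
Implicit Types (D : set 'rV[R]_n) (h : 'rV[R]_n -> R).

Lemma Lp_on1P D h : measurable (D : set T) -> Lp_on D 1 h <-> mu.-integrable D (EFin \o h).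
Proof.
move=> mD; rewrite /Lp_on; split.
  move=> /Lfun1_integrable hD; apply/(integrable_mkcond _ mD).2.
  by rewrite restrict_EFin.
move=> hD; apply/Lfun1_integrable.
by have := (integrable_mkcond _ mD).1 hD; rewrite restrict_EFin.
Qed.

Lemma Lp_norm_on1 D h : Lp_norm_on D 1 h = (\int[mu]_(x in D) `|h x|%:E)%E.
Proof.
rewrite /Lp_norm_on Lnorm1 [RHS]integral_mkcond; apply: eq_integral => x _ /=.
by rewrite /patch; case: ifP => _; rewrite ?normr0.
Qed.

Lemma integral_abs_powR1 D h :
  (\int[mu]_(x in D) (`|h x| `^ 1)%:E = \int[mu]_(x in D) `|h x|%:E)%E.
Proof. by apply: eq_integral => x _; rewrite powRr1. Qed.

Lemma morreyD D (th : R) f h : measurable (D : set T) ->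
  morrey D 1 th f -> morrey D 1 th h -> morrey D 1 th (fun x => f x + h x).
Proof.
move=> mD [/(Lp_on1P _ mD) if_ [C1 C1P]] [/(Lp_on1P _ mD) ih [C2 C2P]].
have ifh : mu.-integrable (D : set T) (EFin \o (fun x => f x + h x)).
  by have := integrableD mD if_ ih; apply: eq_integrable.
split; first exact/Lp_on1P.
exists (C1 + C2) => z r Dz r0.
have mE : measurable (eball z r `&` D : set T).
  by apply: measurableI => //; exact: eball_measurable.
have iE k : mu.-integrable D (EFin \o k) ->
    mu.-integrable (eball z r `&` D : set T) (EFin \o (fun x => `|k x|)).
  by move=> ik; apply: integrable_norm; apply: integrableS ik.
rewrite integral_abs_powR1 mulrDl EFinD.
apply: le_trans (leeD (C1P z r Dz r0) (C2P z r Dz r0)).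
rewrite !integral_abs_powR1.
have e := @ge0_integralD _ _ _ mu _ mE (EFin \o (fun x => `|f x|)) (EFin \o (fun x => `|h x|))
  (fun x _ => normr_ge0 (f x)) (measurable_int _ (iE _ if_))
  (fun x _ => normr_ge0 (h x)) (measurable_int _ (iE _ ih)).
rewrite -[leRHS]e; apply: (@ge0_le_integral _ _ _ mu _ mE).
- by move=> x _; rewrite lee_fin.
- exact: measurable_int (iE _ ifh).
- by have := integrableD mE (iE _ if_) (iE _ ih) => /(measurable_int _).
- by move=> x _; rewrite -EFinD lee_fin ler_normD.
Qed.

Lemma morrey_normP D (th : R) h : morrey D 1 th h ->
  let M := fine (morrey_norm D 1 th h) in 0 <= M /\
  forall z (r : R), D z -> 0 < r <= ediam D ->
    (\int[mu]_(x in eball z r `&` D) `|h x|%:E <= (M * r `^ (n%:R - th))%:E)%E.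
Proof.
move=> [_ [C CP]] /=; rewrite /morrey_norm; set S := [set t | _].
have Sle : (ereal_sup S <= C%:E)%E.
  apply: ge_ereal_sup => _ [z [r [Dz r0 ->]]]; rewrite Lp_norm_on1 divr1.
  have := CP z r Dz r0; rewrite integral_abs_powR1 => h1.
  have rp : 0 < r by case/andP: r0.
  apply: (@le_trans _ _ ((r `^ (th - n%:R))%:E * (C * r `^ (n%:R - th))%:E)%E).
    by apply: lee_wpmul2l => //; rewrite lee_fin powR_ge0.
  by rewrite -EFinM lee_fin mulrCA (powR_subK _ _ rp) mulr1.
have S_ge0 t : S t -> (0 <= t)%E.
  case=> z1 [r1 [_ _ ->]]; apply: mule_ge0; first by rewrite lee_fin powR_ge0.
  by rewrite Lp_norm_on1; apply: integral_ge0 => x _; rewrite lee_fin.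
split.
  (* Without an admissible ball the supremum is minus infinity, which [fine] sends to 0. *)
  have [->|/set0P[t St]] := eqVneq S set0; first by rewrite ereal_sup0.
  by apply: fine_ge0; apply: le_trans (S_ge0 _ St) _; exact: ereal_sup_ubound.
move=> z r Dz r0; have rp : 0 < r by case/andP: r0.
have St : S ((r `^ (th - n%:R))%:E * \int[mu]_(x in eball z r `&` D) `|h x|%:E)%E.
  by exists z, r; split => //; rewrite Lp_norm_on1 divr1.
have Sf : ereal_sup S \is a fin_num.
  rewrite ge0_fin_numE; first exact: le_lt_trans Sle (ltry _).
  by apply: le_trans (S_ge0 _ St) _; exact: ereal_sup_ubound.
have := ereal_sup_ubound St; rewrite -(fineK Sf) => hS.
rewrite EFinM -(@lee_pmul2l _ ((r `^ (th - n%:R))%:E))//; last by rewrite lte_fin powR_gt0.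
by apply: (le_trans hS); rewrite -!EFinM lee_fin mulrCA (powR_subK _ _ rp) mulr1.
Qed.

End Morrey.

(** * Membership of L^q in the Morrey space *)

Section LqMorrey.
Context {R : realType} {n : nat}.
Notation mu := (@leb R n).
Notation T := (leb_type R n).

Lemma bounded_leb_lty (D : set 'rV[R]_n) : bounded_set D -> measurable (D : set T) ->
  (mu D < +oo)%E.
Proof.
move=> [B [_ BP]] mD; pose r := `|B| + 1.
have r0 : 0 <= r by rewrite addr_ge0.
apply: (@le_lt_trans _ _ (mu (cube 0 r : set T))); last by rewrite (cube_measure _ r0) ltry.
apply: le_measure; rewrite ?inE//; first exact: cube_measurable.
move=> x Dx; apply/(cubeP _ _ r0); rewrite subr0; apply: BP => //.
by rewrite /r (le_lt_trans (ler_norm B))// ltrDl.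
Qed.

Lemma eball_sub_cube (z : 'rV[R]_n) (r : R) : 0 <= r -> eball z r `<=` cube z r.
Proof.
move=> r0 x /ltW xz; apply/(cubeP _ _ r0)/rV_normP => // i.
exact: le_trans (coord_le_enorm _ i) xz.
Qed.

Lemma le_powR_scaled (a t q : R) : 0 <= a -> 0 < t -> 1 <= q -> a <= t `^ (1 - q) * a `^ q + t.
Proof.
move=> a0 t0 q1; rewrite -lerBlDr.
have h := linear_le_powR a0 t0 q1.
have tp : 0 <= t `^ (1 - q) by exact: powR_ge0.
by have := ler_wpM2l tp h; rewrite mulrA (powR_subK _ _ t0) mul1r.
Qed.

Lemma Lp_on_morrey (D : set 'rV[R]_n) (q : R) h : open D -> bounded_set D -> 1 <= q ->
  Lp_on D q h -> morrey D 1 (n%:R / q) h.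
Proof.
move=> oD bD q1 hq; have q0 : 0 < q by lra.
have mD : measurable (D : set T) by exact: open_leb_measurable.
have Doo := bounded_leb_lty bD mD.
have ih := Lp_on_integrable q1 mD Doo hq.
have ihq : mu.-integrable (D : set T) (EFin \o (fun x => `|h x| `^ q)).
  apply/(integrable_mkcond _ mD).2; have := Lfun_integrable q1 hq.
  apply: eq_integrable => // x _; rewrite /= !patchE; case: ifP => // _.
  by rewrite normr0 powR0// gt_eqF.
split; first exact/(Lp_on1P _ mD).
pose I := \int[mu]_(x in D) (`|h x| `^ q); exists (I + 2 ^+ n) => z r Dz /andP[r0 _].
rewrite integral_abs_powR1.
pose E := eball z r `&` D.
have mE : measurable (E : set T) by apply: measurableI => //; exact: eball_measurable.
have ED : E `<=` D by move=> x [].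
have Eoo : (mu (E : set T) <= ((2 * r) ^+ n)%:E)%E.
  rewrite -(cube_measure z (ltW r0)); apply: le_measure; rewrite ?inE//.
    exact: cube_measurable.
  by move=> x [xz _]; exact: eball_sub_cube (ltW r0) _ xz.
have iE : mu.-integrable (E : set T) (EFin \o (fun x => `|h x|)).
  by apply: integrable_norm; exact: integrableS ih.
have iEq : mu.-integrable (E : set T) (EFin \o (fun x => `|h x| `^ q)).
  exact: integrableS ihq.
(* This threshold balances the two terms of [le_powR_scaled]: its power [1 - q] is [r^(n-n/q)], and
   [t] times the volume of the ball is at most a constant times the same power. *)
pose t := r `^ (- (n%:R / q)); have t0 : 0 < t by exact: powR_gt0.
have ict := integrable_mulrl (t `^ (1 - q)) mE iEq.
have it : mu.-integrable (E : set T) (EFin \o (fun=> t)).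
  apply: measurable_bounded_integrable => //; last exact: bounded_cst.
  exact: le_lt_trans Eoo (ltry _).
rewrite -[leLHS](fineK (integrable_fin_num mE iE)) lee_fin.
have ist : mu.-integrable (E : set T) (EFin \o (fun x => t `^ (1 - q) * `|h x| `^ q + t)).
  by have := integrableD mE ict it; apply: eq_integrable.
apply: (@le_trans _ _ (\int[mu]_(x in E) (t `^ (1 - q) * `|h x| `^ q + t))).
  by apply: le_Rintegral => // x _; exact: le_powR_scaled.
rewrite (RintegralD mE ict it) (RintegralZl _ mE iEq) (Rintegral_cst mu mE t) mulrDl.
apply: lerD.
  rewrite [leRHS]mulrC (_ : t `^ (1 - q) = r `^ (n%:R - n%:R / q)); last first.
    by rewrite -powRrM; congr (_ `^ _); field; rewrite gt_eqF.
  apply: ler_wpM2l; first exact: powR_ge0.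
  rewrite /I /Rintegral fine_le//; [exact: integrable_fin_num..|].
  apply: (@ge0_subset_integral _ _ _ mu _ _ mE mD).
  - exact: measurable_int ihq.
  - by move=> x _; rewrite lee_fin powR_ge0.
  - exact: ED.
have -> : r `^ (n%:R - n%:R / q) = t * r ^+ n.
  rewrite -(powR_mulrn _ (ltW r0)) -powRD; first by rewrite addrC.
  by rewrite (gt_eqF r0) implybT.
rewrite mulrCA -exprMn ler_wpM2l ?(ltW t0)// -lee_fin fineK//.
by rewrite ge0_fin_numE// (le_lt_trans Eoo)// ltry.
Qed.

End LqMorrey.

(** [M] is the value of the Morrey norm and [K] is fixed right after it: the interior constant [M']
    is determined by then, and the passage to the closure is uniform over the class that [M']
    defines. *)
Lemma holder_of_morrey {R : realType} {n : nat} (Om : set 'rV[R]_n)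
    (p g nu cH q al M : R) : (0 < n)%N ->
  open Om -> bounded_set Om -> connected Om -> lipschitz_boundary Om ->
  1 < p -> p < g -> 0 < nu -> 0 < cH -> 0 < q -> 0 <= M -> 0 < al <= 1 ->
  al <= 1 - n%:R / (q * g) -> al <= (g - p) / (g - (p - 1)) ->
  exists K : R, forall lambda f A B u Du, 0 <= lambda ->
    let h x := f x + lambda * Num.max (u x) 0 in
    ae_in Om (fun x => forall s xi, enorm (A x s xi) <= nu * enorm xi `^ (p - 1)) ->
    ae_in Om (fun x => forall s xi,
      cH * enorm xi `^ g - lambda * s - f x <= B x s xi) ->
    W1_loc Om g u Du -> distributional_supersolution Om p A B u Du ->
    morrey Om 1 (n%:R / q) h -> fine (morrey_norm Om 1 (n%:R / q) h) = M ->
    holder_up_to_boundary Om u K al.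
Proof.
move=> n0 oOm bOm cOm lip p1 pg nu0 cH0 q0 M0 al01 al1 al2; have /andP[al0 _] := al01.
have [C C0 decay] := gradient_decay n0 p1 pg nu0 cH0 q0 M0 al1 al2.
pose k : R := 2 * n%:R + 1.
have k1 : 1 <= k by rewrite lerDr mulr_ge0.
pose M' := C * 3 `^ (n.-1%:R + al) * (1 + 2 / (1 - 2^-1 `^ al)) * 2 `^ al.
have M'0 : 0 <= M'.
  apply: mulr_ge0; last exact: powR_ge0.
  apply: mulr_ge0; first by apply: mulr_ge0 => //; exact: powR_ge0.
  apply: addr_ge0 => //; apply: divr_ge0 => //; rewrite subr_ge0.
  have h : 0 < (2^-1 : R) <= 1 by rewrite invr_gt0 ltr0n/= invf_le1// ler1n.
  by have := ger_powR h (ltW al0); rewrite powRr0.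
have kp1 : 1 <= 8 * k by lra.
have [K K0 glob] := global_holder oOm bOm cOm lip al0 M'0 kp1.
exists K => lambda f A B u Du lam0 h hA hB hu hsup hh hM.
have [Lu LDu wg] := hu.
have mOm : measurable (Om : set (leb_type R n)) by exact: open_leb_measurable.
have g1 : 1 <= g by lra.
have ih : (@leb R n).-integrable (Om : set (leb_type R n)) (EFin \o h).
  by have [/(Lp_on1P _ mOm)] := hh.
have [_ hball] := morrey_normP hh; rewrite hM in hball.
have dec := decay Om lambda f A B u Du oOm bOm lam0 hA hB hu hsup ih hball.
have lty (L : set 'rV[R]_n) : compact L -> (@leb R n L < +oo)%E.
  move=> cL; apply: bounded_leb_lty; first exact: compact_bounded.
  exact: compact_leb_measurable.
have iu (L : set 'rV[R]_n) : compact L -> L `<=` Om -> (@leb R n).-integrable L (EFin \o u).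
  move=> cL LOm; apply: (Lp_on_integrable g1 (compact_leb_measurable cL) (lty _ cL)).
  exact: Lu.
have iDu (L : set 'rV[R]_n) i : compact L -> L `<=` Om ->
    (@leb R n).-integrable L (EFin \o (fun x => Du x 0 i)).
  move=> cL LOm; apply: (Lp_on_integrable g1 (compact_leb_measurable cL) (lty _ cL)).
  exact: LDu.
have [v [vu vH]] := interior_holder oOm wg iu iDu C0 al0 k1 dec.
have vcls : interior_holder_on Om al M' (8 * k) v by exact: vH.
have [w [wv wH]] := holder_extension K0 al01 (glob v vcls).
exists w; split.
  by rewrite /ae_in in vu *; apply: filterS vu => x vux Omx; rewrite wv// vux.
move=> x y _ _; apply: (le_trans (wH x y)); apply: ler_wpM2l => //.
have xy : `|x - y| <= enorm (x - y).
  by apply/rV_normP => [|i]; [exact: enorm_ge0|exact: coord_le_enorm].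
by apply: ge0_ler_powR => //; rewrite ?nnegrE ?enorm_ge0 ?(ltW al0).
Qed.

Unset Implicit Arguments.

Theorem theorem1p1 (R : realType) (N : nat) (hN : (1 < N)%N)
    (Omega : set 'rV[R]_N)
    (hopen : open Omega) (hbounded : bounded_set Omega)
    (hconnected : connected Omega)
    (hlip : lipschitz_boundary Omega)
    (hsphere : uniform_interior_sphere Omega)
    (p gamma nu cH q : R)
    (hp : 1 < p) (hgamma : p < gamma) (hnu : 0 < nu) (hcH : 0 < cH)
    (hq1 : 1 <= q) (hq : N%:R / gamma < q) :
  let alpha :=
    Num.min (1 - N%:R / (q * gamma)) ((gamma - p) / (gamma - (p - 1))) in
  exists K : \bar R -> R,
  forall (lambda : R) (f : 'rV[R]_N -> R)
    (A : 'rV[R]_N -> R -> 'rV[R]_N -> 'rV[R]_N)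
    (B1 : 'rV[R]_N -> R -> 'rV[R]_N -> R)
    (u : 'rV[R]_N -> R) (Du : 'rV[R]_N -> 'rV[R]_N),
  let lu := fun x => lambda * Num.max (u x) 0 in
  let Kest := K (morrey_norm Omega 1 (N%:R / q) (fun x => f x + lu x)) in
  0 <= lambda ->
  caratheodory_fun Omega A ->
  ae_in Omega (fun x => forall s xi,
    enorm (A x s xi) <= nu * enorm xi `^ (p - 1)) ->
  ae_in Omega (fun x => forall s xi,
    cH * enorm xi `^ gamma - lambda * s - f x <= B1 x s xi) ->
  W1_loc Omega gamma u Du ->
  distributional_supersolution Omega p A B1 u Du ->
  (morrey Omega 1 (N%:R / q) f -> morrey Omega 1 (N%:R / q) lu ->
     holder_up_to_boundary Omega u Kest alpha) /\
  (Lp_on Omega q f -> Lp_on Omega q lu ->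
     holder_up_to_boundary Omega u Kest alpha).
Proof.
move=> alpha.
have q0 : 0 < q by lra.
have g0 : 0 < gamma by lra.
have d0 : 0 < gamma - (p - 1) by lra.
have al1 : alpha <= 1 - N%:R / (q * gamma) by rewrite /alpha ge_min lexx.
have al2 : alpha <= (gamma - p) / (gamma - (p - 1)) by rewrite /alpha ge_min lexx orbT.
(* Positivity of the first term is exactly [q > N / gamma], that of the second comes from
   [gamma > p]. *)
have al01 : 0 < alpha <= 1.
  apply/andP; split; last first.
    by apply: (le_trans al2); rewrite ler_pdivrMr// mul1r; lra.
  rewrite lt_min; apply/andP; split; last by rewrite divr_gt0// subr_gt0.
  by rewrite subr_gt0 ltr_pdivrMr ?mul1r ?mulr_gt0// -ltr_pdivrMr.
have N0 : (0 < N)%N by exact: ltnW.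
(* The constant may depend on the norm but not on the solution, so one is found for each value [t],
   and [choice] assembles them into a function. The guard excludes the negative values, which [fine]
   of the norm of a Morrey function never takes. *)
have Kex (t : \bar R) : exists K : R, 0 <= fine t ->
    forall lambda f A B u Du, 0 <= lambda ->
    let h x := f x + lambda * Num.max (u x) 0 in
    ae_in Omega (fun x => forall s xi, enorm (A x s xi) <= nu * enorm xi `^ (p - 1)) ->
    ae_in Omega (fun x => forall s xi,
      cH * enorm xi `^ gamma - lambda * s - f x <= B x s xi) ->
    W1_loc Omega gamma u Du -> distributional_supersolution Omega p A B u Du ->
    morrey Omega 1 (N%:R / q) h -> fine (morrey_norm Omega 1 (N%:R / q) h) = fine t ->
    holder_up_to_boundary Omega u K alpha.
  have [t0|_] := leP 0 (fine t); last by exists 0.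
  have [K HK] := holder_of_morrey N0 hopen hbounded hconnected hlip hp hgamma hnu hcH q0 t0
    al01 al1 al2.
  by exists K.
have [K HK] := choice Kex.
exists K => lambda f A B u Du lu Kest lam0 _ hA hB hu hsup.
have mOm : measurable (Omega : set (leb_type R N)) by exact: open_leb_measurable.
have main : morrey Omega 1 (N%:R / q) f -> morrey Omega 1 (N%:R / q) lu ->
    holder_up_to_boundary Omega u Kest alpha.
  move=> mf mlu; have mh := morreyD mOm mf mlu.
  have [t0 _] := morrey_normP mh.
  exact: (HK _ t0 lambda f A B u Du lam0 hA hB hu hsup mh erefl).
by split=> // hf hlu; apply: main; exact: Lp_on_morrey.
Qed.
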